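(* Let $k$ be a non-zero commutative ring. Every elementary amenable group $G$ with $\mathrm{hd}_k(G)\le 1$ is a filtered colimit of groups of cohomological dimension $\le 1$ over $k$; that is, $G\cong\varinjlim G_\lambda$ for some filtered colimit system of groups $(G_\lambda)$ with $\mathrm{cd}_k(G_\lambda)\le 1$ for all $\lambda$.
   Context: The class of elementary amenable groups is the smallest class of groups containing all finite and all abelian groups and closed under extensions and directed unions. The homological dimension $\mathrm{hd}_k(G)$ (respectively cohomological dimension $\mathrm{cd}_k(G)$) is the least integer $m$ such that $H_{m+1}(G,M)=0$ (respectively $H^{m+1}(G,M)=0$) for all $kG$-modules $M$, or $\infty$ if no such $m$ exists. A filtered colimit system is a colimit system indexed by a filtered category. The maps in the system are arbitrary group homomorphisms (not necessarily injective), and the groups $G_\lambda$ are not required to be amenable. *)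

(* Defs.v *)
From HB Require Import structures.
From mathcomp Require Import all_boot all_algebra.
From mathcomp Require Import finmap.
From mathcomp.multinomials Require Import monalg.
From mathcomp.classical Require Import boolp.

Set Implicit Arguments.
Unset Strict Implicit.
Unset Printing Implicit Defensive.

Import GRing.Theory.
Local Open Scope ring_scope.

(* Groups, possibly infinite, are objects of [groupType].  Between groups,
   {multiplicative G -> H} is the type of group homomorphisms: preservation
   of 1 and of inverses follows. *)

(** * Elementary amenable groups *)

Inductive elementary_amenable : groupType -> Prop :=
| ea_finite (G : groupType) (s : seq G) :
    (forall x : G, x \in s) -> elementary_amenable G
| ea_abelian (G : groupType) :
    (forall x y : G, (x * y = y * x)%g) -> elementary_amenable G
(* short exact sequences 1 -> N -> G -> Q -> 1 *)
| ea_extension (N G Q : groupType)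
    (f : {multiplicative N -> G}) (p : {multiplicative G -> Q}) :
    injective f ->
    (forall q : Q, exists x : G, p x = q) ->
    (forall x : G, p x = 1%g <-> exists n : N, f n = x) ->
    elementary_amenable N -> elementary_amenable Q -> elementary_amenable G
(* The subgroups of the directed family are the images of the embeddings [f].
   The index type is nonempty because these images cover G. *)
| ea_directed_union (G : groupType) (I : Type) (H : I -> groupType)
    (f : forall i : I, {multiplicative H i -> G}) :
    (forall i : I, injective (f i)) ->
    (forall i j : I, exists l : I,
       (forall x : H i, exists z : H l, f l z = f i x) /\
       (forall y : H j, exists z : H l, f l z = f j y)) ->
    (forall x : G, exists (i : I) (y : H i), f i y = x) ->
    (forall i : I, elementary_amenable (H i)) -> elementary_amenable G.

(** * Group homology and cohomology *)

(* Left kG-modules, as k-modules with a k-linear action of G. *)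
Record gmodule (k : comNzRingType) (G : groupType) := GModule {
  gmod_sort :> lmodType k;
  gact : G -> {linear gmod_sort -> gmod_sort};
  gact1 : forall m : gmod_sort, gact 1%g m = m;
  gactM : forall (g h : G) (m : gmod_sort), gact (g * h)%g m = gact g (gact h m)
}.

(* The faces of [g_0 | ... | g_n], for 0 <= i <= n + 1:
     face 0 g       = [g_1 | ... | g_n],
     face i g       = [g_0 | ... | g_(i-1) * g_i | ... | g_n]  (0 < i <= n),
     face (n + 1) g = [g_0 | ... | g_(n-1)]. *)
Definition face (G : groupType) (n : nat) (i : 'I_n.+2)
    (g : {ffun 'I_n.+1 -> G}) : {ffun 'I_n -> G} :=
  [ffun j : 'I_n =>
     let a := g (widen_ord (leqnSn n) j) in
     let b := g (lift ord0 j) in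
     if (j.+1 < i)%N then a else if j.+1 == i :> nat then (a * b)%g else b].

(* n-chains of the bar complex with coefficients in M: finite formal sums of
   terms m * [g_1 | ... | g_n].  This is B_n (x)_{kG} M, where B_n is the n-th
   term of the unnormalized bar resolution of k, and where the left module
   B_n is turned into a right one by inversion in G. *)
Definition chain (k : comNzRingType) (G : groupType) (M : gmodule k G)
    (n : nat) : Type := {malg M[{ffun 'I_n -> G}]}.

(* On generators, d(m * [g_0 | ... | g_n]) =
     (g_0^-1 m) * [g_1 | ... | g_n]
       + \sum_(1 <= i <= n + 1) (-1)^i m * face i [g_0 | ... | g_n]. *)
Definition bar_d (k : comNzRingType) (G : groupType) (M : gmodule k G)
    (n : nat) (c : chain M n.+1) : chain M n :=
  \sum_(g <- msupp c) \sum_(i < n.+2)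
    << (-1) ^+ i *: (if i == ord0 then gact M (g ord0)^-1%g (mcoeff g c)
                     else mcoeff g c) *g face i g >>.

(* The homology of the bar complex vanishes in the positive degree n + 1. *)
Definition homology_vanishes (k : comNzRingType) (G : groupType)
    (M : gmodule k G) (n : nat) : Prop :=
  forall c : chain M n.+1,
    bar_d c = 0 -> exists b : chain M n.+2, bar_d b = c.

Definition cochain (k : comNzRingType) (G : groupType) (M : gmodule k G)
    (n : nat) : Type := {ffun 'I_n -> G} -> M.

Definition cobar_d (k : comNzRingType) (G : groupType) (M : gmodule k G)
    (n : nat) (f : cochain M n) : cochain M n.+1 :=
  fun g => \sum_(i < n.+2)
    (-1) ^+ i *: (if i == ord0 then gact M (g ord0) (f (face i g))
                  else f (face i g)).

(* The cohomology of the bar complex vanishes in the positive degree n + 1. *)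
Definition cohomology_vanishes (k : comNzRingType) (G : groupType)
    (M : gmodule k G) (n : nat) : Prop :=
  forall f : cochain M n.+1,
    (forall g, cobar_d f g = 0) ->
    exists h : cochain M n, forall g, cobar_d h g = f g.

(** * Homological and cohomological dimension *)

(* Dimensions take values in the natural numbers extended by None, which
   stands for infinity.  Negative values are excluded anyway for k non-zero,
   since both H_0(G, k) and H^0(G, k) are k. *)
Definition least (P : nat -> Prop) : option nat :=
  if pselect (exists n, `[< P n >]) is left exP then Some (ex_minn exP)
  else None.

Definition dim_le (d : option nat) (n : nat) : bool :=
  if d is Some m then (m <= n)%N else false.

Definition hd (k : comNzRingType) (G : groupType) : option nat :=
  least (fun m => forall M : gmodule k G, homology_vanishes M m).

Definition cd (k : comNzRingType) (G : groupType) : option nat :=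
  least (fun m => forall M : gmodule k G, cohomology_vanishes M m).

(** * Filtered colimits of groups *)

Record category := Category {
  obj :> Type;
  hom : obj -> obj -> Type;
  idm : forall i : obj, hom i i;
  comp : forall i j l : obj, hom j l -> hom i j -> hom i l;
  comp1m : forall (i j : obj) (u : hom i j), comp (idm j) u = u;
  compm1 : forall (i j : obj) (u : hom i j), comp u (idm i) = u;
  compA : forall (i j l m : obj) (w : hom l m) (v : hom j l) (u : hom i j),
    comp w (comp v u) = comp (comp w v) u
}.

Definition filtered (I : category) : Prop :=
  [/\ exists i : I, True,
      forall i j : I, exists l : I, inhabited (hom i l) /\ inhabited (hom j l) &
      forall (i j : I) (u v : hom i j),
        exists (l : I) (w : hom j l), comp w u = comp w v].

(* functors from I to the category of groups *)
Record group_system (I : category) := GroupSystem {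
  sys_obj :> I -> groupType;
  sys_map : forall i j : I,
    hom i j -> {multiplicative sys_obj i -> sys_obj j};
  sys_map1 : forall (i : I) (x : sys_obj i), sys_map (idm i) x = x;
  sys_mapM : forall (i j l : I) (v : hom j l) (u : hom i j) (x : sys_obj i),
    sys_map (comp v u) x = sys_map v (sys_map u x)
}.

Definition is_cocone (I : category) (D : group_system I) (G : groupType)
    (iota : forall i : I, {multiplicative D i -> G}) : Prop :=
  forall (i j : I) (u : hom i j) (x : D i), iota j (sys_map D u x) = iota i x.

Definition is_colimit (I : category) (D : group_system I) (G : groupType)
    (iota : forall i : I, {multiplicative D i -> G}) : Prop :=
  is_cocone iota /\
  forall (H : groupType) (f : forall i : I, {multiplicative D i -> H}),
    is_cocone f ->
    exists u : {multiplicative G -> H},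
      (forall (i : I) (x : D i), u (iota i x) = f i x) /\
      (forall v : {multiplicative G -> H},
         (forall (i : I) (x : D i), v (iota i x) = f i x) -> v =1 u).

(* Main.v *)
Require Import Defs.
From HB Require Import structures.
From mathcomp Require Import all_boot all_order all_algebra ssrAC.
From mathcomp Require Import finmap.
From mathcomp.multinomials Require Import monalg.
From mathcomp Require Import monoid fingroup.
From mathcomp Require pgroup.
From mathcomp.classical Require Import boolp functions.
From mathcomp Require Import ring lra zify.

Set Implicit Arguments.
Unset Strict Implicit.
Unset Printing Implicit Defensive.
Import Order.TTheory GRing.Theory Num.Theory.

(** Let hd_k(G) <= 1.  For a G-set X, vanishing of H_2 with coefficients in
    Fun(X, k) / k makes H_1(G, k) -> H_1(G, Fun(X, k)) injective, so that a group
    element h whose constant chain 1[h] bounds in Fun(X, k) is killed by all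
    homomorphisms to quotients of k.  For a cyclic group of prime order p acting
    on itself this forces p to be invertible in k.  For a group of affine maps of
    the rationals generated by x + 1 and m x / n, up to torsion, it is a
    contradiction.  By induction along the construction of an elementary amenable
    group, every finitely generated subgroup of G therefore has a subgroup of
    finite index which maps to the integers with locally finite kernel; by
    transfer it then acts on the integers by isometries with locally finite
    kernel.

    A finite set of relations of such a subgroup already holds in an HNN
    extension or an amalgam of finite groups of invertible order.  These have
    cd_k <= 1: in an extension by a module the finite groups lift, any two lifts
    are conjugate, and so the stable letter or the amalgamated subgroup can be
    adjusted.  G is the filtered colimit, over the finite sets s of valid
    relations between its elements which have this lifting property, of the
    groups presented by s on all elements of G as letters. *)

Local Open Scope group_scope.

(** * Subgroups and finite subgroups *)

Section Subgroups.
Variable G : groupType.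
Implicit Types (P : G -> Prop) (x y : G).

(** An infinite locally finite kernel is the obstacle: over the rationals the lamplighter group, the
    wreath product of Z/2 by Z, has homological dimension 1 but cohomological dimension 2, so
    finitely generated subgroups of G cannot always serve in the colimit. A finite list of relations
    sees only a finite subgroup P of the kernel. Conjugation by a translation need not preserve P;
    what survives of it is the partial conjugation of an HNN extension. With reflections one gets an
    amalgam of two finite groups instead. These groups map to G, in general not injectively. The
    coefficients come from 0 -> k -> Fun(X, k) -> Fun(X, k) / k -> 0. The map m x / n arises when t
    normalizes a non-torsion subgroup of rank one: lengths relative to one non-torsion element are
    rational numbers, and t rescales them. The action on the integers is x -> c(h) + eps(h) x; the
    sign is unavoidable, since infinite dihedral groups occur when 2 is invertible. *)

Definition subgroup P :=
  [/\ P 1, forall x y, P x -> P y -> P (x * y) & forall x, P x -> P x^-1].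

Lemma subgroup1 P : subgroup P -> P 1. Proof. by case. Qed.
Lemma subgroupM P x y : subgroup P -> P x -> P y -> P (x * y).
Proof. by case=> _ + _; apply. Qed.
Lemma subgroupV P x : subgroup P -> P x -> P x^-1.
Proof. by case=> _ _; apply. Qed.
Lemma subgroupX P x n : subgroup P -> P x -> P (x ^+ n).
Proof.
move=> sP Px; elim: n => [|n IH]; first exact: subgroup1.
by rewrite expgS; apply: subgroupM.
Qed.
Lemma subgroupVr P x : subgroup P -> P x^-1 -> P x.
Proof. by move=> sP /(subgroupV sP); rewrite invgK. Qed.
Lemma subgroupMr P x y : subgroup P -> P y -> P (x * y) -> P x.
Proof. by move=> sP Py Pxy; rewrite -(mulgK y x); apply: subgroupM _ (subgroupV _ Py). Qed.
Lemma subgroupI P Q : subgroup P -> subgroup Q -> subgroup (fun x => P x /\ Q x).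
Proof.
move=> sP sQ; split=> [|x y [Px Qx] [Py Qy]|x [Px Qx]].
- by split; apply: subgroup1.
- by split; apply: subgroupM.
- by split; apply: subgroupV.
Qed.
Lemma subgroup_conj P (g : G) : subgroup P -> subgroup (fun x => P (g * x * g^-1)).
Proof.
move=> sP; split=> [|x y Px Py|x Px]; first by rewrite mulg1 mulgV; apply: subgroup1.
- by have := subgroupM sP Px Py; rewrite !mulgA mulgVK.
- by have := subgroupV sP Px; rewrite !invgM invgK mulgA.
Qed.

Definition sgpred P : {pred G} := fun x => `[< P x >].
Fact sgpred_closed P : subgroup P -> group_closed (sgpred P).
Proof.
move=> sP; split=> [|x y /asboolP Px /asboolP Py]; apply/asboolP.
  exact: subgroup1.
by apply: subgroupM => //; apply: subgroupV.
Qed.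
(* The unused argument [sP] lets the group structure be inferred from the type. *)
Record sgtype P (sP : subgroup P) := SGtype { sgval : G; _ : sgpred P sgval }.
HB.instance Definition _ P (sP : subgroup P) := [isSub for @sgval P sP].
HB.instance Definition _ P (sP : subgroup P) := [Choice of sgtype sP by <:].
HB.instance Definition _ P (sP : subgroup P) :=
  SubChoice_isSubGroup.Build G (sgpred P) (sgtype sP) (sgpred_closed sP).
HB.instance Definition _ P (sP : subgroup P) :=
  isMultiplicative.Build (sgtype sP) G (@sgval P sP) (@valM _ _ (sgtype sP)).

Lemma subgroup_type P : subgroup P ->
  exists (H : groupType) (f : {multiplicative H -> G}),
    injective f /\ forall x, P x <-> exists h, f h = x.
Proof.
move=> sP; exists (sgtype sP), (@sgval P sP).
split=> [|x]; first exact: val_inj.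
split=> [Px|[[y /= /asboolP Py] <-] //].
by exists (SGtype sP (introT (asboolP _) Px)).
Qed.

Variant gen (X : seq G) x : Prop :=
  Gen of (forall P, subgroup P -> (forall y, y \in X -> P y) -> P x).
Lemma gen_sub X P : subgroup P -> (forall y, y \in X -> P y) -> forall x, gen X x -> P x.
Proof. by move=> sP XP x [gx]; apply: gx. Qed.
Lemma gen_subgroup X : subgroup (gen X).
Proof.
split=> [|x y [gx] [gy]|x [gx]]; split=> P sP XP; first exact: subgroup1.
- by apply: subgroupM (gx _ _ _) (gy _ _ _).
- by apply: subgroupV (gx _ _ _).
Qed.
Lemma mem_gen X x : x \in X -> gen X x.
Proof. by move=> xX; split=> P _; apply. Qed.
Lemma gen_mono X Y : {subset X <= Y} -> forall x, gen X x -> gen Y x.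
Proof. by move=> XY; apply: gen_sub (gen_subgroup _) _ => y /XY; apply: mem_gen. Qed.

(** Lists may repeat, so the order of the subgroup is [size (undup F)]. Closure under inverses
    follows from finiteness. *)
Definition fin_subgroup (F : seq G) :=
  1 \in F /\ {in F &, forall x y, x * y \in F}.

(** Left multiplication by x maps F injectively into itself, hence onto, and so reaches 1. *)
Lemma fin_subgroupV F : fin_subgroup F -> {in F, forall x, x^-1 \in F}.
Proof.
move=> [F1 FM] x Fx; pose s := undup F.
have us : uniq (map (mul x) s) by rewrite map_inj_uniq ?undup_uniq //; apply: mulgI.
have sub : {subset map (mul x) s <= s}.
  by move=> _ /mapP[y ys ->]; rewrite !mem_undup in ys *; apply: FM.
have [|_ eqs] := uniq_min_size us sub; first by rewrite size_map.
have : 1 \in map (mul x) s by rewrite eqs mem_undup.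
case/mapP=> y; rewrite mem_undup => Fy e.
by rewrite (mulg1_eq (esym e)).
Qed.

Lemma fin_subgroup_subgroup F : fin_subgroup F -> subgroup (fun x => x \in F).
Proof. by move=> fF; have [F1 FM] := fF; split=> //; apply: fin_subgroupV. Qed.

Lemma fin_subgroup_perm F x : fin_subgroup F -> x \in F ->
  perm_eq (map (mul x) (undup F)) (undup F).
Proof.
move=> [F1 FM] Fx; apply: uniq_perm; rewrite ?undup_uniq //.
  by rewrite map_inj_uniq ?undup_uniq //; apply: mulgI.
apply: (uniq_min_size _ _ _).2; rewrite ?size_map //.
  by rewrite map_inj_uniq ?undup_uniq //; apply: mulgI.
by move=> _ /mapP[y ys ->]; rewrite !mem_undup in ys *; apply: FM.
Qed.

Definition torsion x := exists2 n, 0 < n & x ^+ n = 1.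

(** The exponent [o] is the order of x; by its minimality x^(o/p) is not 1. This reduces
    invertibility of orders to elements of prime order. *)
Lemma torsion_prime_power x n : 0 < n -> x ^+ n = 1 ->
  exists o, [/\ 0 < o, x ^+ o = 1 &
    forall p, prime p -> p %| o -> exists y, [/\ y <> 1, y ^+ p = 1 & exists i, y = x ^+ i]].
Proof.
move=> n0 xn; have exo : exists o, (0 < o) && (x ^+ o == 1).
  by exists n; rewrite n0 xn eqxx.
case: (ex_minnP exo) => o /andP[o0 /eqP xo] omin; exists o; split=> // p pp po.
exists (x ^+ (o %/ p)); split; last by exists (o %/ p).
  move=> e; have := omin (o %/ p); rewrite e eqxx divn_gt0 ?prime_gt0 // dvdn_leq //=.
  by move=> /(_ isT); rewrite leqNgt ltn_Pdiv // prime_gt1.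
by rewrite -expgnA divnK.
Qed.

(** Otherwise p and n are coprime, and Bezout writes x as a product of powers of x^p and x^n, both
    trivial. *)
Lemma prime_expg_dvd x p n : prime p -> x ^+ p = 1 -> x <> 1 -> x ^+ n = 1 -> p %| n.
Proof.
move=> pp xp x1 xn; apply/negPn/negP => pn; apply: x1.
have /coprimeP : coprime p n by rewrite prime_coprime.
case=> [|[u v] /= uv]; first exact: prime_gt0.
have e : (u * p = 1 + v * n)%N by lia.
have : x ^+ (u * p) = x ^+ (1 + v * n) by rewrite e.
by rewrite expgnDr expg1 ![(_ * p)%N]mulnC ![(_ * n)%N]mulnC !expgnA xp xn !expg1n mulg1.
Qed.

End Subgroups.

Section GroupMorph.
Variables (G H : groupType) (f : G -> H).
Hypothesis fM : {morph f : x y / x * y}.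
Lemma mulmor1 : f 1 = 1.
Proof. by apply: (@mulgI _ (f 1)); rewrite -fM !mulg1. Qed.
Lemma mulmorV x : f x^-1 = (f x)^-1.
Proof. by apply: (@mulgI _ (f x)); rewrite -fM !mulgV mulmor1. Qed.
Lemma mulmorX n x : f (x ^+ n) = f x ^+ n.
Proof. by elim: n => [|n IH]; rewrite ?mulmor1 // !expgS fM IH. Qed.
End GroupMorph.

Section CauchyList.
Variables (G : groupType) (F : seq G).
Hypothesis fF : fin_subgroup F.
Let T : finType := seq_sub F.
Fact fs_one_proof : 1 \in F. Proof. by case: fF. Qed.
Fact fs_mul_proof (x y : T) : ssval x * ssval y \in F.
Proof. by case: fF => _; apply; apply: ssvalP. Qed.
Fact fs_inv_proof (x : T) : (ssval x)^-1 \in F.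
Proof. by apply: fin_subgroupV => //; apply: ssvalP. Qed.
Let one := SeqSub fs_one_proof.
Let mul (x y : T) := SeqSub (fs_mul_proof x y).
Let inv (x : T) := SeqSub (fs_inv_proof x).
Let mulA : associative mul.
Proof. by move=> x y z; apply: val_inj; rewrite /= mulgA. Qed.
Let mul1 : left_id one mul.
Proof. by move=> x; apply: val_inj; rewrite /= mul1g. Qed.
Let mulV : left_inverse one inv mul.
Proof. by move=> x; apply: val_inj; rewrite /= mulVg. Qed.

(** The list is turned into a [finGroupType] on [seq_sub F], where Cauchy's theorem for finite
    groups applies. *)
Lemma Cauchy_list p : prime p -> p %| size (undup F) ->
  exists x, [/\ x \in F, x <> 1 & x ^+ p = 1].
Proof.
move=> pp pd.
pose gT : finGroupType := HB.pack_for finGroupType (Finite.sort T)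
  (Finite.class T) (Finite_isGroup.Build (Finite.sort T) mulA mul1 mulV).
have vM : {morph (fun x : gT => ssval (x : seq_sub F)) : x y / x * y} by [].
have : p %| #|[set: gT]|.
  rewrite cardsT; move: pd; congr (_ %| _).
  rewrite cardE -(size_map (fun x : gT => ssval (x : seq_sub F))).
  apply/perm_size/uniq_perm; first exact: undup_uniq.
    by rewrite map_inj_uniq ?enum_uniq //; apply: (@val_inj _ _ (seq_sub F)).
  move=> x; rewrite mem_undup; apply/idP/mapP => [Fx|[y _ ->]]; last exact: (ssvalP (y : seq_sub F)).
  by exists (SeqSub Fx : gT); rewrite // mem_enum.
move=> /(pgroup.Cauchy pp)[x _ ox].
exists (ssval (x : seq_sub F)); split; first exact: (ssvalP (x : seq_sub F)).
  move=> x1; have e : x = 1 by apply: (@val_inj _ _ (seq_sub F)).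
  by move: pp; rewrite -ox e order1.
by rewrite -(mulmorX vM) -ox expg_order.
Qed.
End CauchyList.

Local Open Scope group_scope.

(** * Coverings and locally finite subgroups *)

Section IntPowers.
Variable G : groupType.
Implicit Types (x y g : G) (z : int).

Definition zexpg x z := match z with Posz n => x ^+ n | Negz n => x ^- n.+1 end.

Lemma PoszS (n : nat) : Posz n.+1 = (Posz n + 1)%R. Proof. lia. Qed.
Lemma zexpg_nat x (n : nat) : zexpg x n = x ^+ n. Proof. by []. Qed.
Lemma zexpg0 x : zexpg x 0 = 1. Proof. by []. Qed.
Lemma zexpg1 x : zexpg x 1 = x. Proof. by rewrite zexpg_nat expg1. Qed.
Lemma zexpgS x z : zexpg x (z + 1)%R = zexpg x z * x.
Proof.
case: z => n; first by rewrite -PoszD addn1 !zexpg_nat expgSr.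
rewrite NegzE; case: n => [|n].
  by rewrite addNr /= expg1 mulVg.
rewrite (_ : (- n.+2%:Z + 1)%R = Negz n); last by rewrite NegzE; lia.
rewrite -NegzE /= [X in _ = X^-1 * _]expgS invgM.
by rewrite mulgVK.
Qed.
Lemma zexpgP x z : zexpg x (z - 1)%R = zexpg x z * x^-1.
Proof. by rewrite -{2}(subrK 1%R z) zexpgS mulgK. Qed.
Lemma zexpgD x z1 z2 : zexpg x (z1 + z2)%R = zexpg x z1 * zexpg x z2.
Proof.
elim/int_ind: z2 => [|n IH|n IH]; first by rewrite addr0 zexpg0 mulg1.
  by rewrite PoszS addrA !zexpgS IH mulgA.
rewrite (_ : (- n.+1%:Z)%R = (- n%:Z - 1)%R); last by lia.
by rewrite addrA !zexpgP IH mulgA.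
Qed.
Lemma zexpgN x z : zexpg x (- z)%R = (zexpg x z)^-1.
Proof. by apply/esym/mulg1_eq; rewrite -zexpgD subrr. Qed.
Lemma zexpg_subgroup (P : G -> Prop) x z : subgroup P -> P x -> P (zexpg x z).
Proof.
move=> sP Px; case: z => n /=; first exact: subgroupX.
by apply: (subgroupV sP); apply: subgroupX.
Qed.
Lemma zexpg_conj g x z : g * zexpg x z * g^-1 = zexpg (g * x * g^-1) z.
Proof.
elim/int_ind: z => [|n IH|n IH]; first by rewrite !zexpg0 mulg1 mulgV.
  by rewrite PoszS !zexpgS -IH !mulgA mulgVK.
rewrite (_ : (- n.+1%:Z)%R = (- n%:Z - 1)%R); last by lia.
by rewrite !zexpgP -IH !invgM invgK !mulgA mulgVK.
Qed.
Lemma zexpgM x z1 z2 : zexpg x (z1 * z2)%R = zexpg (zexpg x z1) z2.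
Proof.
elim/int_ind: z2 => [|n IH|n IH]; first by rewrite mulr0 !zexpg0.
  by rewrite PoszS zexpgS mulrDr mulr1 zexpgD IH.
rewrite (_ : (- n.+1%:Z)%R = (- n%:Z - 1)%R); last by lia.
by rewrite zexpgP mulrBr mulr1 zexpgD (zexpgN x z1) IH.
Qed.

Lemma hom_on1 (K : G -> Prop) (f : G -> int) : subgroup K ->
  (forall x y, K x -> K y -> f (x * y) = (f x + f y)%R) -> f 1 = 0%R.
Proof.
move=> sK fM; have := fM 1 1 (subgroup1 sK) (subgroup1 sK); rewrite mulg1.
by move/eqP; rewrite -subr_eq0 opprD addrA subrr add0r oppr_eq0 => /eqP.
Qed.
Lemma hom_onV (K : G -> Prop) (f : G -> int) : subgroup K ->
  (forall x y, K x -> K y -> f (x * y) = (f x + f y)%R) ->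
  forall x, K x -> f x^-1 = (- f x)%R.
Proof.
move=> sK fM x Kx; have := fM x x^-1 Kx (subgroupV sK Kx).
by rewrite mulgV (hom_on1 sK fM) => /esym/eqP; rewrite addrC addr_eq0 => /eqP.
Qed.
Lemma hom_onZ (K : G -> Prop) (f : G -> int) : subgroup K ->
  (forall x y, K x -> K y -> f (x * y) = (f x + f y)%R) ->
  forall x z, K x -> f (zexpg x z) = (z * f x)%R.
Proof.
move=> sK fM x z Kx; elim/int_ind: z => [|n IH|n IH].
- by rewrite zexpg0 (hom_on1 sK fM) mul0r.
- rewrite PoszS zexpgS fM //; last exact: zexpg_subgroup.
  by rewrite IH; lia.
rewrite (_ : (- n.+1%:Z)%R = (- n%:Z - 1)%R); last by lia.
rewrite zexpgP fM //; [|exact: zexpg_subgroup|exact: subgroupV].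
by rewrite IH (hom_onV sK fM) //; lia.
Qed.
Lemma hom_on_torsion (K : G -> Prop) (f : G -> int) : subgroup K ->
  (forall x y, K x -> K y -> f (x * y) = (f x + f y)%R) ->
  forall x, K x -> torsion x -> f x = 0%R.
Proof.
move=> sK fM x Kx [n n0 xn]; have := hom_onZ sK fM n Kx.
rewrite zexpg_nat xn (hom_on1 sK fM); nia.
Qed.
End IntPowers.

Section LocallyFinite.
Variable G : groupType.
Implicit Types (P Q K S A B : G -> Prop) (X R F : seq G).

Definition locally_finite P := forall X, (forall x, x \in X -> P x) ->
  exists F, [/\ fin_subgroup F, {subset X <= F} & forall x, x \in F -> P x].

Lemma locally_finite_torsion P x : locally_finite P -> P x -> torsion x.
Proof.
move=> lP Px; have [|F [fF XF _]] := lP [:: x]; first by move=> y; rewrite inE => /eqP->.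
have Fx : x \in F by apply: XF; rewrite inE.
have sF := fin_subgroup_subgroup fF.
pose h (i : 'I_(size F).+1) := x ^+ i.
have hF : {subset map h (enum 'I_(size F).+1) <= F}.
  by move=> _ /mapP[i _ ->]; apply: (subgroupX _ sF).
have [/uniq_leq_size/(_ hF)|/negP nu] := boolP (uniq (map h (enum 'I_(size F).+1))).
  by rewrite size_map size_enum_ord ltnn.
have : ~ injective h by move=> hi; apply: nu; rewrite map_inj_uniq ?enum_uniq.
move=> /existsNP[i /existsNP[j]] /not_implyP[]; rewrite /h.
wlog lt : i j / (i < j)%N => [W e ne|e _].
  have [lt|lt|/val_inj//] := ltngtP i j; first exact: W lt e ne.
  by apply: W lt (esym e) _ => ee; apply: ne.
exists (j - i)%N; first by rewrite subn_gt0.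
by rewrite expgnFr 1?ltnW // -e mulgV.
Qed.

Lemma locally_finiteS P Q : subgroup Q -> (forall x, Q x -> P x) ->
  locally_finite P -> locally_finite Q.
Proof.
move=> sQ QP lP X XQ; have [|F [fF XF FP]] := lP X; first by move=> x /XQ/QP.
exists [seq x <- F | `[< Q x >]]; split=> [|x Xx|x].
- case: fF => F1 FM; split; first by rewrite mem_filter F1 andbT; apply/asboolP; exact: subgroup1.
  move=> x y; rewrite !mem_filter => /andP[/asboolP Qx Fx] /andP[/asboolP Qy Fy].
  by rewrite FM // andbT; apply/asboolP; exact: subgroupM.
- by rewrite mem_filter XF // andbT; apply/asboolP; exact: XQ.
- by rewrite mem_filter => /andP[/asboolP].
Qed.

(** S meets only finitely many right cosets K r; for subgroups, the intersection of S and K then has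
    finite index in S. Neither K nor the r need lie in S. *)
Definition covered S K := exists R, forall x, S x -> exists2 r, r \in R & K (x * r^-1).

Lemma covered_reps S K : subgroup S -> subgroup K -> covered S K ->
  exists R, [/\ 1 \in R, forall r, r \in R -> S r &
    forall x, S x -> exists2 r, r \in R & K (x * r^-1)].
Proof.
move=> sS sK [R SR].
(* A coset K r that meets S is represented by a point of S; the others get the default 1. *)
pose rep r := if pselect (exists x, S x /\ K (x * r^-1)) is left e then projT1 (cid e) else 1.
exists (1 :: map rep R); split=> [|r|x Sx]; first by rewrite inE eqxx.
  rewrite inE => /orP[/eqP->|/mapP[r' _ ->]]; first exact: subgroup1.
  by rewrite /rep; case: pselect => [e|_]; [case: cid => y []|apply: subgroup1].
have [r Rr Kx] := SR x Sx; exists (rep r); first by rewrite inE map_f ?orbT.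
rewrite /rep; case: pselect => [e|[]]; last by exists x.
case: cid => y [Sy Ky] /=.
have := subgroupM sK Kx (subgroupV sK Ky).
by rewrite invgM invgK mulgA mulgVK.
Qed.

(** The y such that right multiplication by y and by y^-1 preserves S form a subgroup, although S
    itself need not be one. *)
Lemma gen_ind_r X S : S 1 -> (forall s x, S s -> x \in X -> S (s * x) /\ S (s * x^-1)) ->
  forall x, gen X x -> S x.
Proof.
move=> S1 SX x gx; rewrite -(mul1g x).
have sP : subgroup (fun y => forall s, S s -> S (s * y) /\ S (s * y^-1)).
  split=> [s|y z Py Pz s Ss|y Py s /Py]; first by rewrite invg1 mulg1.
    rewrite invgM !mulgA; split.
      by have [/Pz[]] := Py _ Ss.
    by have [_ /Py[]] := Pz _ Ss.
  by rewrite invgK => -[].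
by have [] := gen_sub sP (fun y Xy s Ss => SX s y Ss Xy) gx 1 S1.
Qed.

(** Schreier's generators. Every r x r'^-1 that lies in K is kept, with x a generator or the inverse
    of one, so no function choosing coset representatives is needed. *)
Lemma Schreier_covered_gen X K : subgroup K -> covered (gen X) K ->
  exists2 U, forall u, u \in U -> K u /\ gen X u & covered (gen X) (gen U).
Proof.
move=> sK /(covered_reps (gen_subgroup X) sK)[R [R1 Rg XR]].
have sX := gen_subgroup X.
pose X' := X ++ [seq x^-1 | x <- X].
pose U := [seq u <- [seq rx * r'^-1 | rx <- [seq r * x | r <- R, x <- X'], r' <- R]
             | `[< K u >]].
have X'g x : x \in X' -> gen X x.
  rewrite mem_cat => /orP[/mem_gen//|/mapP[y Xy ->]].
  by apply: (subgroupV sX); apply: mem_gen.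
exists U => [u|].
  rewrite mem_filter => /andP[/asboolP Ku] /allpairsP[[_ r'] /= [/allpairsP[[r x] /= [Rr Xx ->]] Rr' eu]].
  split=> //; rewrite eu.
  apply: (subgroupM sX); last by apply: (subgroupV sX); apply: Rg.
  by apply: (subgroupM sX); [apply: Rg|apply: X'g].
exists R => x gx; apply: (@gen_ind_r X (fun x => exists2 r, r \in R & gen U (x * r^-1))) gx.
  by exists 1 => //; rewrite mulgV; apply: subgroup1 (gen_subgroup _).
have step s y : (exists2 r, r \in R & gen U (s * r^-1)) -> y \in X' ->
    exists2 r, r \in R & gen U (s * y * r^-1).
  move=> [r Rr gs] Xy; have [|r' Rr' Kr'] := XR (r * y).
    by apply: (subgroupM sX); [apply: Rg|apply: X'g].
  exists r' => //; rewrite -(mulgVK r s) -2!mulgA.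
  apply: (subgroupM (gen_subgroup _)) => //; apply: mem_gen; rewrite mem_filter mulgA.
  rewrite (introT (asboolP _) Kr') /=; apply: allpairs_f => //.
  exact: allpairs_f.
move=> s y Ss Xy; split; apply: step => //; rewrite mem_cat ?Xy //.
by apply/orP; right; apply/mapP; exists y.
Qed.

Lemma covered_fin_subgroup X F : fin_subgroup F -> covered (gen X) (fun x => x \in F) ->
  exists F', [/\ fin_subgroup F', {subset X <= F'} & forall x, x \in F' <-> gen X x].
Proof.
move=> fF [R XR].
pose F' := [seq x <- [seq f * r | f <- F, r <- R] | `[< gen X x >]].
have F'P x : x \in F' <-> gen X x.
  rewrite mem_filter; split=> [/andP[/asboolP]//|gx].
  rewrite (introT (asboolP _) gx); have [r Rr Fx] := XR x gx.
  by apply/allpairsP; exists (x * r^-1, r); rewrite /= mulgVK; split.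
have sX := gen_subgroup X.
exists F'; split=> //; last by move=> x Xx; apply/(F'P x); exact: mem_gen.
split; first by apply/(F'P 1); exact: (subgroup1 sX).
by move=> x y /F'P gx /F'P gy; apply/(F'P (x * y)); exact: (subgroupM sX gx gy).
Qed.

Lemma covered_trans X U K : covered (gen X) (gen U) -> covered (gen U) K -> covered (gen X) K.
Proof.
move=> [R XR] [R' UR']; exists [seq r' * r | r' <- R', r <- R] => x gx.
have [r Rr gu] := XR x gx; have [r' Rr' Ku] := UR' _ gu.
by exists (r' * r); [apply: allpairs_f|rewrite invgM mulgA].
Qed.

Lemma covered_sub S S' K : (forall x, S x -> S' x) -> covered S' K -> covered S K.
Proof. by move=> SS' [R SR]; exists R => x /SS'/SR. Qed.

Lemma covered_super S K K' : (forall x, K x -> K' x) -> covered S K -> covered S K'.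
Proof. by move=> KK' [R SR]; exists R => x /SR[r Rr /KK']; exists r. Qed.

(** The Schreier generators of a subgroup of finite index in [gen X] lie in S and K, hence in a
    finite subgroup; so [gen X] is finite. *)
Lemma locally_finite_covered S K : subgroup S -> subgroup K -> covered S K ->
  locally_finite (fun x => S x /\ K x) -> locally_finite S.
Proof.
move=> sS sK cSK lSK X XS.
have gS x : gen X x -> S x := gen_sub sS XS (x:=x).
have [U UK cU] := Schreier_covered_gen sK (covered_sub gS cSK).
have [u /UK[Ku /gS Su]//|F [fF UF _]] := lSK U.
have [|F' [fF' XF' F'X]] := @covered_fin_subgroup X F fF.
  by apply: covered_super cU => x; apply: (gen_sub (fin_subgroup_subgroup fF) UF).
by exists F'; split=> // x /F'X/gS.
Qed.

Lemma coveredI S K L : subgroup K -> subgroup L -> covered S K -> covered S L ->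
  covered S (fun x => K x /\ L x).
Proof.
move=> sK sL [R SR] [R' SR'].
(* A point common to the cosets K r and L r' if there is one, else the default 1. *)
pose rep rr := if pselect (exists x, K (x * rr.1^-1) /\ L (x * rr.2^-1)) is left e
  then projT1 (cid e) else 1.
exists [seq rep (r, r') | r <- R, r' <- R'] => x Sx.
have [r Rr Kx] := SR x Sx; have [r' Rr' Lx] := SR' x Sx.
exists (rep (r, r')); first exact: allpairs_f.
rewrite /rep; case: pselect => [e|[]]; last by exists x.
case: cid => y [/= Ky Ly]; split.
  by have := subgroupM sK Kx (subgroupV sK Ky); rewrite invgM invgK mulgA mulgVK.
by have := subgroupM sL Lx (subgroupV sL Ly); rewrite invgM invgK mulgA mulgVK.
Qed.

Lemma covered_conj S K g : subgroup S -> S g -> covered S K ->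
  covered S (fun x => K (g * x * g^-1)).
Proof.
move=> sS Sg [R SR]; exists [seq g^-1 * r * g | r <- R] => x Sx.
have [|r Rr Kx] := SR (g * x * g^-1).
  by apply: (subgroupM sS (subgroupM sS Sg Sx)); apply: subgroupV.
exists (g^-1 * r * g); first by apply/mapP; exists r.
by move: Kx; rewrite !invgM invgK !mulgA mulgK.
Qed.

(** By pigeonhole two powers of x share a coset of K, and their quotient is the power sought. *)
Lemma covered_power S K x : subgroup S -> subgroup K -> covered S K -> S x ->
  exists2 n, (0 < n)%N & K (x ^+ n).
Proof.
move=> sS sK [R SR] Sx; pose idx i := find (fun r => `[< K (x ^+ i * r^-1) >]) R.
have idxP i : K (x ^+ i * (nth 1 R (idx i))^-1).
  apply/asboolP; apply: (@nth_find _ 1 (fun r => `[< K (x ^+ i * r^-1) >])).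
  have [r Rr Kr] := SR (x ^+ i) (subgroupX i sS Sx).
  by apply/hasP; exists r => //; apply/asboolP.
have lt i : (idx i < size R)%N.
  rewrite -has_find; have [r Rr Kr] := SR (x ^+ i) (subgroupX i sS Sx).
  by apply/hasP; exists r => //; apply/asboolP.
pose h (i : 'I_(size R).+1) : 'I_(size R) := Ordinal (lt i).
have : ~ injective h.
  by move=> /leq_card; rewrite !card_ord ltnn.
move=> /existsNP[i /existsNP[j]] /not_implyP[] /(congr1 val) /=.
wlog ltij : i j / (i < j)%N => [W e ne|e _].
  have [l|l|/val_inj//] := ltngtP i j; first exact: W l e ne.
  by apply: W l (esym e) _ => ee; apply: ne.
exists (j - i)%N; first by rewrite subn_gt0.
have := subgroupM sK (idxP j) (subgroupV sK (idxP i)); rewrite e.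
by rewrite invgM invgK mulgA mulgVK expgnFr // ltnW.
Qed.
End LocallyFinite.

Local Open Scope group_scope.

(** * Elementary amenable groups *)

Section Elementary.
Variable G : groupType.
Implicit Types (A B : G -> Prop).

Definition normalized A B := forall b a, B b -> A a -> A (b * a * b^-1).

(* Of the extensions only those with cyclic or finite quotient are kept, so that
   induction meets nothing but subgroups of G: the bound on the homological
   dimension passes to subgroups, but not to quotients. *)
Inductive elementary : (G -> Prop) -> Prop :=
| elem_trivial : elementary (fun x => x = 1)
| elem_union (I : Type) (A : I -> G -> Prop) :
    (exists i : I, True) ->
    (forall i j, exists l, (forall x, A i x -> A l x) /\ (forall x, A j x -> A l x)) ->
    (forall i, elementary (A i)) -> elementary (fun x => exists i, A i x)
| elem_cyclic A B t : elementary A -> subgroup B -> (forall x, A x -> B x) ->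
    normalized A B -> B t -> (forall x, B x -> exists z, A (x * (zexpg t z)^-1)) ->
    elementary B
| elem_finite A B : elementary A -> subgroup B -> (forall x, A x -> B x) ->
    normalized A B -> covered B A -> elementary B.

Lemma elementary_ext A B : (forall x, A x <-> B x) -> elementary A -> elementary B.
Proof. by move=> AB; suff -> : A = B by []; apply/funext => x; apply/propext. Qed.

Lemma elementary_subgroup A : elementary A -> subgroup A.
Proof.
elim=> // [|I B [i _] dir _ sB].
  by split=> [//|x y -> ->|x ->]; rewrite ?mulg1 ?invg1.
split=> [|x y [j Bx] [l By]|x [j Bx]]; first by exists i; apply: subgroup1.
  have [n [jn ln]] := dir j l; exists n.
  by apply: subgroupM (sB n) (jn _ Bx) (ln _ By).
by exists j; apply: subgroupV (sB j) Bx.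
Qed.

(** A surjection from B to Q is a function on all of G that is constrained only on B. This keeps the
    groups of the induction below inside G. *)
Definition onto_with_kernel (Q : groupType) B (p : G -> Q) :=
  [/\ subgroup B, forall x y, B x -> B y -> p (x * y) = p x * p y &
      forall q, exists2 x, B x & p x = q].

Section Onto.
Variables (Q : groupType) (B : G -> Prop) (p : G -> Q).
Hypothesis op : onto_with_kernel B p.
Lemma onto1 : p 1 = 1.
Proof.
have [sB pM _] := op; apply: (@mulgI _ (p 1)); rewrite -pM ?mulg1 //; exact: subgroup1.
Qed.
Lemma ontoV x : B x -> p x^-1 = (p x)^-1.
Proof.
have [sB pM _] := op; move=> Bx; apply: (@mulgI _ (p x)).
by rewrite -pM ?mulgV ?onto1 //; apply: subgroupV.
Qed.
Lemma ontoX x z : B x -> p (zexpg x z) = zexpg (p x) z.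
Proof.
have [sB pM _] := op; move=> Bx; elim/int_ind: z => [|n IH|n IH].
- by rewrite !zexpg0 onto1.
- by rewrite PoszS !zexpgS pM ?IH //; apply: zexpg_subgroup.
rewrite (_ : (- n.+1%:Z)%R = (- n%:Z - 1)%R); last by lia.
by rewrite !zexpgP pM ?IH ?ontoV //; [apply: zexpg_subgroup|apply: subgroupV].
Qed.
Lemma onto_preim (S : Q -> Prop) : subgroup S -> subgroup (fun x => B x /\ S (p x)).
Proof.
have [sB pM _] := op; move=> sS; split=> [|x y [Bx Sx] [By Sy]|x [Bx Sx]].
- by rewrite onto1; split; apply: subgroup1.
- by rewrite pM //; split; apply: subgroupM.
- by rewrite ontoV //; split; apply: subgroupV.
Qed.
Lemma onto_preim_normal (S S' : Q -> Prop) : (forall y x, S' y -> S x -> S (y * x * y^-1)) ->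
  normalized (fun x => B x /\ S (p x)) (fun x => B x /\ S' (p x)).
Proof.
have [sB pM _] := op; move=> nS b a [Bb Sb] [Ba Sa].
have BV := subgroupV sB Bb; have Bba := subgroupM sB Bb Ba.
by split; [apply: subgroupM|rewrite !pM ?ontoV //; apply: nS].
Qed.
(** Lets the induction pass from Q to a subgroup N: the preimage of N in B maps onto N with the same
    kernel as [p]. *)
Lemma onto_sub (N : groupType) (f : {multiplicative N -> Q}) : injective f ->
  exists p' : G -> N, onto_with_kernel (fun x => B x /\ exists n, f n = p x) p' /\
    forall x, (B x /\ exists n, f n = p x) -> f (p' x) = p x.
Proof.
have [sB pM pO] := op; move=> f_inj; have fM := @gmulfM _ _ f.
pose p' x := if pselect (exists n, f n = p x) is left e then projT1 (cid e) else 1.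
have fp' x : (B x /\ exists n, f n = p x) -> f (p' x) = p x.
  by move=> [_ ex]; rewrite /p'; case: pselect => // e; case: cid.
exists p'; split=> //; split=> [|x y Px Py|q].
- apply: (@onto_preim (fun q => exists n, f n = q)).
  split=> [|_ _ [m <-] [n <-]|_ [m <-]]; first by exists 1; rewrite (mulmor1 fM).
    by exists (m * n); rewrite fM.
  by exists m^-1; rewrite (mulmorV fM).
- apply: f_inj; rewrite fM !fp' //; have [Bx [m em]] := Px; have [By [n en]] := Py.
    exact: pM.
  by split; [apply: subgroupM|exists (m * n); rewrite fM em en pM].
- have [x Bx px] := pO (f q); exists x; first by split=> //; exists q.
  by apply: f_inj; rewrite fp' //; split=> //; exists q.
Qed.
End Onto.

Lemma subgroup_eq1 (Q : groupType) : subgroup (fun q : Q => q = 1).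
Proof. by split=> [//|x y -> ->|x ->]; rewrite ?mulg1 ?invg1. Qed.

Lemma gen_nil (Q : groupType) (x : Q) : gen [::] x -> x = 1.
Proof. by move=> [gx]; apply: (gx (fun q => q = 1)); first exact: subgroup_eq1. Qed.

(** Induction on the construction of Q, for all B and p at once: pulled back along p, every quotient
    met on the way becomes a pair of subgroups of G. For an extension, the kernel of [pr \o p] is
    the preimage of N, so the two induction hypotheses can be chained. *)
Theorem elementary_lift (Q : groupType) : elementary_amenable Q ->
  forall B (p : G -> Q), onto_with_kernel B p ->
  elementary (fun x => B x /\ p x = 1) -> elementary B.
Proof.
elim=> {Q} [Q s sP|Q Qab|N E Q f pr f_inj prO kerE _ IHN _ IHQ|Q I H f f_inj dir cov _ IH] B p op eK;
  have [sB pM pO] := op.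
- apply: (elem_finite eK sB) => [x []//||].
    move=> b a Bb Ka.
    have := @onto_preim_normal _ B p op (fun q => q = 1) (fun=> True).
    by move=> /(_ _ b a (conj Bb I) Ka); apply=> y x _ ->; rewrite mulg1 mulgV.
  pose r q := projT1 (cid2 (pO q)).
  have rP q : B (r q) /\ p (r q) = q by rewrite /r; case: cid2.
  exists (map r s) => x Bx; exists (r (p x)); first by apply: map_f.
  have [Br pr] := rP (p x); have BV := subgroupV sB Br.
  by split; [apply: subgroupM|rewrite pM // (ontoV op) // pr mulgV].
(* An abelian Q is the directed union of its finitely generated subgroups, whose preimages grow by
   one cyclic extension per generator. *)
- pose Bl (l : seq Q) x := B x /\ gen l (p x).
  have sBl l : subgroup (Bl l) by apply: (onto_preim op (gen_subgroup l)).
  have eBl l : elementary (Bl l).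
    elim: l => [|q l IH].
      apply: elementary_ext eK => x; split=> -[Bx]; last by move/gen_nil.
      by move=> e; split=> //; rewrite e; apply: subgroup1 (gen_subgroup _).
    have [t Bt pt] := pO q.
    apply: (@elem_cyclic (Bl l) (Bl (q :: l)) t IH (sBl _)).
    + move=> x [Bx gx]; split=> //; apply: gen_mono gx => y ly; by rewrite inE ly orbT.
    + move=> b a [Bb gb] [Ba ga]; have BV := subgroupV sB Bb; have Bba := subgroupM sB Bb Ba.
      by split; [apply: subgroupM|rewrite !pM // (ontoV op) // [p b * _]Qab mulgK].
    + by split=> //; rewrite pt; apply: mem_gen; rewrite inE eqxx.
    move=> x [Bx gx].
    pose S (y : Q) := exists z, gen l (y * (zexpg q z)^-1).
    have sS : subgroup S.
      split=> [|y y' [z gz] [z' gz']|y [z gz]].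
      - by exists (0 : int)%R; rewrite mul1g zexpg0 invg1; apply: subgroup1 (gen_subgroup _).
      - exists (z + z')%R; have := subgroupM (gen_subgroup l) gz gz'.
        rewrite zexpgD invgM [_^-1 * _^-1]Qab !mulgA -(mulgA y) [_^-1 * y']Qab.
        by rewrite !mulgA.
      - exists (- z)%R; have := subgroupV (gen_subgroup l) gz.
        by rewrite invgM zexpgN Qab.
    have [|z gz] := gen_sub sS _ gx.
      move=> y; rewrite inE => /orP[/eqP->|ly].
        by exists (1 : int)%R; rewrite zexpg1 mulgV; apply: subgroup1 (gen_subgroup _).
      by exists (0 : int)%R; rewrite zexpg0 invg1 mulg1; apply: mem_gen.
    exists z; have Bz := zexpg_subgroup z sB Bt; have BV := subgroupV sB Bz.
    by split; [apply: subgroupM|rewrite pM // (ontoV op) // (ontoX op) // pt].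
  apply: elementary_ext (elem_union _ _ eBl) => [x||l l'].
  + split=> [[l []//]|Bx]; exists [:: p x]; split=> //; apply: mem_gen.
    by rewrite inE eqxx.
  + by exists [::].
  exists (l ++ l'); split=> x [Bx gx]; split=> //; apply: gen_mono gx => y ly;
    by rewrite mem_cat ly ?orbT.
- have prM := @gmulfM _ _ pr.
  have opr : onto_with_kernel B (pr \o p).
    split=> // [x y Bx By|q]; first by rewrite /= pM ?prM.
    by have [e <-] := prO q; have [x Bx <-] := pO e; exists x.
  apply: (IHQ B (pr \o p) opr).
  have [p' [op' fp']] := onto_sub op f_inj.
  have AP x : (B x /\ exists n, f n = p x) <-> (B x /\ (pr \o p) x = 1).
    by split=> -[Bx] /kerE.
  apply: elementary_ext AP _; apply: (IHN _ p' op').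
  apply: elementary_ext eK => x; split=> [[Bx px]|[Bx' px']].
    have Bx' : B x /\ exists n, f n = p x.
      by split=> //; exists 1; rewrite px (mulmor1 (@gmulfM _ _ f)).
    split=> //; apply: f_inj; rewrite fp' // px (mulmor1 (@gmulfM _ _ f)) //.
  by case: (Bx') => Bx _; split=> //; rewrite -(fp' _ Bx') px' (mulmor1 (@gmulfM _ _ f)).
- have eB i : elementary (fun x => B x /\ exists n, f i n = p x).
    have [p' [op' fp']] := onto_sub op (f_inj i).
    apply: (IH i _ p' op').
    apply: elementary_ext eK => x; split=> [[Bx px]|[Bx' px']].
      have Bx' : B x /\ exists n, f i n = p x.
        by split=> //; exists 1; rewrite px (mulmor1 (@gmulfM _ _ (f i))).
      by split=> //; apply: f_inj; rewrite fp' // px (mulmor1 (@gmulfM _ _ (f i))) //.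
    by case: (Bx') => Bx _; split=> //; rewrite -(fp' _ Bx') px' (mulmor1 (@gmulfM _ _ (f i))).
  apply: elementary_ext (elem_union _ _ eB) => [x||i j].
  + split=> [[i []//]|Bx]; have [i [y ey]] := cov (p x).
    by exists i; split=> //; exists y.
  + by have [i _] := cov 1; exists i.
  have [l [il jl]] := dir i j; exists l.
  split=> x [Bx [n en]]; split=> //.
    by have [z ez] := il n; exists z; rewrite ez.
  by have [z ez] := jl n; exists z; rewrite ez.
Qed.
End Elementary.

Theorem elementary_amenable_elementary (G : groupType) :
  elementary_amenable G -> elementary (fun _ : G => True).
Proof.
move=> eG; apply: (@elementary_lift G G eG _ id).
  by split=> // q; exists q.
by apply: elementary_ext (elem_trivial G) => x; split=> [->|[]].
Qed.

Local Open Scope group_scope.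

(** * Transfer *)

Section RankOne.
Variable G : groupType.
Implicit Types (A B S K : G -> Prop) (X : seq G).

Definition hom_on K (f : G -> int) := forall x y, K x -> K y -> f (x * y) = (f x + f y)%R.

Definition virtually_rank_le1 S := exists K f,
  [/\ subgroup K, hom_on K f, locally_finite (fun x => K x /\ f x = 0%R) & covered S K].

Definition locally_rank_le1 B :=
  forall X, (forall x, x \in X -> B x) -> virtually_rank_le1 (gen X).

Lemma subgroup_ker K f : subgroup K -> hom_on K f -> subgroup (fun x => K x /\ f x = 0%R).
Proof.
move=> sK fM; split=> [|x y [Kx fx] [Ky fy]|x [Kx fx]].
- by split; [apply: subgroup1|apply: hom_on1 fM].
- by split; [apply: subgroupM|rewrite fM // fx fy].
- by split; [apply: subgroupV|rewrite (hom_onV sK fM) // fx oppr0].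
Qed.

(** A homomorphism to the integers kills torsion, so up to finite index only its locally finite
    kernel remains. *)
Lemma locally_rank_le1_torsion A : subgroup A -> locally_rank_le1 A ->
  (forall x, A x -> torsion x) -> locally_finite A.
Proof.
move=> sA lA tA X XA; have [K [f [sK fM lK cK]]] := lA X XA.
have gA := gen_sub sA XA.
have [U UK cU] := Schreier_covered_gen sK cK.
have [u /UK[Ku gu]|F [fF UF _]] := lK U.
  by split=> //; apply: (hom_on_torsion sK fM Ku); apply/tA/gA.
have [|F' [fF' XF' F'X]] := @covered_fin_subgroup G X F fF.
  by apply: covered_super cU => x; apply: (gen_sub (fin_subgroup_subgroup fF) UF).
by exists F'; split=> // x /F'X/gA.
Qed.

(** The hypothesis isolates where homological dimension enters: an infinite cyclic quotient may only
    sit above a torsion group A, since otherwise the rank would become two. Such an A is locally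
    finite, and the exponent of t is the required homomorphism. If some power of t lies in A, then A
    has finite index in B. *)
Lemma elementary_locally_rank_le1 :
  (forall A t a, subgroup A -> locally_rank_le1 A ->
     (forall x, A x -> A (t * x * t^-1)) -> (forall x, A x -> A (t^-1 * x * t)) ->
     (forall n, (0 < n)%N -> ~ A (t ^+ n)) -> A a -> torsion a) ->
  forall B, elementary B -> locally_rank_le1 B.
Proof.
move=> obst; have fin A B : subgroup A -> subgroup B ->
    covered B A -> locally_rank_le1 A -> locally_rank_le1 B.
  move=> sA sB cBA lA X XB.
  have gB := gen_sub sB XB.
  have [U UA cU] := Schreier_covered_gen sA (covered_sub gB cBA).
  have [u /UA[]//|K [f [sK fM lK cK]]] := lA U.
  by exists K, f; split=> //; apply: covered_trans cU cK.
move=> B; elim=> {B} [|I A [i0 _] dir _ IH|A B t eA lA sB AB nA Bt BA|A B eA lA sB AB nA cBA].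
- move=> X X1; exists (fun x => x = 1), (fun=> 0%R).
  have s1 : subgroup (fun x : G => x = 1) by apply: subgroup_eq1.
  split=> // [Y Y1|].
    exists [:: 1]; split=> [|x /Y1[->]|x]; rewrite ?inE //; last by move=> /eqP ->.
    by split=> [|x y]; rewrite ?inE // => /eqP-> /eqP->; rewrite mulg1.
  exists [:: 1] => x gx; exists 1; rewrite ?inE // invg1 mulg1.
  by apply: (gen_sub s1 X1).
- move=> X XA; have [j jX] : exists j, forall x, x \in X -> A j x.
    elim: X XA => [|y X IHX] XA; first by exists i0.
    have [|j jX] := IHX; first by move=> x Xx; apply: XA; rewrite inE Xx orbT.
    have [l ly] := XA y (mem_head _ _); have [n [jn ln]] := dir j l.
    by exists n => x; rewrite inE => /orP[/eqP->|/jX/jn]; first exact: ln.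
  exact: (IH j X jX).
- have sA := elementary_subgroup eA; have BV := subgroupV sB Bt.
  have [[n n0 An]|noA] := pselect (exists2 n, (0 < n)%N & A (t ^+ n)).
    apply: fin lA => //; exists [seq t ^+ i | i <- iota 0 n] => x Bx.
    have [z Az] := BA x Bx; pose i := absz (z %% n)%Z.
    have iE : Posz i = (z %% n)%Z by rewrite /i gez0_abs // modz_ge0; lia.
    exists (t ^+ i).
      apply/mapP; exists i => //; rewrite mem_iota add0n /=.
      by have := ltz_pmod z (d := Posz n); rewrite -iE ltz_nat; apply; lia.
    have ez : z = (Posz n * (z %/ n)%Z + Posz i)%R by rewrite iE {1}(divz_eq z n) mulrC.
    move: Az; rewrite ez zexpgD zexpgM zexpg_nat zexpg_nat invgM mulgA => Az.
    by apply: (subgroupMr sA _ Az); apply: (subgroupV sA); apply: zexpg_subgroup.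
  have noA' n : (0 < n)%N -> ~ A (t ^+ n) by move=> n0 An; apply: noA; exists n.
  have lfA : locally_finite A.
    apply: locally_rank_le1_torsion => // a Aa; apply: (obst A t a) => // x Ax.
      exact: nA.
    by have := nA t^-1 x BV Ax; rewrite invgK.
  have noz z : A (zexpg t z) -> z = 0%R.
    case: z => [[|n]|n] //= Az; first by case: (noA' n.+1).
    by case: (noA' n.+1) => //; apply: subgroupVr.
  (* The exponent of t in x, well defined on B because no nontrivial power of t lies in A; the
     default off B is 0. *)
  pose f x := if pselect (exists z, A (x * (zexpg t z)^-1)) is left e
    then projT1 (cid e) else 0%R.
  have fP x : B x -> A (x * (zexpg t (f x))^-1).
    by move=> /BA ex; rewrite /f; case: pselect => // e; case: cid.
  have fU x z : B x -> A (x * (zexpg t z)^-1) -> f x = z.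
    move=> Bx Az; have := subgroupM sA (subgroupV sA (fP x Bx)) Az.
    rewrite invgM invgK mulgA mulgVK -zexpgN -zexpgD => /noz; lia.
  have fM : hom_on B f.
    move=> x y Bx By; apply: fU; first exact: subgroupM.
    have Bz : B (zexpg t (f x)) by apply: zexpg_subgroup.
    have := subgroupM sA (fP x Bx) (nA _ _ Bz (fP y By)).
    by rewrite zexpgD invgM !mulgA mulgVK.
  move=> X XB; exists B, f; split=> //; last first.
    exists [:: 1] => x gx; exists 1; rewrite ?inE // invg1 mulg1.
    exact: (gen_sub sB XB).
  apply: locally_finiteS lfA; first exact: subgroup_ker.
  by move=> x [Bx fx]; have := fP x Bx; rewrite fx zexpg0 invg1 mulg1.
- by apply: fin lA => //; apply: elementary_subgroup.
Qed.

Section Transfer.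
Variables (X : seq G) (K : G -> Prop) (f : G -> int).
Notation H := (gen X).
Hypotheses (sK : subgroup K) (fM : hom_on K f)
  (lK : locally_finite (fun x => K x /\ f x = 0%R)) (cK : covered H K).
Let sH := gen_subgroup X.

Let N x := H x /\ forall h, H h -> K (h * x * h^-1).

Let sN : subgroup N.
Proof.
split=> [|x y [Hx Nx] [Hy Ny]|x [Hx Nx]].
- by split=> [|h Hh]; rewrite ?mulg1 ?mulgV; apply: subgroup1.
- split=> [|h Hh]; first exact: subgroupM.
  by have := subgroupM sK (Nx h Hh) (Ny h Hh); rewrite !mulgA mulgVK.
- split=> [|h Hh]; first exact: subgroupV.
  by have := subgroupV sK (Nx h Hh); rewrite !invgM invgK mulgA.
Qed.

Let NK x : N x -> K x.
Proof. by move=> [_ /(_ 1 (subgroup1 sH))]; rewrite mul1g invg1 mulg1. Qed.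

Let NH x : N x -> H x. Proof. by case. Qed.

Let nN h x : H h -> N x -> N (h * x * h^-1).
Proof.
move=> Hh [Hx Nx]; split=> [|g Hg].
  by apply: (subgroupM sH); [apply: (subgroupM sH)|apply: (subgroupV sH)].
by have := Nx (g * h) (subgroupM sH Hg Hh); rewrite !mulgA invgM mulgA.
Qed.

Let cN0 : covered H N.
Proof.
have [R [R1 RH HR]] := covered_reps sH sK cK.
pose C (s : seq G) x := forall r, r \in s -> K (r * x * r^-1).
have sC s : subgroup (C s).
  split=> [y sy|x y Px Py r' sr'|x Px r' sr']; first by rewrite mulg1 mulgV; apply: subgroup1.
    by have := subgroupM sK (Px r' sr') (Py r' sr'); rewrite !mulgA mulgVK.
  by have := subgroupV sK (Px r' sr'); rewrite !invgM invgK mulgA.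
have cC (s : seq G) : (forall r, r \in s -> H r) -> covered H (C s).
  elim: s => [|r s IH] sR.
    by exists [:: 1] => x _; exists 1; rewrite ?inE.
  have cs : covered H (C s) by apply: IH => y sy; apply: sR; rewrite inE sy orbT.
  have [R' HR'] := coveredI (subgroup_conj r sK) (sC s)
    (covered_conj sH (sR r (mem_head _ _)) cK) cs.
  exists R' => x /HR'[y Ry [K1 K2]]; exists y => // r'.
  by rewrite inE => /orP[/eqP->//|]; apply: K2.
have [R' [_ R'H HR']] := covered_reps sH (sC R) (cC R RH).
exists R' => x Hx; have [r Rr Kr] := HR' x Hx; exists r => //.
split=> [|h Hh].
  by apply: (subgroupM sH) => //; apply: (subgroupV sH); apply: R'H.
have [s Rs Ks] := HR h Hh.
have := subgroupM sK (subgroupM sK Ks (Kr s Rs)) (subgroupV sK Ks).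
by rewrite !invgM invgK !mulgA mulgVK mulgVK.
Qed.

Let fN : hom_on N f.
Proof. by move=> x y /NK Kx /NK Ky; apply: fM. Qed.

Let torsionN x : N x -> f x = 0%R -> torsion x.
Proof. by move=> Nx fx; apply: locally_finite_torsion lK _; split=> //; apply: NK. Qed.

(** The kernel of f on N is exactly the torsion of N, which conjugation preserves. *)
Let f_conj0 h x : H h -> N x -> f x = 0%R -> f (h * x * h^-1) = 0%R.
Proof.
move=> Hh Nx /(torsionN Nx)[n n0 xn]; apply: (hom_on_torsion sN fN); first exact: nN.
by exists n => //; have := zexpg_conj h x n; rewrite !zexpg_nat xn mulg1 mulgV.
Qed.

(** [w] lies in the kernel of f, hence so does its conjugate. Thus conjugation by h rescales f on N
    by a ratio independent of the element. *)
Let f_conj h x y : H h -> N x -> N y ->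
  (f (h * x * h^-1) * f y = f (h * y * h^-1) * f x)%R.
Proof.
move=> Hh Nx Ny; pose w := zexpg x (f y) * zexpg y (- f x)%R.
have Nxz : N (zexpg x (f y)) by apply: zexpg_subgroup.
have Nyz : N (zexpg y (- f x)%R) by apply: zexpg_subgroup.
have Nw : N w by apply: subgroupM.
have : f w = 0%R by rewrite fN // !(hom_onZ sN fN) //; lia.
move=> /(f_conj0 Hh Nw).
have -> : h * w * h^-1 = zexpg (h * x * h^-1) (f y) * zexpg (h * y * h^-1) (- f x)%R.
  by rewrite -!zexpg_conj !mulgA mulgVK.
rewrite [f (zexpg _ _ * _)]fN; try by apply: zexpg_subgroup => //; apply: nN.
rewrite !(hom_onZ sN fN); try exact: nN.
lia.
Qed.

(* N is the normal core of K.  Conjugation by H multiplies f on N by a sign eps,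
   and c is the transfer of f from N to H, twisted by eps. *)
Lemma transfer : exists c eps : G -> int,
  [/\ forall x, H x -> eps x = 1%R \/ eps x = (-1)%R,
      forall x y, H x -> H y -> eps (x * y) = (eps x * eps y)%R,
      forall x y, H x -> H y -> c (x * y) = (c x + eps x * c y)%R &
      locally_finite (fun x => [/\ H x, eps x = 1%R & c x = 0%R])].
Proof.
have [f0|/existsNP[a0 /not_implyP[Na fa]]] := pselect (forall x, N x -> f x = 0%R).
  exists (fun=> 0%R), (fun=> 1%R); split=> //; first by left.
  have lH : locally_finite H.
    apply: (locally_finite_covered sH sN cN0).
    apply: locally_finiteS lK; first exact: subgroupI.
    by move=> x [Hx Nx]; split; [apply: NK|apply: f0].
  apply: locally_finiteS lH; last by move=> x [].
  split=> [|x y [Hx _ _] [Hy _ _]|x [Hx _ _]]; split=> //.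
  - exact: subgroup1.
  - exact: subgroupM.
  - exact: subgroupV.
have fa0 : f a0 <> 0%R by [].
have aV h : H h -> N (h * a0 * h^-1) by move=> Hh; apply: nN.
pose lam h : rat := ((f (h * a0 * h^-1))%:~R / (f a0)%:~R)%R.
have fa0' : ((f a0)%:~R != 0 :> rat)%R by rewrite intr_eq0; apply/eqP.
have lamP h x : H h -> N x -> ((f (h * x * h^-1))%:~R = lam h * (f x)%:~R :> rat)%R.
  move=> Hh Nx; have := congr1 (intr : int -> rat) (f_conj Hh Nx Na).
  by rewrite !intrM /lam => e; rewrite mulrAC -e mulfK.
have lamM g h : H g -> H h -> lam (g * h) = (lam g * lam h)%R.
  move=> Hg Hh; have e : g * h * a0 * (g * h)^-1 = g * (h * a0 * h^-1) * g^-1.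
    by rewrite invgM !mulgA.
  by rewrite {1}/lam e (lamP g _ Hg (aV h Hh)) -mulrA.
have lam1 x : N x -> lam x = 1%R.
  move=> Nx; rewrite /lam !fN //; last by apply: subgroupV.
    by rewrite (hom_onV sN fN) // addrAC subrr add0r divff.
  exact: subgroupM.
have lamX h n : H h -> lam (h ^+ n) = (lam h ^+ n)%R.
  move=> Hh; elim: n => [|n IH]; first by rewrite lam1 ?expr0 //; apply: subgroup1.
  by rewrite expgS exprS lamM ?IH //; apply: subgroupX.
(* Some positive power of h lies in N, where [lam] is 1, and a rational number with a positive power
   equal to 1 is 1 or -1. *)
have lam_pm h : H h -> lam h = 1%R \/ lam h = (-1)%R.
  move=> Hh; have [n n0 Nn] := covered_power sH sN cN0 Hh.
  have /eqP : (`|lam h| ^+ n = 1)%R by rewrite -normrX -lamX // lam1 // normr1.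
  rewrite pexprn_eq1 // (gtn_eqF n0) /= => /eqP.
  by case: (ger0P (lam h)) => _ e; [left|right]; rewrite // -e opprK.
pose eps h : int := if lam h == 1%R then 1%R else (-1)%R.
have epsE h : H h -> ((eps h)%:~R = lam h :> rat)%R.
  by move=> /lam_pm; rewrite /eps => -[->|->].
have epsM g h : H g -> H h -> eps (g * h) = (eps g * eps h)%R.
  move=> Hg Hh; apply: (@intr_inj rat).
  by rewrite intrM !epsE ?lamM //; apply: subgroupM.
have eps_pm h : eps h = 1%R \/ eps h = (-1)%R by rewrite /eps; case: ifP; [left|right].
have epsP h x : H h -> N x -> f (h * x * h^-1) = (eps h * f x)%R.
  by move=> Hh Nx; apply: (@intr_inj rat); rewrite intrM epsE // lamP.
have eps1 x : N x -> eps x = 1%R by move=> Nx; rewrite /eps lam1 // eqxx.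
have [R [R1 RH HR]] := covered_reps sH sN cN0.
pose rep x := nth 1 R (find (fun r => `[< N (x * r^-1) >]) R).
have has_rep x : H x -> has (fun r => `[< N (x * r^-1) >]) R.
  by move=> /HR[r Rr Nr]; apply/hasP; exists r => //; apply/asboolP.
have repN x : H x -> N (x * (rep x)^-1).
  by move=> /has_rep/(nth_find 1)/asboolP.
have repR x : H x -> rep x \in R by move=> /has_rep; rewrite has_find; apply: mem_nth.
have repH x : H x -> H (rep x) by move=> /repR/RH.
have rep_eq x y : H x -> H y -> N (x * y^-1) -> rep x = rep y.
  move=> Hx Hy Nxy; rewrite /rep; congr nth; apply: eq_find => r /=.
  apply/asbool_equiv_eq; split=> Nr.
    by have := subgroupM sN (subgroupV sN Nxy) Nr; rewrite invgM invgK mulgA mulgVK.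
  by have := subgroupM sN Nxy Nr; rewrite mulgA mulgVK.
have repK x : H x -> rep (rep x) = rep x.
  move=> Hx; apply: rep_eq => //; first exact: repH.
  by have := subgroupV sN (repN x Hx); rewrite invgM invgK.
pose S := undup [seq rep r | r <- R].
have SP s : s \in S -> H s /\ rep s = s.
  by rewrite mem_undup => /mapP[r /RH Hr ->]; split; [apply: repH|apply: repK].
have repS x : H x -> rep x \in S.
  by move=> Hx; rewrite mem_undup; apply/mapP; exists (rep x); rewrite ?repK //; apply: repR.
pose kap x := x * (rep x)^-1.
have kapN x : H x -> N (kap x) by apply: repN.
(* The transfer sum over coset representatives s, applied to the N-part of s h; the weight eps s
   makes it a cocycle for the sign action. *)
pose c h : int := (\sum_(s <- S) eps s * f (kap (s * h)%g))%R.
have cM g h : H g -> H h -> c (g * h) = (c g + eps g * c h)%R.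
  move=> Hg Hh; rewrite /c.
  have perm : perm_eq [seq rep (s * g) | s <- S] S.
    have inj : {in S &, injective (fun s => rep (s * g))}.
      move=> s s' /SP[Hs rs] /SP[Hs' rs'] e.
      have Hsg := subgroupM sH Hs Hg; have Hsg' := subgroupM sH Hs' Hg.
      rewrite -rs -rs'; apply: rep_eq => //.
      have := subgroupM sN (repN _ Hsg) (subgroupV sN (repN _ Hsg')).
      by rewrite e !invgM invgK !mulgA mulgVK mulgK.
    have uS : uniq [seq rep (s * g) | s <- S] by rewrite map_inj_in_uniq ?undup_uniq.
    apply: uniq_perm => //; first exact: undup_uniq.
    apply: (uniq_min_size uS _ _).2; last by rewrite size_map.
    by move=> _ /mapP[s /SP[Hs _] ->]; apply: repS; exact: (subgroupM sH Hs Hg).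
  rewrite -[X in (_ + _ * X)%R](perm_big _ perm) /= big_map mulr_sumr -big_split /=.
  apply: eq_big_seq => s /SP[Hs rs].
  have Hsg := subgroupM sH Hs Hg; have Hr := repH _ Hsg; have Hrh := subgroupM sH Hr Hh.
  have e : rep (rep (s * g) * h) = rep (s * (g * h)).
    apply: rep_eq => //; first by apply: (subgroupM sH) => //; apply: (subgroupM sH).
    have := subgroupV sN (repN _ Hsg).
    by rewrite !invgM invgK !mulgA mulgK.
  have -> : kap (s * (g * h)) = kap (s * g) * kap (rep (s * g) * h).
    by rewrite /kap e !mulgA mulgVK.
  rewrite fN; try exact: kapN.
  have -> : eps (rep (s * g)) = (eps s * eps g)%R.
    have Nk := repN _ Hsg; rewrite -epsM // -[in RHS](mulgVK (rep (s * g)) (s * g)).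
    by rewrite epsM ?(eps1 _ Nk) ?mul1r //; apply: NH.
  by rewrite mulrDr; congr (_ + _)%R; case: (eps_pm g) => ->; ring.
exists c, eps; split=> //.
(* On N the cocycle is the index of N in H times f, so both vanish at the same points of N. *)
have cN x : N x -> c x = ((Posz (size S)) * f x)%R.
  move=> Nx; rewrite /c; have Hx := NH Nx.
  rewrite (eq_big_seq (fun=> f x)) => [|s /SP[Hs rs]].
    by rewrite big_const_seq count_predT iter_addr_0 -mulr_natl natz.
  have e : rep (s * x) = s.
    rewrite -{2}rs; apply: rep_eq => //; first exact: subgroupM.
    exact: nN.
  by rewrite /kap e epsP // mulrA; case: (eps_pm s) => ->; ring.
have S0 : (0 < size S)%N.
  by have := repS _ (subgroup1 sH); case: (S).
have sE : subgroup (fun x => [/\ H x, eps x = 1%R & c x = 0%R]).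
  split=> [|x y [Hx ex cx] [Hy ey cy]|x [Hx ex cx]].
  - have N1 := subgroup1 sN; split; [exact: subgroup1|exact: eps1|].
    by rewrite cN // (hom_on1 sN fN) mulr0.
  - by split; [apply: subgroupM|rewrite epsM // ex ey|rewrite cM // cx cy mulr0].
  have HV := subgroupV sH Hx; have N1 := subgroup1 sN.
  have eV : eps x^-1 = 1%R by have := eps1 _ N1; rewrite -(mulVg x) epsM // ex mulr1.
  split=> //; have := cM _ _ HV Hx; rewrite mulVg cN // (hom_on1 sN fN) cx.
  lia.
apply: (locally_finite_covered sE sN); first by apply: covered_sub cN0 => x [].
apply: locally_finiteS lK; first exact: subgroupI.
move=> x [[Hx ex cx] Nx]; split; first exact: NK.
by move: cx; rewrite cN // => /eqP; rewrite mulf_eq0 => /orP[/eqP|/eqP//]; lia.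
Qed.
End Transfer.
End RankOne.

Local Open Scope ring_scope.

(** * The bar complex in low degrees *)

Definition addmor (U V : zmodType) (f : U -> V) := forall x y, f (x + y) = f x + f y.

Section AddF.
Variables (U V : zmodType) (f : U -> V).
Hypothesis fD : addmor f.
Lemma addmor0 : f 0 = 0.
Proof. by apply: (@addrI _ (f 0)); rewrite -fD !addr0. Qed.
Lemma addmorN x : f (- x) = - f x.
Proof. by apply: (@addrI _ (f x)); rewrite -fD !subrr addmor0. Qed.
Lemma addmorB x y : f (x - y) = f x - f y.
Proof. by rewrite fD addmorN. Qed.
End AddF.

Section MExt.
Variables (K : choiceType) (M : zmodType).
Implicit Types c d : {malg M[K]}.

Lemma malg_ind (P : {malg M[K]} -> Prop) :
  P 0 -> (forall c d, P c -> P d -> P (c + d)) ->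
  (forall m x, P << m *g x >>) -> forall c, P c.
Proof.
move=> P0 PD PU c; rewrite (monalgE c); elim: (X in \sum_(k <- X) _) => [|x s IH].
  by rewrite big_nil.
by rewrite big_cons; apply: PD.
Qed.

Lemma malg_addmor_eq (V : zmodType) (f g : {malg M[K]} -> V) :
  addmor f -> addmor g -> (forall m x, f << m *g x >> = g << m *g x >>) -> f =1 g.
Proof.
move=> fD gD fg; elim/malg_ind => [|c d IHc IHd|//]; first by rewrite !addmor0.
by rewrite fD gD IHc IHd.
Qed.

End MExt.

HB.lock Definition mext (K : choiceType) (M V : zmodType) (F : K -> M -> V)
  (c : {malg M[K]}) : V := \sum_(x <- msupp c) F x (c@_x).

Section MExtTheory.
Variables (K : choiceType) (M V : zmodType) (F : K -> M -> V).
Implicit Types c d : {malg M[K]}.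
Hypothesis FD : forall x, addmor (F x).
Local Notation mext := (mext F).

Lemma mextEw (d : {fset K}) c : (msupp c `<=` d)%fset ->
  mext c = \sum_(x <- d) F x (c@_x).
Proof.
move=> le; rewrite mext.unlock; apply: big_fset_incl le _ => x _ xc.
by rewrite mcoeff_outdom // addmor0.
Qed.

Lemma mextD : addmor mext.
Proof.
move=> c d; set s := (msupp c `|` msupp d `|` msupp (c + d))%fset.
rewrite (@mextEw s (c + d)) ?(@mextEw s c) ?(@mextEw s d) -?big_split /=.
- by apply: eq_bigr => x _; rewrite mcoeffD FD.
- by rewrite /s -fsetUA [X in (_ `<=` X)%fset]fsetUC -fsetUA; apply: fsubsetUl.
- by rewrite /s -fsetUA; apply: fsubsetUl.
- by rewrite /s fsetUC; apply: fsubsetUl.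
Qed.

Lemma mextU m x : mext << m *g x >> = F x m.
Proof.
rewrite (@mextEw [fset x]%fset) ?msuppU_le //.
by rewrite big_seq_fset1 mcoeffUU.
Qed.
End MExtTheory.

Lemma malgUD (K : choiceType) (M : zmodType) (x : K) :
  addmor (fun m : M => << m *g x >>).
Proof. exact: monalgUD. Qed.

Definition tup (G : groupType) n (s : seq G) : {ffun 'I_n -> G} :=
  [ffun i : 'I_n => nth 1%g s i].

Section Tup.
Variable G : groupType.
Implicit Types x y z : G.

Lemma ffun1_tup (g : {ffun 'I_1 -> G}) : exists x, g = tup 1 [:: x].
Proof. by exists (g ord0); apply/ffunP=> i; rewrite ffunE ord1. Qed.
Lemma ffun2_tup (g : {ffun 'I_2 -> G}) : exists x y, g = tup 2 [:: x; y].
Proof.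
exists (g ord0), (g (lift ord0 ord0)); apply/ffunP=> i; rewrite ffunE.
by case: i => [[|[|//]] Hi]; congr (g _); apply: val_inj.
Qed.
Lemma ffun3_tup (g : {ffun 'I_3 -> G}) : exists x y z, g = tup 3 [:: x; y; z].
Proof.
exists (g ord0), (g (lift ord0 ord0)), (g (lift ord0 (lift ord0 ord0))).
apply/ffunP=> i; rewrite ffunE.
by case: i => [[|[|[|//]]] Hi]; congr (g _); apply: val_inj.
Qed.

Lemma tup_nth0 n s : (tup n.+1 s) ord0 = nth 1%g s 0 :> G.
Proof. by rewrite ffunE. Qed.

Ltac face_tac := apply/ffunP; case=> [[|[|[|?]]]] ? //; rewrite !ffunE.

Lemma face_1_0 x : face ord0 (tup 1 [:: x]) = tup 0 [::].
Proof. by apply/ffunP; case. Qed.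
Lemma face_1_1 x : face (lift ord0 ord0) (tup 1 [:: x]) = tup 0 [::].
Proof. by apply/ffunP; case. Qed.
Lemma face_2_0 x y : face ord0 (tup 2 [:: x; y]) = tup 1 [:: y].
Proof. by face_tac. Qed.
Lemma face_2_1 x y : face (lift ord0 ord0) (tup 2 [:: x; y]) = tup 1 [:: (x * y)%g].
Proof. by face_tac. Qed.
Lemma face_2_2 x y :
  face (lift ord0 (lift ord0 ord0)) (tup 2 [:: x; y]) = tup 1 [:: x].
Proof. by face_tac. Qed.
Lemma face_3_0 x y z : face ord0 (tup 3 [:: x; y; z]) = tup 2 [:: y; z].
Proof. by face_tac. Qed.
Lemma face_3_1 x y z :
  face (lift ord0 ord0) (tup 3 [:: x; y; z]) = tup 2 [:: (x * y)%g; z].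
Proof. by face_tac. Qed.
Lemma face_3_2 x y z :
  face (lift ord0 (lift ord0 ord0)) (tup 3 [:: x; y; z]) = tup 2 [:: x; (y * z)%g].
Proof. by face_tac. Qed.
Lemma face_3_3 x y z :
  face (lift ord0 (lift ord0 (lift ord0 ord0))) (tup 3 [:: x; y; z])
    = tup 2 [:: x; y].
Proof. by face_tac. Qed.

Definition faceE := (face_1_0, face_1_1, face_2_0, face_2_1, face_2_2,
  face_3_0, face_3_1, face_3_2, face_3_3).
End Tup.

Section Bar.
Variables (k : comNzRingType) (G : groupType) (M : gmodule k G).
Implicit Types (x y z : G) (m : M).

Definition bar_dU n (g : {ffun 'I_n.+1 -> G}) (m : M) : chain M n :=
  \sum_(i < n.+2)
    << (-1) ^+ i *: (if i == ord0 then gact M (g ord0)^-1%g m else m) *g face i g >>.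

Lemma bar_dUD n (g : {ffun 'I_n.+1 -> G}) :
  @addmor M {malg M[{ffun 'I_n -> G}]} (bar_dU g).
Proof.
move=> a b; rewrite /bar_dU -big_split /=; apply: eq_bigr => i _.
by rewrite -monalgUD -scalerDr; case: ifP => // _; rewrite linearD.
Qed.

Lemma bar_dE n (c : chain M n.+1) : bar_d c = mext (@bar_dU n) c.
Proof. by rewrite mext.unlock. Qed.

Lemma bar_dD n : @addmor {malg M[{ffun 'I_n.+1 -> G}]} {malg M[{ffun 'I_n -> G}]}
  (@bar_d k G M n).
Proof. by move=> c d; rewrite !bar_dE mextD //; apply: bar_dUD. Qed.

Lemma bar_d1 m x : bar_d (<< m *g tup 1 [:: x] >> : chain M 1) =
  << gact M x^-1%g m *g tup 0 [::] >> - << m *g tup 0 [::] >> :> {malg M[_]}.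
Proof.
rewrite bar_dE mextU; last exact: bar_dUD.
rewrite /bar_dU !big_ord_recl big_ord0 /= !faceE tup_nth0 /= addr0.
by rewrite expr0 expr1 !scaleN1r scale1r monalgUN.
Qed.

Lemma bar_d2 m x y : bar_d (<< m *g tup 2 [:: x; y] >> : chain M 2) =
  << gact M x^-1%g m *g tup 1 [:: y] >> - << m *g tup 1 [:: (x * y)%g] >>
  + << m *g tup 1 [:: x] >> :> {malg M[_]}.
Proof.
rewrite bar_dE mextU; last exact: bar_dUD.
rewrite /bar_dU !big_ord_recl big_ord0 /= !faceE tup_nth0 /= addr0.
by rewrite /bump /= !exprS expr0 !mulN1r !opprK !scaleN1r !scale1r monalgUN addrA.
Qed.

Lemma bar_d3 m x y z : bar_d (<< m *g tup 3 [:: x; y; z] >> : chain M 3) =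
  << gact M x^-1%g m *g tup 2 [:: y; z] >> - << m *g tup 2 [:: (x * y)%g; z] >>
  + << m *g tup 2 [:: x; (y * z)%g] >> - << m *g tup 2 [:: x; y] >> :> {malg M[_]}.
Proof.
rewrite bar_dE mextU; last exact: bar_dUD.
rewrite /bar_dU !big_ord_recl big_ord0 /= !faceE tup_nth0 /= addr0.
by rewrite /bump /= !exprS expr0 !mulN1r !opprK !scaleN1r !scale1r !monalgUN !addrA.
Qed.

Lemma gactVK x : cancel (gact M x^-1%g) (gact M x).
Proof. by move=> m; rewrite -gactM mulgV gact1. Qed.
End Bar.

(** A least degree of at most 1 means that all first homology groups vanish or that all second ones
    do. Both cases are carried along, in place of a dimension shift from the first to the second. *)
Definition hd_le1_alt (k : comNzRingType) (G : groupType) :=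
  (forall M : gmodule k G, homology_vanishes M 0) \/
  (forall M : gmodule k G, homology_vanishes M 1).

Lemma dim_le_least1 (P : nat -> Prop) : dim_le (least P) 1 -> P 0%N \/ P 1%N.
Proof.
rewrite /least; case: pselect => // exP /=.
case: ex_minnP => m /asboolP Pm _ /=.
by case: m Pm => [|[|//]]; [left|right].
Qed.

Lemma hd_le1P k G : dim_le (hd k G) 1 -> hd_le1_alt k G.
Proof. exact: dim_le_least1. Qed.

Lemma cd_le1 k G : (forall M : gmodule k G, cohomology_vanishes M 1) ->
  dim_le (cd k G) 1.
Proof.
move=> H; rewrite /cd /least; case: pselect => [exP|[]]; last first.
  by exists 1%N; apply/asboolP.
by case: ex_minnP => m _ /(_ 1%N) /=; apply; apply/asboolP.
Qed.

Local Open Scope ring_scope.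

(** * Shapiro's lemma *)

Section MalgLmod.
Variables (k : comNzRingType) (M : lmodType k) (K : choiceType).
Definition malgl : Type := {malg M[K]}.
HB.instance Definition _ := GRing.Zmodule.on malgl.

Definition malgl_scale (a : k) (c : malgl) : malgl :=
  mext (fun x (m : M) => << a *: m *g x >>) c.

Lemma malgl_scale_addmor a : addmor (malgl_scale a).
Proof. by apply: mextD => x m m'; rewrite scalerDr monalgUD. Qed.

Lemma malgl_scaleU a m x : malgl_scale a << m *g x >> = << a *: m *g x >>.
Proof. by rewrite /malgl_scale mextU // => y n n'; rewrite scalerDr monalgUD. Qed.

Lemma malgl_scaleE a (c : malgl) x : mcoeff x (malgl_scale a c) = a *: mcoeff x c.
Proof.
move: c; apply: (@malg_addmor_eq K M M) => [c d|c d|m y].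
- by rewrite malgl_scale_addmor mcoeffD.
- by rewrite mcoeffD scalerDr.
- by rewrite malgl_scaleU !mcoeffU; case: eqP => _; rewrite ?mulr1n // !mulr0n scaler0.
Qed.

Fact malgl_scaleA a b (c : malgl) :
  malgl_scale a (malgl_scale b c) = malgl_scale (a * b) c.
Proof. by apply/malgP => x; rewrite !malgl_scaleE scalerA. Qed.
Fact malgl_scale1 : left_id 1 malgl_scale.
Proof. by move=> c; apply/malgP => x; rewrite !malgl_scaleE scale1r. Qed.
Fact malgl_scaleDr : right_distributive malgl_scale +%R.
Proof. by move=> a c d; apply: malgl_scale_addmor. Qed.
Fact malgl_scaleDl (c : malgl) : {morph malgl_scale^~ c : a b / a + b}.
Proof. by move=> a b; apply/malgP => x; rewrite mcoeffD !malgl_scaleE scalerDl. Qed.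

HB.instance Definition _ := GRing.Zmodule_isLmodule.Build k malgl
  malgl_scaleA malgl_scale1 malgl_scaleDr malgl_scaleDl.

Lemma malgl_scalerU a m x : a *: (<< m *g x >> : malgl) = << a *: m *g x >>.
Proof. exact: malgl_scaleU. Qed.
End MalgLmod.

Section Shapiro.
Variables (k : comNzRingType) (G H : groupType) (f : {multiplicative H -> G}).
Hypothesis f_inj : injective f.

Let coset (x y : G) : bool := `[< exists h, y = (x * f h)%g >].

Lemma coset_refl x : coset x x.
Proof. by apply/asboolP; exists 1%g; rewrite (mulmor1 (@gmulfM _ _ f)) mulg1. Qed.
Lemma coset_eq x h : coset (x * f h)%g =1 coset x.
Proof.
move=> y; apply/asboolP/asboolP => -[h' ->].
  by exists (h * h')%g; rewrite gmulfM mulgA.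
by exists (h^-1 * h')%g; rewrite -mulgA -gmulfM mulVKg.
Qed.

Let sig0 (x : G) : G := xchoose (ex_intro _ x (coset_refl x)).
(** The chosen representative of the left coset of x. It is 1 on the image of H, so that [incl]
    lands in the summand of the trivial coset and [retr] undoes it. *)
Definition csig (x : G) : G := if coset x 1%g then 1%g else sig0 x.

Lemma csigP x : coset x (csig x).
Proof. by rewrite /csig; case: ifP => // _; apply: (xchooseP (ex_intro _ x (coset_refl x))). Qed.
Lemma csigM x h : csig (x * f h)%g = csig x.
Proof.
rewrite /csig coset_eq; case: ifP => // _.
by apply: eq_xchoose; apply: coset_eq.
Qed.
Lemma crho_ex x : exists h, x = (csig x * f h)%g.
Proof.
have /asboolP[h eh] := csigP x; exists h^-1%g.
by rewrite eh -mulgA -gmulfM mulgV (mulmor1 (@gmulfM _ _ f)) mulg1.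
Qed.
Definition crho x : H := projT1 (cid (crho_ex x)).
Lemma crhoE x : x = (csig x * f (crho x))%g.
Proof. by rewrite /crho; case: cid. Qed.
Lemma csigK x : csig (csig x) = csig x.
Proof. by rewrite [in RHS](crhoE x) csigM. Qed.
Lemma csig1 : csig 1%g = 1%g.
Proof. by rewrite /csig coset_refl. Qed.
Lemma crhoM x h : crho (x * f h)%g = (crho x * h)%g.
Proof.
apply: f_inj; apply: (@mulgI _ (csig x)).
by rewrite -{1}(csigM x h) -crhoE gmulfM mulgA -crhoE.
Qed.
Lemma crho_sig x : csig x = x -> crho x = 1%g.
Proof.
move=> sx; apply: f_inj; apply: (@mulgI _ (csig x)).
by rewrite -crhoE sx (mulmor1 (@gmulfM _ _ f)) mulg1.
Qed.

Record trv := Trv { trv_val : G; _ : csig trv_val == trv_val }.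
HB.instance Definition _ := [isSub for trv_val].
HB.instance Definition _ := [Choice of trv by <:].
Definition tsg (x : G) : trv := Trv (introT eqP (csigK x)).
Lemma tsg_val (x : trv) : tsg (trv_val x) = x.
Proof. by apply: val_inj; rewrite /= (eqP (valP x)). Qed.
Lemma crho_trv (x : trv) : crho (trv_val x) = 1%g.
Proof. by apply: crho_sig; apply/eqP; case: x. Qed.
Lemma csig_mul g x : csig (g * csig x)%g = csig (g * x)%g.
Proof. by rewrite [in RHS](crhoE x) mulgA csigM. Qed.
Lemma tsg_mul g x : tsg (g * csig x)%g = tsg (g * x)%g.
Proof. by apply: val_inj; rewrite /= csig_mul. Qed.
Lemma crho_mul g x : crho (g * x)%g = (crho (g * csig x) * crho x)%g.
Proof. by rewrite {1}(crhoE x) mulgA crhoM. Qed.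

Variable M : gmodule k H.
Notation indM := (malgl M trv).

(** Action on the induced module, the sum of copies of M over a transversal: if g x = y f(h) with y
    in the transversal, then g sends x (x) m to y (x) h m. *)
Definition ind_actU g (x : trv) (m : M) : indM :=
  << gact M (crho (g * trv_val x)%g) m *g tsg (g * trv_val x)%g >>.
Lemma ind_actUD g x : addmor (ind_actU g x).
Proof. by move=> m n; rewrite /ind_actU linearD monalgUD. Qed.
Definition ind_act g (c : indM) : indM := mext (ind_actU g) c.
Lemma ind_actD g : addmor (ind_act g).
Proof. by apply: mextD => x; apply: ind_actUD. Qed.
Lemma ind_act_U g m x : ind_act g (<< m *g x >> : indM) = ind_actU g x m.
Proof. by rewrite /ind_act mextU //; apply: ind_actUD. Qed.

Fact ind_act_linear g : linear (ind_act g).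
Proof.
move=> a c d; rewrite ind_actD; congr (_ + _).
move: c; apply: (@malg_addmor_eq trv M) => [c d'|c d'|m x].
- by rewrite scalerDr ind_actD.
- by rewrite ind_actD scalerDr.
- by rewrite malgl_scalerU !ind_act_U /ind_actU malgl_scalerU linearZ.
Qed.
HB.instance Definition _ g :=
  GRing.isLinear.Build k indM indM *:%R (ind_act g) (ind_act_linear g).

Fact ind_act1 (c : indM) : ind_act 1%g c = c.
Proof.
move: c; apply: (@malg_addmor_eq trv M) => [|//|m x]; first exact: ind_actD.
by rewrite ind_act_U /ind_actU mul1g crho_trv gact1 tsg_val.
Qed.
Fact ind_actM g h (c : indM) : ind_act (g * h)%g c = ind_act g (ind_act h c).
Proof.
move: c; apply: (@malg_addmor_eq trv M) => [|c d|m x]; first exact: ind_actD.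
  by rewrite !ind_actD.
rewrite !ind_act_U /ind_actU -mulgA /=.
by rewrite (crho_mul g (h * trv_val x)%g) gactM tsg_mul.
Qed.

Definition ind_mod : gmodule k G := @GModule k G indM
  (fun g => ind_act g : {linear indM -> indM}) ind_act1 ind_actM.

(** With y = [cnext g x], the image of [ckap g x] in G is x^-1 g y. A bar [g_1 | ... | g_n] is read
    as a path of cosets starting at x, and each step is translated into H. *)
Definition ckap (g : G) (x : trv) : H := ((crho (g^-1 * trv_val x))^-1)%g.
Definition cnext (g : G) (x : trv) : trv := tsg (g^-1 * trv_val x)%g.

Lemma ckapM g h x : ckap (g * h)%g x = (ckap g x * ckap h (cnext g x))%g.
Proof. by rewrite /ckap -invgM /cnext /= invgM -mulgA (crho_mul h^-1%g). Qed.
Lemma cnextM g h x : cnext (g * h)%g x = cnext h (cnext g x).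
Proof. by rewrite /cnext /= tsg_mul invgM mulgA. Qed.

Fixpoint hseq (x : trv) (s : seq G) : seq H :=
  if s is g :: s' then ckap g x :: hseq (cnext g x) s' else [::].

Definition retr_basis n (x : trv) (g : {ffun 'I_n -> G}) : {ffun 'I_n -> H} :=
  tup n (hseq x (codom g)).
Definition retrU n (g : {ffun 'I_n -> G}) (c : indM) : chain M n :=
  mext (fun x (m : M) => << m *g retr_basis x g >>) c.
Definition retr n (c : chain ind_mod n) : chain M n := mext (@retrU n) c.

Lemma codom_tup (K : groupType) n (s : seq K) : size s = n -> codom (tup n s) = s.
Proof.
move=> sn; apply: (@eq_from_nth _ 1%g) => [|i]; rewrite size_codom card_ord //.
move=> lt_in; rewrite (nth_map (Ordinal lt_in)) ?size_enum_ord //.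
by rewrite ffunE nth_enum_ord.
Qed.

Lemma retrUD n (g : {ffun 'I_n -> G}) : @addmor indM {malg M[_]} (retrU g).
Proof. by apply: mextD => x; apply: malgUD. Qed.
Lemma retrD n : @addmor {malg indM[_]} {malg M[_]} (@retr n).
Proof. by apply: mextD => g; apply: retrUD. Qed.
Lemma retr_U n m x (s : seq G) : size s = n ->
  retr (<< (<< m *g x >> : indM) *g tup n s >> : chain ind_mod n)
  = << m *g tup n (hseq x s) >>.
Proof.
move=> sn; rewrite /retr mextU; last exact: retrUD.
by rewrite /retrU mextU /retr_basis ?codom_tup // => y; apply: malgUD.
Qed.

Lemma retr_U1 m x g :
  retr (<< (<< m *g x >> : indM) *g tup 1 [:: g] >> : chain ind_mod 1)
  = << m *g tup 1 [:: ckap g x] >>.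
Proof. exact: retr_U. Qed.
Lemma retr_U2 m x g h :
  retr (<< (<< m *g x >> : indM) *g tup 2 [:: g; h] >> : chain ind_mod 2)
  = << m *g tup 2 [:: ckap g x; ckap h (cnext g x)] >>.
Proof. exact: retr_U. Qed.
Lemma retr_U3 m x g h l :
  retr (<< (<< m *g x >> : indM) *g tup 3 [:: g; h; l] >> : chain ind_mod 3)
  = << m *g tup 3 [:: ckap g x; ckap h (cnext g x); ckap l (cnext h (cnext g x))] >>.
Proof. exact: retr_U. Qed.

Lemma ind_actV_U g m x : gact ind_mod g^-1%g (<< m *g x >> : indM) =
  << gact M (ckap g x)^-1%g m *g cnext g x >>.
Proof. by rewrite /= ind_act_U /ind_actU /ckap invgK. Qed.

Lemma retr_ind n (P : chain ind_mod n -> Prop) :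
  P (0 : {malg _[_]}) ->
  (forall c d : {malg indM[_]}, P c -> P d -> P (c + d)) ->
  (forall m x g, P << (<< m *g x >> : indM) *g g >>) -> forall c, P c.
Proof.
move=> P0 PD PU; apply: malg_ind => // F g; move: F.
by apply: malg_ind => [|c d Pc Pd|//]; rewrite ?monalgU0 // monalgUD; apply: PD.
Qed.

Lemma retr_d1 (b : chain ind_mod 2) : retr (bar_d b) = bar_d (retr b).
Proof.
elim/retr_ind: b => [|c d IHc IHd|m x g].
- by rewrite ?(addmor0 (@bar_dD _ _ _ _)) ?(addmor0 (@retrD _)) ?(addmor0 (@bar_dD _ _ _ _)).
- by rewrite bar_dD !retrD bar_dD IHc IHd.
case: (ffun2_tup g) => g1 [g2 ->].
rewrite bar_d2 retr_U2 bar_d2 ind_actV_U retrD (addmorB (@retrD _)).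
by rewrite !retr_U1 ckapM.
Qed.

Lemma retr_d2 (b : chain ind_mod 3) : retr (bar_d b) = bar_d (retr b).
Proof.
elim/retr_ind: b => [|c d IHc IHd|m x g].
- by rewrite ?(addmor0 (@bar_dD _ _ _ _)) ?(addmor0 (@retrD _)) ?(addmor0 (@bar_dD _ _ _ _)).
- by rewrite bar_dD !retrD bar_dD IHc IHd.
case: (ffun3_tup g) => g1 [g2 [g3 ->]].
rewrite bar_d3 retr_U3 bar_d3 ind_actV_U (addmorB (@retrD _)) retrD (addmorB (@retrD _)).
by rewrite !retr_U2 !ckapM cnextM.
Qed.

Definition inclU n (h : {ffun 'I_n -> H}) (m : M) : chain ind_mod n :=
  << (<< m *g tsg 1%g >> : indM) *g tup n (map f (codom h)) >>.
Lemma inclUD n (h : {ffun 'I_n -> H}) : @addmor M {malg indM[_]} (inclU h).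
Proof. by move=> m m'; rewrite /inclU !monalgUD. Qed.
Definition incl n (c : chain M n) : chain ind_mod n := mext (@inclU n) c.
Lemma inclD n : @addmor {malg M[_]} {malg indM[_]} (@incl n).
Proof. by apply: mextD => h; apply: inclUD. Qed.
Lemma incl_U n m (s : seq H) : size s = n ->
  incl (<< m *g tup n s >> : chain M n)
  = << (<< m *g tsg 1%g >> : indM) *g tup n (map f s) >>.
Proof.
by move=> sn; rewrite /incl mextU /inclU ?codom_tup //; apply: inclUD.
Qed.

Lemma incl_U0 m : incl (<< m *g tup 0 [::] >> : chain M 0)
  = << (<< m *g tsg 1%g >> : indM) *g tup 0 [::] >>.
Proof. exact: incl_U. Qed.
Lemma incl_U1 m x : incl (<< m *g tup 1 [:: x] >> : chain M 1)
  = << (<< m *g tsg 1%g >> : indM) *g tup 1 [:: f x] >>.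
Proof. exact: incl_U. Qed.
Lemma incl_U2 m x y : incl (<< m *g tup 2 [:: x; y] >> : chain M 2)
  = << (<< m *g tsg 1%g >> : indM) *g tup 2 [:: f x; f y] >>.
Proof. exact: incl_U. Qed.

Lemma ckap_f h : ckap (f h) (tsg 1%g) = h.
Proof.
by rewrite /ckap /= csig1 -(mulmorV (@gmulfM _ _ f)) mulg1 -(mul1g (f _)) crhoM crho_sig ?csig1 // mul1g invgK.
Qed.
Lemma cnext_f h : cnext (f h) (tsg 1%g) = tsg 1%g.
Proof.
apply: val_inj; rewrite /= csig1 -(mulmorV (@gmulfM _ _ f)) mulg1 -(mul1g (f _)) csigM csig1 //.
Qed.

Lemma incl_d0 (c : chain M 1) : bar_d (incl c) = incl (bar_d c).
Proof.
move: c; apply: malg_addmor_eq => [c d|c d|m g].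
- by rewrite inclD bar_dD.
- by rewrite bar_dD inclD.
case: (ffun1_tup g) => g1 ->.
rewrite bar_d1 incl_U1 bar_d1 (addmorB (@inclD _)) !incl_U0.
by rewrite (@ind_actV_U (f g1)) ckap_f cnext_f.
Qed.
Lemma incl_d1 (c : chain M 2) : bar_d (incl c) = incl (bar_d c).
Proof.
move: c; apply: malg_addmor_eq => [c d|c d|m g].
- by rewrite inclD bar_dD.
- by rewrite bar_dD inclD.
case: (ffun2_tup g) => g1 [g2 ->].
rewrite bar_d2 incl_U2 bar_d2 inclD (addmorB (@inclD _)) !incl_U1.
by rewrite (@ind_actV_U (f g1)) ckap_f cnext_f gmulfM.
Qed.

(** This makes the homology of H in M a direct summand of that of G in the induced module. The
    descent of vanishing needs no more of Shapiro's lemma, and in particular no homotopy. *)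
Lemma inclK n (c : chain M n) : retr (incl c) = c.
Proof.
move: c; apply: malg_addmor_eq => [c d|//|m g].
  by rewrite inclD retrD.
have -> : g = tup n (codom g).
  apply/ffunP => i; rewrite ffunE (nth_map i) ?size_enum_ord //.
  by rewrite nth_ord_enum.
rewrite incl_U ?retr_U ?size_map -?enumT ?size_enum_ord //.
congr (<< m *g tup n _ >>); elim: (codom g) => //= h s IH.
by rewrite ckap_f cnext_f IH.
Qed.

Lemma Shapiro0 : homology_vanishes ind_mod 0 -> homology_vanishes M 0.
Proof.
move=> hv c dc; have [|b db] := hv (incl c).
  by rewrite incl_d0 dc (addmor0 (@inclD _)).
by exists (retr b); rewrite -retr_d1 db inclK.
Qed.
Lemma Shapiro1 : homology_vanishes ind_mod 1 -> homology_vanishes M 1.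
Proof.
move=> hv c dc; have [|b db] := hv (incl c).
  by rewrite incl_d1 dc (addmor0 (@inclD _)).
by exists (retr b); rewrite -retr_d2 db inclK.
Qed.
End Shapiro.

Lemma hd_le1_alt_sub (k : comNzRingType) (G H : groupType) (f : {multiplicative H -> G}) :
  injective f -> hd_le1_alt k G -> hd_le1_alt k H.
Proof.
move=> f_inj [hv|hv]; [left|right] => M.
  by apply: (@Shapiro0 k G H f f_inj M).
by apply: (@Shapiro1 k G H f f_inj M).
Qed.

Local Open Scope ring_scope.

(** * Constants in function modules *)

Section MapChain.
Variables (k : comNzRingType) (G : groupType) (M N : gmodule k G) (phi : M -> N).
Hypothesis phiD : addmor phi.
Hypothesis phiG : forall g m, phi (gact M g m) = gact N g (phi m).

Definition mapc n (c : chain M n) : chain N n :=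
  mext (fun g (m : M) => << phi m *g g >>) c.
Lemma mapcD n : @addmor {malg M[_]} {malg N[_]} (@mapc n).
Proof. by apply: mextD => g m m'; rewrite phiD monalgUD. Qed.
Lemma mapc_U n m (g : {ffun 'I_n -> G}) :
  mapc (<< m *g g >> : chain M n) = << phi m *g g >>.
Proof. by rewrite /mapc mextU // => h x y; rewrite phiD monalgUD. Qed.
Lemma mapc_d (c : chain M 2) : bar_d (mapc c) = mapc (bar_d c).
Proof.
move: c; apply: malg_addmor_eq => [c d|c d|m g].
- by rewrite mapcD bar_dD.
- by rewrite bar_dD mapcD.
case: (ffun2_tup g) => x [y ->].
by rewrite mapc_U !bar_d2 mapcD (addmorB (@mapcD _)) !mapc_U phiG.
Qed.
End MapChain.

Section Trivial.
Variables (k : comNzRingType) (G : groupType).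
Definition triv_mod : gmodule k G := @GModule k G k^o (fun _ => idfun : {linear k^o -> k^o})
  (fun _ => erefl) (fun _ _ _ => erefl).
End Trivial.

Section FunMod.
Variables (k : comNzRingType) (G : groupType) (X : Type) (act : G -> X -> X).
Hypothesis act1 : forall x, act 1%g x = x.
Hypothesis actM : forall g h x, act (g * h)%g x = act g (act h x).

Definition fun_act (g : G) (F : X -> k^o) : X -> k^o := fun x => F (act g^-1%g x).
Fact fun_act_linear g : linear (fun_act g).
Proof. by []. Qed.
HB.instance Definition _ g := GRing.isLinear.Build k (X -> k^o) (X -> k^o) *:%R
  (fun_act g) (fun_act_linear g).
Fact fun_act1 F : fun_act 1%g F = F.
Proof. by apply/funext => x; rewrite /fun_act invg1 act1. Qed.
Fact fun_actM g h F : fun_act (g * h)%g F = fun_act g (fun_act h F).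
Proof. by apply/funext => x; rewrite /fun_act invgM actM. Qed.
Definition fun_mod : gmodule k G := @GModule k G (X -> k^o)
  (fun g => fun_act g : {linear (X -> k^o) -> (X -> k^o)}) fun_act1 fun_actM.

Variable x0 : X.
Definition vanishes_at : {pred X -> k^o} := fun F => F x0 == 0.
Fact vanishes_at_submod : submod_closed vanishes_at.
Proof.
split => [|a F F']; first by rewrite unfold_in eqxx.
rewrite !unfold_in => /eqP F0 /eqP F'0.
by rewrite !fctE F0 F'0 scaler0 addr0 eqxx.
Qed.
HB.instance Definition _ := GRing.isSubmodClosed.Build k (X -> k^o) vanishes_at
  vanishes_at_submod.
(* The quotient of X -> k by the constants, each class being represented by its
   member that vanishes at x0. *)
Record redf : Type := Redf { redf_val :> X -> k^o; redf_P : vanishes_at redf_val }.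
HB.instance Definition _ := [isSub for redf_val].
HB.instance Definition _ := [Choice of redf by <:].
HB.instance Definition _ := [SubChoice_isSubLmodule of redf by <:].

Lemma redfP (F F' : redf) : (forall x, F x = F' x) -> F = F'.
Proof. by move=> FF'; apply: val_inj; apply/funext. Qed.
Lemma redf0 (F : redf) : F x0 = 0.
Proof. by case: F => F /= /eqP. Qed.

Fact reduce_proof (F : X -> k^o) : vanishes_at (fun x => F x - F x0).
Proof. exact/eqP/subrr. Qed.
Definition reduce (F : X -> k^o) : redf := Redf (reduce_proof F).
Lemma reduceD : addmor reduce.
Proof. by move=> F F'; apply: redfP => x /=; rewrite !fctE; ring. Qed.

Definition red_act g (F : redf) : redf := reduce (fun_act g F).
Fact red_act_linear g : linear (red_act g).
Proof.
move=> a F F'; apply: redfP => x /=; rewrite /fun_act !fctE.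
by rewrite scalerBr; ring.
Qed.
HB.instance Definition _ g := GRing.isLinear.Build k redf redf *:%R
  (red_act g) (red_act_linear g).
Fact red_act1 F : red_act 1%g F = F.
Proof. by apply: redfP => x /=; rewrite fun_act1 redf0 subr0. Qed.
Fact red_actM g h F : red_act (g * h)%g F = red_act g (red_act h F).
Proof. by apply: redfP => x /=; rewrite fun_actM /fun_act /=; ring. Qed.
Definition red_mod : gmodule k G := @GModule k G redf
  (fun g => red_act g : {linear redf -> redf}) red_act1 red_actM.

Lemma reduce_act g F : reduce (gact fun_mod g F) = gact red_mod g (reduce F).
Proof. by apply: redfP => x /=; rewrite /fun_act /=; ring. Qed.

(** [theta] stands for a homomorphism from G to k / pk, given by lifts to k so that no quotient ring
    is formed. With p = 0 it is a homomorphism to k itself. *)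
Variables (theta : G -> k) (p : k).
Hypothesis thetaM : forall g h, exists c, theta (g * h)%g = theta g + theta h + p * c.

(* The connecting map H_2(G, Fun(X, k) / k) -> H_1(G, k) of the constants,
   followed by theta modulo p. *)
Definition pairing2 : chain red_mod 2 -> k :=
  mext (fun (g : {ffun 'I_2 -> G}) (F : redf) => F (act (g ord0) x0) * theta (g (lift ord0 ord0))).
Lemma pairing2D : @addmor {malg redf[_]} k pairing2.
Proof. by apply: mextD => g F F'; rewrite mulrDl. Qed.
Lemma pairing2U F g h :
  pairing2 << (F : redf) *g tup 2 [:: g; h] >> = F (act g x0) * theta h.
Proof.
by rewrite /pairing2 mextU => [|y f f']; rewrite ?mulrDl // !ffunE /=.
Qed.

Lemma pairing2_d (b : chain red_mod 3) : exists c, pairing2 (bar_d b) = p * c.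
Proof.
elim/malg_ind: b => [|b b' [c e] [c' e']|F g].
- by exists 0; rewrite mulr0 (addmor0 (@bar_dD _ _ _ _)) (addmor0 pairing2D).
- by exists (c + c'); rewrite bar_dD pairing2D e e' mulrDr.
case: (ffun3_tup g) => x [y [z ->]].
rewrite bar_d3 (addmorB pairing2D) pairing2D (addmorB pairing2D) !pairing2U /=.
rewrite /fun_act invgK !actM.
have [c ->] := thetaM y z.
by exists (F (act x x0) * c); ring.
Qed.

Definition pairing1 : chain fun_mod 1 -> k :=
  mext (fun (g : {ffun 'I_1 -> G}) (F : X -> k^o) => F x0 * theta (g ord0)).
Lemma pairing1D : @addmor {malg (X -> k^o)[_]} k pairing1.
Proof. by apply: mextD => g F F'; rewrite mulrDl. Qed.
Lemma pairing1U F g : pairing1 << (F : X -> k^o) *g tup 1 [:: g] >> = F x0 * theta g.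
Proof.
by rewrite /pairing1 mextU => [|y f f']; rewrite ?mulrDl // !ffunE /=.
Qed.

(** On F[x | y] the left side is F(x x0) theta(y) - F(x0) (theta(x y) - theta(x)), which is (F(x x0)
    - F(x0)) theta(y) modulo p and hence depends on F only up to constants. *)
Lemma pairing_reduce (b : chain fun_mod 2) :
  exists c, pairing1 (bar_d b) = pairing2 (mapc (M:=fun_mod) (N:=red_mod) reduce b) + p * c.
Proof.
elim/malg_ind: b => [|b b' [c e] [c' e']|F g].
- exists 0; rewrite (addmor0 (@bar_dD _ _ _ _)) (addmor0 pairing1D) mulr0.
  by rewrite (addmor0 (@mapcD k G fun_mod red_mod reduce reduceD 2)) (addmor0 pairing2D) addr0.
- exists (c + c'); rewrite bar_dD pairing1D e e' (@mapcD k G fun_mod red_mod reduce reduceD 2).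
  by rewrite pairing2D; ring.
case: (ffun2_tup g) => x [y ->].
rewrite bar_d2 pairing1D (addmorB pairing1D) !pairing1U (mapc_U (M:=fun_mod) (N:=red_mod) reduceD).
rewrite pairing2U /= /fun_act invgK.
have [c ->] := thetaM x y.
by exists (- F x0 * c); ring.
Qed.

Definition pairing0 : chain (triv_mod k G) 1 -> k :=
  mext (fun (g : {ffun 'I_1 -> G}) (a : k^o) => a * theta (g ord0)).
Lemma pairing0D : @addmor {malg k^o[_]} k pairing0.
Proof. by apply: mextD => g F F'; rewrite mulrDl. Qed.
Lemma pairing0U (a : k^o) g : pairing0 << a *g tup 1 [:: g] >> = a * theta g.
Proof.
by rewrite /pairing0 mextU => [|y f f']; rewrite ?mulrDl // !ffunE /=.
Qed.
Lemma pairing0_d (b : chain (triv_mod k G) 2) : exists c, pairing0 (bar_d b) = p * c.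
Proof.
elim/malg_ind: b => [|b b' [c e] [c' e']|a g].
- by exists 0; rewrite mulr0 (addmor0 (@bar_dD _ _ _ _)) (addmor0 pairing0D).
- by exists (c + c'); rewrite bar_dD pairing0D e e' mulrDr.
case: (ffun2_tup g) => x [y ->].
rewrite bar_d2 pairing0D (addmorB pairing0D) !pairing0U /=.
have [c ->] := thetaM x y.
by exists (- a * c); ring.
Qed.

Definition bounds (c : chain fun_mod 1) := exists b, bar_d b = c.

(** If first homology vanishes, 1[h] bounds already with trivial coefficients. Otherwise a chain b
    bounding 1[h] becomes a cycle modulo constants, hence a boundary; [pairing2] is 0 modulo p on
    boundaries, and [pairing_reduce] identifies its value on b with theta h. *)
Theorem constant_bounds (h : G) : hd_le1_alt k G ->
  bounds << (fun=> 1 : k^o) *g tup 1 [:: h] >> -> exists c, theta h = p * c.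
Proof.
case=> [hv _|hv [b db]].
  have [|b db] := hv (triv_mod k G) << (1 : k^o) *g tup 1 [:: h] >>.
    by rewrite bar_d1 /= subrr.
  have [c e] := pairing0_d b; exists c.
  by rewrite -e db pairing0U mul1r.
have [|e de] := hv red_mod (mapc (M:=fun_mod) (N:=red_mod) reduce b).
  rewrite (mapc_d (M:=fun_mod) (N:=red_mod) reduceD reduce_act) db (mapc_U (M:=fun_mod) (N:=red_mod) reduceD).
  suff -> : reduce (fun=> 1) = 0 by rewrite monalgU0.
  by apply: redfP => x /=; rewrite subrr.
have [c ec] := pairing_reduce b; have [c' ec'] := pairing2_d e.
exists (c' + c); rewrite mulrDr -ec' de -ec db pairing1U; ring.
Qed.

Lemma boundsD c d : bounds c -> bounds d -> bounds ((c : {malg _[_]}) + d).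
Proof. by move=> [b <-] [b' <-]; exists ((b : {malg _[_]}) + b'); rewrite bar_dD. Qed.
Lemma boundsN c : bounds c -> bounds (- (c : {malg _[_]})).
Proof. by move=> [b <-]; exists (- (b : {malg _[_]})); rewrite (addmorN (@bar_dD _ _ _ _)). Qed.
Lemma boundsB c d : bounds c -> bounds d -> bounds ((c : {malg _[_]}) - d).
Proof. by move=> bc bd; apply: boundsD => //; apply: boundsN. Qed.

Notation "F @[ g ]" := (<< (F : X -> k^o) *g tup 1 [:: g%g] >> : {malg (X -> k^o)[_]})
  (at level 2, format "F @[ g ]").

Lemma bounds_mul F g h :
  bounds ((fun x => F (act g x)) @[h] - F @[g * h] + F @[g]).
Proof.
exists (<< (F : X -> k^o) *g tup 2 [:: g; h] >> : {malg _[_]}).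
by rewrite bar_d2 /= /fun_act invgK.
Qed.

Lemma bounds_1 F : bounds (F @[1]).
Proof.
have := bounds_mul F 1%g 1%g; rewrite mulg1.
by under [X in (X @[_])]funext do rewrite act1; rewrite subrr add0r.
Qed.

(** [bounds_mul] telescoped along the powers of a: a power is traded for a sum of translates, which
    the obstructions below evaluate explicitly. *)
Lemma bounds_pow F a n :
  bounds (F @[a ^+ n] - (fun x => \sum_(j < n) F (act (a ^+ j) x)) @[a]).
Proof.
elim: n => [|n IH].
  under [X in _ - X @[_]]funext do rewrite big_ord0.
  by rewrite (_ : (fun=> 0) = 0) // monalgU0 subr0 expg0; apply: bounds_1.
have -> : (fun x => \sum_(j < n.+1) F (act (a ^+ j) x)) =
  (fun x => \sum_(j < n) F (act (a ^+ j) x)) + (fun x => F (act (a ^+ n) x)).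
  by apply/funext => x; rewrite big_ord_recr.
rewrite monalgUD expgSr; have := boundsB IH (bounds_mul F (a ^+ n) a).
have E (V : zmodType) (u v w t : V) : u - v - (w - t + u) = t - (v + w).
  by rewrite [w - t + u]addrC opprD addrA [u - v - u]addrAC subrr add0r opprB addrCA opprD.
by rewrite E.
Qed.
End FunMod.

Local Open Scope ring_scope.

Definition inverts (k : comNzRingType) (n : nat) := exists c : k, n%:R * c = 1.

Notation "F @[ g ]" := (<< F *g tup 1 [:: g%g] >> : {malg _[_]})
  (at level 2, format "F @[ g ]").

(** * Obstructions to homological dimension one *)

Section PrimeOrder.
Variables (k : comNzRingType) (H : groupType) (a : H) (p : nat).
Hypotheses (gk : hd_le1_alt k H) (pp : prime p) (ap : (a ^+ p)%g = 1%g) (a1 : a <> 1%g).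
Hypothesis cyc : forall x : H, exists i, x = (a ^+ i)%g.

Let idx (x : H) : nat := projT1 (cid (cyc x)).
Let idxE x : (a ^+ idx x)%g = x.
Proof. by rewrite /idx; case: cid. Qed.

Let expg_modp i j : (a ^+ i)%g = (a ^+ j)%g -> exists c : k, i%:R = j%:R + p%:R * c.
Proof.
wlog le : i j / (j <= i)%N => [W e|e].
  have [le|/ltnW le] := leqP j i; first exact: W.
  by have [c ec] := W _ _ le (esym e); exists (- c); rewrite ec; ring.
have : (a ^+ (i - j))%g = 1%g by rewrite expgnFr // e mulgV.
move=> /(prime_expg_dvd pp ap a1)/dvdnP[q eq]; exists q%:R.
by rewrite -natrM -natrD; congr _%:R; lia.
Qed.

Let delta_sum x : \sum_(j < p) ((a ^+ j * x)%g == 1%g)%:R = 1 :> k.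
Proof.
pose r := idx x; have p0 := prime_gt0 pp.
have lt : ((p - r %% p) %% p < p)%N by rewrite ltn_pmod.
rewrite (bigD1 (Ordinal lt)) //= big1 ?addr0 => [|j /eqP ne].
  rewrite -{1}(idxE x) -expgnDr (_ : _ == _ = true) //.
  apply/eqP; have /dvdnP[q ->] : (p %| ((p - r %% p) %% p + idx x))%N.
    by rewrite /dvdn modnDml -modnDmr subnK ?modnn // ltnW // ltn_pmod.
  by rewrite mulnC expgnA ap expg1n.
case: eqP => // e; case: ne; apply: val_inj => /=.
have : (p %| j + r)%N by apply: (prime_expg_dvd pp ap a1); rewrite expgnDr idxE.
have := ltn_pmod r p0; have := ltn_ord j; have := divn_eq r p.
set q := (r %/ p)%N; set s := (r %% p)%N => er lj ls.
rewrite er addnCA dvdn_addr ?dvdn_mull // => /dvdnP[[|[|t]] e'].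
- by rewrite (_ : s = 0%N) ?subn0 ?modnn; lia.
- by rewrite modn_small; lia.
- by exfalso; nia.
Qed.

(** Let F be the indicator function of 1. Its p translates sum to the constant 1, so [bounds_pow]
    makes 1[a] homologous to F[a^p] = F[1], a boundary. The discrete logarithm to base a is a
    homomorphism modulo p with value 1 at a, so p divides 1 in k. *)
Lemma inverts_prime_order_cyclic : inverts k p.
Proof.
have act1 (x : H) : (1 * x)%g = x by rewrite mul1g.
have actM (g h x : H) : (g * h * x)%g = (g * (h * x))%g by rewrite mulgA.
have thM g h : exists c : k, (idx (g * h)%g)%:R = (idx g)%:R + (idx h)%:R + p%:R * c.
  by rewrite -natrD; apply: expg_modp; rewrite expgnDr !idxE.
have [|c ec] := @constant_bounds k H H (fun g x => (g * x)%g) act1 actM 1%g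
  (fun g => (idx g)%:R) p%:R thM a gk.
  pose F : H -> k^o := fun x => (x == 1%g)%:R.
  have := bounds_pow act1 actM F a p; rewrite ap.
  move=> /(boundsB (bounds_1 act1 actM F)); rewrite opprB addrCA subrr addr0.
  suff -> : (fun x => \sum_(j < p) F (a ^+ j * x)%g) = (fun=> 1) by [].
  by apply/funext => x; apply: delta_sum.
have [c' ec'] : exists c' : k, (idx a)%:R = 1%:R + p%:R * c'.
  by apply: expg_modp; rewrite idxE expg1.
by exists (c - c'); rewrite mulrBr -ec ec'; ring.
Qed.
End PrimeOrder.

Section Torsion.
Variables (k : comNzRingType) (G : groupType).
Hypothesis gk : hd_le1_alt k G.

Lemma inverts_prime_order (g : G) p : prime p -> (g ^+ p)%g = 1%g -> g <> 1%g -> inverts k p.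
Proof.
move=> pp gp g1; pose P (x : G) := exists i, x = (g ^+ i)%g.
have sP : subgroup P.
  split=> [|x y [i ->] [j ->]|x [i ->]]; first by exists 0%N.
    by exists (i + j)%N; rewrite expgnDr.
  exists (i * p.-1)%N; apply/mulg1_eq; rewrite -expgnDr -mulnS prednK ?prime_gt0 //.
  by rewrite mulnC expgnA gp expg1n.
have [H [f [f_inj fP]]] := subgroup_type sP.
have [a fa] : exists a, f a = g by apply/fP; exists 1%N; rewrite expg1.
have fM := @gmulfM _ _ f.
apply: (@inverts_prime_order_cyclic k H a p (hd_le1_alt_sub f_inj gk) pp).
- by apply: f_inj; rewrite (mulmorX fM) fa gp (mulmor1 fM).
- by move=> e; apply: g1; rewrite -fa e (mulmor1 fM).
- move=> x; have [i e] : P (f x) by apply/fP; exists x.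
  by exists i; apply: f_inj; rewrite e (mulmorX fM) fa.
Qed.

Lemma invertsM m n : inverts k m -> inverts k n -> inverts k (m * n).
Proof. by move=> [c ec] [d ed]; exists (c * d); rewrite natrM mulrACA ec ed mulr1. Qed.

Lemma inverts_primes n : (0 < n)%N ->
  (forall p, prime p -> (p %| n)%N -> inverts k p) -> inverts k n.
Proof.
elim/ltn_ind: n => n IH n0 np; have [le1|lt1] := leqP n 1.
  by rewrite (_ : n = 1)%N; [exists 1; rewrite mulr1|lia].
have dn := pdiv_dvd n; have pp := pdiv_prime lt1.
rewrite -(divnK dn); apply: invertsM; last exact: np.
apply: IH; rewrite ?ltn_Pdiv ?prime_gt1 //; first by rewrite divn_gt0 ?prime_gt0 // dvdn_leq.
by move=> p' pp' pd; apply: np => //; apply: dvdn_trans pd (dvdn_div dn).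
Qed.

Lemma inverts_torsion (g : G) : torsion g ->
  exists o, [/\ (0 < o)%N, (g ^+ o)%g = 1%g & inverts k o].
Proof.
move=> [n n0 gn]; have [o [o0 go op]] := torsion_prime_power n0 gn.
exists o; split=> //; apply: inverts_primes => // p pp /(op p pp)[y [y1 yp _]].
exact: inverts_prime_order yp y1.
Qed.

Lemma inverts_fin_subgroup (F : seq G) : fin_subgroup F -> inverts k (size (undup F)).
Proof.
move=> fF; apply: inverts_primes.
  by case: fF => F1 _; rewrite lt0n size_eq0; apply: contraTneq F1 => e;
     rewrite -mem_undup e.
move=> p pp /(Cauchy_list fF pp)[x [_ x1 xp]].
exact: inverts_prime_order xp x1.
Qed.
End Torsion.

Section Hermite.
Variables (R : archiRealFieldType) (m : nat).
Hypothesis m0 : (0 < m)%N.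
Let phi (x : R) : int := Num.floor (x / m%:R).

Lemma floor_div_shift x : phi (x + m%:R) = phi x + 1.
Proof. by rewrite /phi mulrDl divff ?pnatr_eq0 -?lt0n // floorDrz ?int_num1 // floor1. Qed.

(** Replacing x by x + 1 shifts the summands cyclically, one of them gaining 1. It therefore
    suffices that every summand vanishes for x in [0, 1). *)
Lemma Hermite_identity (x : R) :
  \sum_(j < m) Num.floor ((x + j%:R) / m%:R) = Num.floor x.
Proof.
pose S (x : R) : int := \sum_(j < m) phi (x + j%:R).
have S1 y : S (y + 1) = S y + 1.
  have : \sum_(j < m.+1) phi (y + j%:R) = \sum_(j < m.+1) phi (y + j%:R) by [].
  rewrite [in LHS]big_ord_recl big_ord_recr /= floor_div_shift addr0 => e.
  apply: (@addrI _ (phi y)); rewrite [RHS]addrCA.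
  apply: etrans e; congr (_ + _).
  by apply: eq_bigr => j _; rewrite -addrA /bump leq0n add1n -natr1 [1 + _]addrC.
have Sn y n : S (y + n%:R) = S y + n%:R.
  elim: n => [|n IH]; first by rewrite !mulr0n !addr0.
  by rewrite -natr1 addrA S1 IH -[in RHS]natr1 addrA.
have Sz y (z : int) : S (y + z%:~R) = S y + z.
  case: z => n; first by rewrite [_%:~R]/= Sn natz.
  rewrite NegzE mulrNz; apply: (@addIr _ n.+1%:R); rewrite -Sn.
  by rewrite subrK -[_ + _%:R]addrA -natz addNr addr0.
have S0 y : 0 <= y < 1 -> S y = 0.
  move=> /andP[y0 y1]; rewrite /S big1 // => j _; apply: floor_def.
  have mp : 0 < m%:R :> R by rewrite ltr0n.
  rewrite divr_ge0 ?addr_ge0 ?ler0n //= ltr_pdivrMr // add0r mul1r.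
  have : j%:R + 1 <= m%:R :> R by rewrite natr1 ler_nat.
  lra.
rewrite -[LHS]/(S x) -{1}[x](subrK (Num.floor x)%:~R) Sz S0 ?add0r //.
have /andP[] := floor_itv x; rewrite intrD; lra.
Qed.
End Hermite.

Section Affine.
Variables (R : archiRealFieldType) (k : comNzRingType) (H : groupType) (act : H -> R -> R) (chi : H -> int).
Hypotheses (act1 : forall x, act 1%g x = x)
  (actM : forall g h x, act (g * h)%g x = act g (act h x))
  (chiM : forall g h, chi (g * h)%g = chi g + chi h).
Variables (a u tau : H) (n m o : nat).
Hypotheses (m0 : (0 < m)%N) (n0 : (0 < n)%N) (ko : inverts k o).
Hypotheses (act_a : forall x, act a x = x + 1) (act_tau : forall x, act tau x = x)
  (act_u : forall x, act u x = m%:R / n%:R * x).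
Hypotheses (rel : (u * a ^+ n = a ^+ m * u * tau)%g) (tau_o : (tau ^+ o)%g = 1%g)
  (chi_u : chi u = 1).

(* Write F[g] for the chain F * [g].  The function F x = floor (x / m) satisfies
   F (a^m x) = F x + 1 and F (u x) = floor (x / n), and by Hermite's identity
   F[a^m] and floor (x / n)[a^n] are both homologous to (floor x)[a].  Hence the
   relation u a^n = a^m u tau makes the constant chain 1[u] a boundary. *)
Lemma no_affine_action : ~ hd_le1_alt k H.
Proof.
move=> gk; have thM g h : exists c : k, (chi (g * h)%g)%:~R = (chi g)%:~R + (chi h)%:~R + 0 * c.
  by exists 0; rewrite mulr0 addr0 chiM intrD.
have act_aX j x : act (a ^+ j)%g x = x + j%:R.
  elim: j x => [|j IH] x; first by rewrite expg0 act1 addr0.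
  by rewrite expgS actM act_a IH -natr1 addrA.
have act_tauX j x : act (tau ^+ j)%g x = x.
  by elim: j => [|j IH]; rewrite ?expg0 ?act1 // expgS actM act_tau IH.
have [|c ec] := @constant_bounds k H R act act1 actM 0 (fun g => (chi g)%:~R) 0 thM u gk;
  last first.
  by move: ec; rewrite chi_u mul0r => /eqP; rewrite oner_eq0.
pose fl (d : nat) (x : R) : k^o := (Num.floor (x / d%:R))%:~R.
pose F1 : R -> k^o := fun x => (Num.floor x)%:~R.
have flE d x : (0 < d)%N -> \sum_(j < d) fl d (x + j%:R) = F1 x.
  by move=> d0; rewrite /F1 -(Hermite_identity d0) (big_morph _ (@intrD k) (mulr0z _)).
have Fu : (fun x => fl m (act u x)) = fl n.
  apply/funext => x; rewrite /fl act_u; congr ((Num.floor _)%:~R).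
  by field; rewrite !pnatr_eq0 -!lt0n n0 m0.
have Fa : (fun x => fl m (act (a ^+ m)%g x)) = (fun=> 1) + fl m.
  apply/funext => x; rewrite /fl act_aX fctE.
  by rewrite floor_div_shift // intrD addrC.
pose F' : R -> k^o := fun x => fl m (act (a ^+ m * u)%g x).
(* tau acts trivially on the function, so with d inverse to o the boundary d F'[tau^o] = d F'[1] is
   homologous to o d F'[tau] = F'[tau]. *)
have Bt : @bounds k H R act act1 actM (F' @[tau]).
  have [d ed] := ko.
  have := bounds_pow act1 actM (fun x => d * F' x) tau o; rewrite tau_o.
  move=> /(boundsB (bounds_1 act1 actM (fun x => d * F' x))); rewrite opprB addrCA subrr addr0.
  suff -> : (fun x => \sum_(j < o) (d * F' (act (tau ^+ j)%g x) : k^o)) = F' by [].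
  apply/funext => x; under eq_bigr => j _ do rewrite act_tauX.
  by rewrite sumr_const card_ord -mulrnAl -mulr_natl ed mul1r.
have Pm : @bounds k H R act act1 actM ((fl m) @[a ^+ m] - F1 @[a]).
  have := bounds_pow act1 actM (fl m) a m.
  suff -> : (fun x => \sum_(j < m) fl m (act (a ^+ j)%g x)) = F1 by [].
  by apply/funext => x; rewrite -(flE m) //; apply: eq_bigr => j _; rewrite act_aX.
have Pn : @bounds k H R act act1 actM ((fl n) @[a ^+ n] - F1 @[a]).
  have := bounds_pow act1 actM (fl n) a n.
  suff -> : (fun x => \sum_(j < n) fl n (act (a ^+ j)%g x)) = F1 by [].
  by apply/funext => x; rewrite -(flE n) //; apply: eq_bigr => j _; rewrite act_aX.
have B1 := bounds_mul act1 actM (fl m) u (a ^+ n)%g.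
have B2 := bounds_mul act1 actM (fl m) (a ^+ m)%g u.
have B3 := bounds_mul act1 actM (fl m) (a ^+ m * u)%g tau.
move: B1 B2 B3; rewrite Fu Fa rel monalgUD => B1 B2 B3.
(* Everything cancels except the constant chain on u, which splits off because F(a^m x) = F x +
   1. *)
have E (V : zmodType) (c1 fu xm am t y fn f1 : V) :
  c1 + fu - xm + am + (t - y + xm) - (fn - y + fu) - (am - f1) + (fn - f1) - t = c1.
  rewrite !opprD !opprK !addrA.
  rewrite [LHS](ACl (1*(2*10)*(3*7)*(4*11)*(5*15)*(6*9)*(8*13)*(12*14))) /=.
  by rewrite !subrr !addNr !addr0.
move: (boundsB (boundsD (boundsB (boundsB (boundsD B2 B3) B1) Pm) Pn) Bt).
by rewrite E.
Qed.
End Affine.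

Local Open Scope group_scope.

(** * Groups of rank one *)

Section TorsionConj.
Variable G : groupType.
Lemma torsion_conj (g x : G) : torsion x -> torsion (g * x * g^-1).
Proof.
move=> [n n0 xn]; exists n => //.
by have := zexpg_conj g x n; rewrite !zexpg_nat xn mulg1 mulgV.
Qed.
Lemma torsion_conjV (g x : G) : torsion (g * x * g^-1) -> torsion x.
Proof. by move/(torsion_conj g^-1); rewrite invgK !mulgA mulVg mul1g mulgVK. Qed.
Lemma torsionX (x : G) n : (0 < n)%N -> torsion (x ^+ n) -> torsion x.
Proof. by move=> n0 [m m0 xm]; exists (n * m)%N; rewrite ?muln_gt0 ?n0 // expgnA. Qed.
End TorsionConj.

(** * The obstruction to rank two *)

Section RankTwo.
Variables (k : comNzRingType) (G : groupType) (A : G -> Prop) (t a : G).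
Hypotheses (gk : hd_le1_alt k G) (sA : subgroup A) (lA : locally_rank_le1 A)
  (At : forall x, A x -> A (t * x * t^-1)) (AtV : forall x, A x -> A (t^-1 * x * t))
  (tA : forall n, (0 < n)%N -> ~ A (t ^+ n)) (Aa : A a) (na : ~ torsion a).

(** Only the listed elements are non-torsion; the group that they generate may contain torsion. *)
Definition torsion_free_list (X : seq G) :=
  a \in X /\ forall x, x \in X -> A x /\ ~ torsion x.

Definition ruler X (c : G -> int) :=
  [/\ torsion_free_list X, hom_on (gen X) c &
      locally_finite (fun x => gen X x /\ c x = 0%R)].

(** A generator x with eps x = -1 would have its square in the locally finite kernel and so be
    torsion. Hence eps is 1 on all of [gen X], and the twisted transfer is a homomorphism. *)
Lemma ruler_ex X : torsion_free_list X -> exists c, ruler X c.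
Proof.
move=> tX; have [aX XA] := tX; have sX := gen_subgroup X.
have [|K [f [sK fM lK cK]]] := lA (X := X); first by move=> x /XA[].
have [c [eps [eps_pm epsM cM lE]]] := transfer sK fM lK cK.
have e1 x : x \in X -> eps x = 1%R.
  move=> Xx; have gx := mem_gen Xx; have [//|ex] := eps_pm x gx.
  have [_ []] := XA x Xx; apply: (@torsionX _ x 2) => //.
  apply: locally_finite_torsion lE _; split; first exact: subgroupX.
    by rewrite expgS expg1 epsM // ex.
  by rewrite expgS expg1 cM // ex; lia.
have eX x : gen X x -> gen X x /\ eps x = 1%R.
  have sE : subgroup (fun x => gen X x /\ eps x = 1%R).
    have g1 := subgroup1 sX.
    have e11 : eps 1 = 1%R by have := epsM _ _ g1 g1; rewrite mulg1; case: (eps_pm 1 g1) => ->.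
    split=> [//|y z [gy ey] [gz ez]|y [gy ey]].
      by split; [apply: subgroupM|rewrite epsM // ey ez].
    have gV := subgroupV sX gy; split=> //.
    by have := epsM _ _ gV gy; rewrite mulVg e11 ey mulr1.
  by apply: gen_sub sE _ x => y Xy; split; [apply: mem_gen|apply: e1].
exists c; split=> // [x y gx gy|].
  by have [_ ex] := eX x gx; rewrite cM // ex mul1r.
apply: locally_finiteS lE => [|x [gx cx]]; last by split=> //; case: (eX x gx).
apply: subgroup_ker => // x y gx gy.
by have [_ ex] := eX x gx; rewrite cM // ex mul1r.
Qed.

Lemma ruler_torsion X c x : ruler X c -> gen X x -> c x = 0%R -> torsion x.
Proof. by move=> [_ _ lc] gx cx; apply: locally_finite_torsion lc _. Qed.

Lemma ruler_a X c : ruler X c -> gen X a /\ c a <> 0%R.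
Proof.
move=> rc; have [[aX _] _ _] := rc; have ga := mem_gen aX; split=> // ca.
exact: na (ruler_torsion rc ga ca).
Qed.

(** The element y = x^(c a) a^(- c x) is killed by c, hence torsion, hence killed by d:
    homomorphisms that vanish on torsion are proportional to c. *)
Lemma ruler_prop X c (d : G -> int) x : ruler X c -> hom_on (gen X) d ->
  (forall y, gen X y -> torsion y -> d y = 0%R) -> gen X x ->
  (c x * d a = c a * d x)%R.
Proof.
move=> rc dM d0 gx; have [ga ca] := ruler_a rc; have [_ cM _] := rc.
have sX := gen_subgroup X.
pose y := zexpg x (c a) * zexpg a (- c x)%R.
have gxz : gen X (zexpg x (c a)) by apply: zexpg_subgroup.
have gaz : gen X (zexpg a (- c x)%R) by apply: zexpg_subgroup.
have gy : gen X y by apply: subgroupM.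
have cy : c y = 0%R by rewrite cM // !(hom_onZ sX cM) //; lia.
have := d0 y gy (ruler_torsion rc gy cy); rewrite dM // !(hom_onZ sX dM) //; lia.
Qed.

(** r is the length of x in units of the length of a; this normalization removes the dependence on
    the ruler. *)
Definition measured x r := exists X c,
  [/\ ruler X c, gen X x & (r = (c x)%:~R / (c a)%:~R :> rat)%R].

(** Both lengths are compared with those given by a ruler for the concatenated list, to which each
    of the two rulers is proportional. *)
Lemma measured_uniq x r r' : measured x r -> measured x r' -> r = r'.
Proof.
move=> [X [c [rc gx ->]]] [X' [c' [rc' gx' ->]]].
have [[aX XA] cM _] := rc; have [[aX' XA'] cM' _] := rc'.
have sX := gen_subgroup X; have sX' := gen_subgroup X'.
have [|d rd] := @ruler_ex (X ++ X').
  split; first by rewrite mem_cat aX.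
  by move=> y; rewrite mem_cat => /orP[/XA|/XA'].
have [_ dM _] := rd.
have sub : forall y, gen X y -> gen (X ++ X') y.
  by apply: gen_mono => y Xy; rewrite mem_cat Xy.
have sub' : forall y, gen X' y -> gen (X ++ X') y.
  by apply: gen_mono => y Xy; rewrite mem_cat Xy orbT.
have [ga ca] := ruler_a rc; have [ga' ca'] := ruler_a rc'.
have [gda da] := ruler_a rd.
have e : (c x * d a = c a * d x)%R.
  apply: (ruler_prop rc) => // [y z /sub gy /sub gz|y /sub gy ty]; first exact: dM.
  exact: hom_on_torsion (gen_subgroup _) dM _ gy ty.
have e' : (c' x * d a = c' a * d x)%R.
  apply: (ruler_prop rc') => // [y z /sub' gy /sub' gz|y /sub' gy ty]; first exact: dM.
  exact: hom_on_torsion (gen_subgroup _) dM _ gy ty.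
have nz (z : int) : z <> 0%R -> (z%:~R != 0 :> rat)%R by move=> z0; rewrite intr_eq0; apply/eqP.
apply: (mulIf (nz _ da)); rewrite mulrAC -intrM e intrM mulrAC divff ?nz // mul1r.
by rewrite mulrAC -intrM e' intrM mulrAC divff ?nz // mul1r.
Qed.

Definition tconj (i : int) := zexpg t i * a * (zexpg t i)^-1.
Definition tlist (Y : seq int) := a :: [seq tconj i | i <- Y].

Lemma A_tconj z x : A x -> A (zexpg t z * x * (zexpg t z)^-1).
Proof.
move=> Ax; elim/int_ind: z => [|n IH|n IH].
- by rewrite zexpg0 mul1g invg1 mulg1.
- by rewrite PoszS addrC zexpgD zexpg1 invgM !mulgA; have := At IH; rewrite !mulgA.
rewrite (_ : (- n.+1%:Z)%R = (- 1 + - n%:Z)%R); last by lia.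
by rewrite zexpgD (zexpgN t 1) zexpg1 invgM invgK !mulgA; have := AtV IH; rewrite !mulgA.
Qed.

Lemma tlist_free Y : torsion_free_list (tlist Y).
Proof.
split=> [|x]; first exact: mem_head.
rewrite inE => /orP[/eqP->//|/mapP[i _ ->]]; split; first exact: A_tconj.
by move/torsion_conjV.
Qed.

(** The subgroup generated by the conjugates of a under powers of t. Its generators are non-torsion,
    so each element is covered by a ruler, which need not hold for all of A. *)
Definition tclosure x := exists Y, gen (tlist Y) x.

Lemma tlist_catl Y Y' : {subset tlist Y <= tlist (Y ++ Y')}.
Proof. by move=> x; rewrite !inE map_cat mem_cat => /orP[->|->]; rewrite ?orbT. Qed.
Lemma tlist_catr Y Y' : {subset tlist Y' <= tlist (Y ++ Y')}.
Proof. by move=> x; rewrite !inE map_cat mem_cat => /orP[->|->]; rewrite ?orbT. Qed.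

Lemma tclosure_subgroup : subgroup tclosure.
Proof.
split=> [|x y [Y gx] [Y' gy]|x [Y gx]].
- by exists [::]; apply: subgroup1 (gen_subgroup _).
- exists (Y ++ Y'); apply: (subgroupM (gen_subgroup _)).
    exact: gen_mono (@tlist_catl Y Y') _ gx.
  exact: gen_mono (@tlist_catr Y Y') _ gy.
- by exists Y; apply: subgroupV (gen_subgroup _) gx.
Qed.
Lemma tclosure_A x : tclosure x -> A x.
Proof.
move=> [Y]; apply: gen_sub => // y; have [_ tY] := tlist_free Y.
by move/tY => [].
Qed.
Lemma tclosure_a : tclosure a. Proof. by exists [::]; apply: mem_gen; rewrite inE. Qed.

Lemma tclosure_tconj z x : tclosure x -> tclosure (zexpg t z * x * (zexpg t z)^-1).
Proof.
move=> [Y]; apply: (@gen_sub _ _ (fun x => tclosure (zexpg t z * x * (zexpg t z)^-1))).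
  exact: subgroup_conj tclosure_subgroup.
move=> y; rewrite inE => /orP[/eqP->|/mapP[i _ ->]].
  by exists [:: z]; apply: mem_gen; rewrite !inE eqxx orbT.
exists [:: (z + i)%R]; apply: mem_gen; rewrite !inE; apply/orP; right.
by rewrite /tconj zexpgD invgM !mulgA.
Qed.

Lemma measured_ex x : tclosure x -> exists r, measured x r.
Proof.
move=> [Y gx]; have [c rc] := ruler_ex (tlist_free Y).
by exists ((c x)%:~R / (c a)%:~R)%R; exists (tlist Y), c.
Qed.

Definition psi x : rat := if pselect (exists r, measured x r) is left e
  then projT1 (cid e) else 0%R.
Lemma psiP x : tclosure x -> measured x (psi x).
Proof. by move=> /measured_ex e; rewrite /psi; case: pselect => // e'; case: cid. Qed.
Lemma psiE X c x : ruler X c -> tclosure x -> gen X x -> (psi x = (c x)%:~R / (c a)%:~R)%R.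
Proof.
by move=> rc Nx gx; apply: measured_uniq (psiP Nx) _; exists X, c.
Qed.
Lemma psiM x y : tclosure x -> tclosure y -> (psi (x * y) = psi x + psi y)%R.
Proof.
move=> Nx Ny; have [Y gx] := Nx; have [Y' gy] := Ny.
have [c rc] := ruler_ex (tlist_free (Y ++ Y')); have [_ cM _] := rc.
have gx' := gen_mono (@tlist_catl Y Y') gx; have gy' := gen_mono (@tlist_catr Y Y') gy.
rewrite (psiE rc Nx gx') (psiE rc Ny gy') (psiE rc (subgroupM tclosure_subgroup Nx Ny)).
  by rewrite cM // intrD mulrDl.
exact: subgroupM (gen_subgroup _) gx' gy'.
Qed.
Lemma psi1 : psi 1 = 0%R.
Proof.
have N1 := subgroup1 tclosure_subgroup; have := psiM N1 N1; rewrite mulg1; lra.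
Qed.
Lemma psiV x : tclosure x -> psi x^-1 = (- psi x)%R.
Proof.
move=> Nx; have := psiM Nx (subgroupV tclosure_subgroup Nx); rewrite mulgV psi1; lra.
Qed.
Lemma psiX x n : tclosure x -> psi (x ^+ n) = (n%:R * psi x)%R.
Proof.
move=> Nx; elim: n => [|n IH]; first by rewrite expg0 psi1 mul0r.
rewrite expgSr psiM //; last exact: subgroupX tclosure_subgroup Nx.
by rewrite IH -natr1 mulrDl mul1r.
Qed.
Lemma psia : psi a = 1%R.
Proof.
have [c rc] := ruler_ex (tlist_free [::]); have [ga ca] := ruler_a rc.
by rewrite (psiE rc tclosure_a ga) divff // intr_eq0; apply/eqP.
Qed.
Lemma psi0_torsion x : tclosure x -> psi x = 0%R -> torsion x.
Proof.
move=> Nx; have [Y gx] := Nx; have [c rc] := ruler_ex (tlist_free Y).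
have [ga ca] := ruler_a rc; rewrite (psiE rc Nx gx) => /eqP.
rewrite mulf_eq0 invr_eq0 !intr_eq0 => /orP[/eqP|/eqP//].
exact: ruler_torsion rc gx.
Qed.

Notation ratio := (psi (t * a * t^-1)).

Lemma tclosure_conj x : tclosure x -> tclosure (t * x * t^-1).
Proof. by move/(tclosure_tconj 1); rewrite zexpg1. Qed.

(** On [gen (tlist Y)] the function z -> c(t z t^-1) is another homomorphism that kills torsion,
    hence proportional to c; evaluation at a gives the factor. *)
Lemma psi_conj x : tclosure x -> psi (t * x * t^-1) = (ratio * psi x)%R.
Proof.
move=> Nx; have [Y gx] := Nx.
pose X := tlist Y ++ [seq t * y * t^-1 | y <- tlist Y].
have [aY fY] := tlist_free Y.
have [|c rc] := @ruler_ex X.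
  split; first by rewrite mem_cat aY.
  move=> y; rewrite mem_cat => /orP[/fY//|/mapP[z /fY[Az tz] ->]].
  by split; [apply: At|move/torsion_conjV].
have [_ cM _] := rc; have [ga ca] := ruler_a rc; have sX := gen_subgroup X.
have gX z : gen (tlist Y) z -> gen X z by apply: gen_mono => y Yy; rewrite mem_cat Yy.
have gtX z : gen (tlist Y) z -> gen X (t * z * t^-1).
  apply: (@gen_sub _ _ (fun z => gen X (t * z * t^-1))); first exact: subgroup_conj.
  by move=> y Yy; apply: mem_gen; rewrite mem_cat; apply/orP; right; apply/mapP; exists y.
have ga0 : gen (tlist Y) a by apply: mem_gen.
have rc' : ruler (tlist Y) c.
  have cMY : hom_on (gen (tlist Y)) c by move=> y z /gX gy /gX gz; apply: cM.
  split; [exact: tlist_free|exact: cMY|].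
  have [_ _ lc] := rc; apply: locally_finiteS lc => [|y [/gX]//].
  exact: subgroup_ker (gen_subgroup _) cMY.
have e : (c x * c (t * a * t^-1)%g = c a * c (t * x * t^-1)%g)%R.
  apply: (ruler_prop (d := fun z => c (t * z * t^-1)) rc') => // [y z gy gz|y gy ty].
    by rewrite -cM; [rewrite !mulgA mulgVK|apply: gtX|apply: gtX].
  by apply: (hom_on_torsion sX cM); [apply: gtX|apply: torsion_conj].
rewrite (psiE rc (tclosure_conj Nx) (gtX _ gx)) (psiE rc (tclosure_conj tclosure_a) (gtX _ ga0)).
rewrite (psiE rc Nx (gX _ gx)).
have ca' : ((c a)%:~R != 0 :> rat)%R by rewrite intr_eq0; apply/eqP.
have /(congr1 (intr : int -> rat)) := e; rewrite !intrM => e'.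
apply: (mulIf ca'); apply: (mulIf ca'); rewrite mulfVK // mulrC -e'.
by field.
Qed.

Lemma ratio_neq0 : (ratio != 0)%R.
Proof.
apply/eqP => /(psi0_torsion (tclosure_conj tclosure_a))/torsion_conjV; exact: na.
Qed.

Variable u : G.
Hypothesis uE : u = t ^+ 2.
Notation s := (ratio ^+ 2)%R.

Lemma u_zexpg z : zexpg u z = zexpg t (2 * z)%R.
Proof. by rewrite uE zexpgM. Qed.

Lemma tclosure_uconj z x : tclosure x -> tclosure (zexpg u z * x * (zexpg u z)^-1).
Proof. by rewrite u_zexpg; apply: tclosure_tconj. Qed.

Lemma s_neq0 : (s != 0)%R. Proof. by rewrite expf_neq0 // ratio_neq0. Qed.

Lemma psi_u x : tclosure x -> psi (u * x * u^-1) = (s * psi x)%R.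
Proof.
move=> Nx; have -> : u * x * u^-1 = t * (t * x * t^-1) * t^-1.
  by rewrite uE expgS expg1 invgM !mulgA.
by rewrite (psi_conj (tclosure_conj Nx)) (psi_conj Nx) expr2 mulrA.
Qed.

Lemma psi_uz z x : tclosure x -> (psi (zexpg u z * x * (zexpg u z)^-1) = s ^ z * psi x)%R.
Proof.
move=> Nx; elim/int_ind: z => [|n IH|n IH].
- by rewrite zexpg0 mul1g invg1 mulg1 expr0z mul1r.
- rewrite PoszS addrC zexpgD zexpg1 invgM.
  have -> : u * zexpg u n * x * ((zexpg u n)^-1 * u^-1) =
    u * (zexpg u n * x * (zexpg u n)^-1) * u^-1 by rewrite !mulgA.
  by rewrite psi_u ?IH ?exprzDr ?expr1z ?mulrA ?unitfE ?s_neq0 //; apply: tclosure_uconj.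
apply: (mulfI s_neq0); rewrite -psi_u; last exact: tclosure_uconj.
have -> : u * (zexpg u (- n.+1%:Z)%R * x * (zexpg u (- n.+1%:Z)%R)^-1) * u^-1 =
    zexpg u (- n%:Z)%R * x * (zexpg u (- n%:Z)%R)^-1.
  rewrite (_ : (- n%:Z)%R = (1 + - n.+1%:Z)%R); last by lia.
  by rewrite zexpgD zexpg1 (invgM u (zexpg u _)) !mulgA.
rewrite IH mulrA -{2}[s]expr1z -exprzDr ?unitfE ?s_neq0 //.
by congr (_ ^ _ * _)%R; lia.
Qed.

Definition ucyclic x := exists z, tclosure (x * (zexpg u z)^-1).

Lemma A_zexpg_u z : A (zexpg u z) -> z = 0%R.
Proof.
rewrite u_zexpg; case: z => [[|n]|n] //.
  by move=> Az; case: (tA (n := 2 * n.+1)).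
move=> Az; case: (tA (n := 2 * n.+1)) => //; apply: subgroupVr => //.
Qed.

Lemma ucyclic_uniq x z z' : tclosure (x * (zexpg u z)^-1) -> tclosure (x * (zexpg u z')^-1) -> z = z'.
Proof.
move=> Nz Nz'; have := tclosure_A (subgroupM tclosure_subgroup (subgroupV tclosure_subgroup Nz) Nz').
rewrite invgM invgK mulgA mulgVK -zexpgN -zexpgD => /A_zexpg_u; lia.
Qed.

Lemma ucyclic_mul x y z z' : x * y * (zexpg u (z + z')%R)^-1 = x * (zexpg u z)^-1 *
    (zexpg u z * (y * (zexpg u z')^-1) * (zexpg u z)^-1).
Proof. by rewrite zexpgD invgM !mulgA mulgVK. Qed.

Lemma ucyclic_subgroup : subgroup ucyclic.
Proof.
split=> [|x y [z Nz] [z' Nz']|x [z Nz]].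
- by exists 0%R; rewrite zexpg0 mul1g invg1; apply: subgroup1 tclosure_subgroup.
- by exists (z + z')%R; rewrite ucyclic_mul //; apply: (subgroupM tclosure_subgroup) => //; apply: tclosure_uconj.
exists (- z)%R; have := tclosure_uconj (- z)%R (subgroupV tclosure_subgroup Nz).
by rewrite zexpgN !invgK invgM invgK !mulgA mulVg mul1g.
Qed.

(* u is the square of t so that the ratio s is positive, hence m / n with m and n
   natural numbers as in no_affine_action. *)
Lemma rank_two_absurd : False.
Proof.
have [H [f [f_inj fH]]] := subgroup_type ucyclic_subgroup.
have fM := @gmulfM _ _ f.
have fcyc h : ucyclic (f h) by apply/fH; exists h.
pose chi h := projT1 (cid (fcyc h)).
have chiP h : tclosure (f h * (zexpg u (chi h))^-1) by rewrite /chi; case: cid.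
pose tr h := psi (f h * (zexpg u (chi h))^-1).
have chiE h z : tclosure (f h * (zexpg u z)^-1) -> chi h = z by apply: ucyclic_uniq (chiP h).
have chiM g h : chi (g * h) = (chi g + chi h)%R.
  apply: chiE; rewrite fM ucyclic_mul //; apply: (subgroupM tclosure_subgroup) => //; exact: tclosure_uconj.
have trM g h : tr (g * h) = (tr g + s ^ chi g * tr h)%R.
  by rewrite /tr chiM fM (ucyclic_mul (f g) (f h)) (psiM (chiP g) (tclosure_uconj _ (chiP h)))
    (psi_uz _ (chiP h)).
have N1 := subgroup1 tclosure_subgroup.
have chiN h : tclosure (f h) -> chi h = 0%R.
  by move=> Nh; apply: chiE; rewrite zexpg0 invg1 mulg1.
have trN h : tclosure (f h) -> tr h = psi (f h).
  by move=> Nh; rewrite /tr chiN // zexpg0 invg1 mulg1.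
(* The extension of [tclosure] by u acts on the rationals by affine maps: u multiplies by s, and an
   element of [tclosure] translates by its length. *)
pose act h (x : rat) := (tr h + s ^ chi h * x)%R.
have f1 := mulmor1 fM.
have act1 x : act 1 x = x.
  by rewrite /act trN ?chiN ?f1 // psi1 expr0z mul1r add0r.
have actM g h x : act (g * h) x = act g (act h x).
  by rewrite /act trM chiM exprzDr ?unitfE ?s_neq0 // mulrDr !mulrA addrA.
have actN h x : tclosure (f h) -> act h x = (x + psi (f h))%R.
  by move=> Nh; rewrite /act trN ?chiN // expr0z mul1r addrC.
have [ha fa] : exists h, f h = a.
  by apply/fH; exists 0%R; rewrite zexpg0 invg1 mulg1; apply: tclosure_a.
have [hu fu] : exists h, f h = u.
  by apply/fH; exists 1%R; rewrite zexpg1 mulgV.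
have chi_u : chi hu = 1%R by apply: chiE; rewrite fu zexpg1 mulgV.
have s_gt0 : (0 < s)%R by rewrite exprn_even_gt0 //= ratio_neq0.
pose m := absz (numq s); pose n := absz (denq s).
have mE : (m%:R = (numq s)%:~R :> rat)%R.
  by rewrite /m -{2}(@gez0_abs (numq s)) ?numq_ge0 // ltW.
have nE : (n%:R = (denq s)%:~R :> rat)%R.
  by rewrite /n -{2}(@gez0_abs (denq s)) // denq_ge0.
have sE : (s = m%:R / n%:R)%R by rewrite mE nE divq_num_den.
have n0 : (0 < n)%N by rewrite absz_gt0 denq_neq0.
have m0 : (0 < m)%N by rewrite absz_gt0 numq_eq0 s_neq0.
(* The defect tau in u a^n = a^m u tau. Its length is 0 because s n = m, so it is torsion, and its
   order can be taken invertible in k. *)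
pose hx := (ha ^+ m * hu)^-1 * (hu * ha ^+ n).
have fx : f hx = u^-1 * ((a ^+ m)^-1 * (u * a ^+ n * u^-1)) * u.
  by rewrite /hx !fM (mulmorV fM) !fM !(mulmorX fM) fa fu (invgM (a ^+ m) u) !mulgA mulgVK.
have Nam := subgroupX m tclosure_subgroup tclosure_a; have Nan := subgroupX n tclosure_subgroup tclosure_a.
have Nuan : tclosure (u * a ^+ n * u^-1) by have := tclosure_uconj 1%R Nan; rewrite zexpg1.
have Ny : tclosure ((a ^+ m)^-1 * (u * a ^+ n * u^-1)).
  by apply: (subgroupM tclosure_subgroup) => //; apply: (subgroupV tclosure_subgroup).
have Nx : tclosure (f hx).
  by rewrite fx; have := tclosure_uconj (-1)%R Ny; rewrite zexpgN zexpg1 invgK.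
have psix : psi (f hx) = 0%R.
  have e : u * f hx * u^-1 = (a ^+ m)^-1 * (u * a ^+ n * u^-1).
    by rewrite fx !mulgA mulgV mul1g mulgK.
  apply: (mulfI s_neq0); rewrite mulr0 -(psi_u Nx) e (psiM (subgroupV tclosure_subgroup Nam) Nuan).
  rewrite (psiV Nam) (psi_u Nan) (psiX m tclosure_a) (psiX n tclosure_a) psia !mulr1 sE mulfVK ?addNr //.
  by rewrite pnatr_eq0 -lt0n.
have [o [o0 xo ko]] := inverts_torsion gk (psi0_torsion Nx psix).
apply: (@no_affine_action rat k H act chi act1 actM chiM ha hu hx n m o m0 n0 ko).
- by move=> x; rewrite actN ?fa ?psia //; apply: tclosure_a.
- by move=> x; rewrite actN // psix addr0.
- by move=> x; rewrite /act chi_u expr1z /tr chi_u fu zexpg1 mulgV psi1 add0r -sE.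
- by rewrite /hx mulVKg.
- by apply: f_inj; rewrite (mulmorX fM) xo f1.
- by [].
- exact: hd_le1_alt_sub f_inj gk.
Qed.
End RankTwo.

Theorem hd_le1_locally_rank_le1 (k : comNzRingType) (G : groupType) :
  elementary_amenable G -> hd_le1_alt k G -> locally_rank_le1 (fun _ : G => True).
Proof.
move=> eG gk; apply: elementary_locally_rank_le1 (elementary_amenable_elementary eG).
move=> A t a sA lA At AtV tA Aa; apply: contrapT => na.
exact: (@rank_two_absurd k G A t a gk sA lA At AtV tA Aa na (t ^+ 2) erefl).
Qed.

Local Open Scope group_scope.

(** * Presentations *)

Section Words.
Variable T : choiceType.
Definition word := seq (bool * T).
Implicit Types (u v w : word).

Section Eval.
Variables (K : groupType) (e : T -> K).
Definition lit (l : bool * T) : K := if l.1 then e l.2 else (e l.2)^-1.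
Fixpoint ev w : K := if w is l :: w' then lit l * ev w' else 1.
Lemma ev_cat u v : ev (u ++ v) = ev u * ev v.
Proof. by elim: u => [|l u IH] /=; rewrite ?mul1g // IH mulgA. Qed.
Lemma ev_letter x : ev [:: (true, x)] = e x.
Proof. by rewrite /= mulg1. Qed.
End Eval.

Definition winv w : word := rev [seq (~~ l.1, l.2) | l <- w].
Lemma ev_winv (K : groupType) (e : T -> K) w : ev e (winv w) = (ev e w)^-1.
Proof.
elim: w => [|[b x] w IH] /=; first by rewrite invg1.
rewrite /winv map_cons rev_cons -cats1 ev_cat -/(winv w) IH /= mulg1 invgM; congr (_ * _).
by rewrite /lit /=; case: b; rewrite /= ?invgK.
Qed.

Lemma ev_eq (K : groupType) (e e' : T -> K) w :
  (forall l, l \in w -> e l.2 = e' l.2) -> ev e w = ev e' w.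
Proof.
elim: w => [//|l w IH] le /=; rewrite IH => [|l' wl']; last by apply: le; rewrite inE wl' orbT.
by rewrite /lit le ?mem_head.
Qed.

Lemma ev_morph (K K' : groupType) (e : T -> K) (f : K -> K') w :
  {morph f : x y / x * y} -> f (ev e w) = ev (f \o e) w.
Proof.
move=> fM; elim: w => [|[b x] w IH] /=; first exact: mulmor1.
by rewrite fM IH /lit; case: b; rewrite //= mulmorV.
Qed.

Record congruence (E : word -> word -> Prop) : Prop := Congruence {
  cong_refl : forall w, E w w;
  cong_sym : forall u v, E u v -> E v u;
  cong_trans : forall u v w, E u v -> E v w -> E u w;
  cong_cat : forall u u' v v', E u u' -> E v v' -> E (u ++ v) (u' ++ v');
  cong_invl : forall w, E (winv w ++ w) [::];
  cong_invr : forall w, E (w ++ winv w) [::] }.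

Section Quotient.
Variables (E : word -> word -> Prop) (cE : congruence E).
Let Eb u v : bool := `[< E u v >].
Let Eb_refl u : Eb u u. Proof. exact/asboolP/(cong_refl cE). Qed.
Definition wcan u : word := xchoose (ex_intro _ u (Eb_refl u)).
Lemma wcanP u : E u (wcan u).
Proof. exact/asboolP/(xchooseP (ex_intro _ u (Eb_refl u))). Qed.
Lemma wcan_eq u v : E u v -> wcan u = wcan v.
Proof.
move=> uv; apply: eq_xchoose => w; apply/asboolP/asboolP => [uw|vw].
  exact: (cong_trans cE (cong_sym cE uv) uw).
exact: (cong_trans cE uv vw).
Qed.
Lemma wcanK u : wcan (wcan u) = wcan u.
Proof. by apply: wcan_eq; apply: (cong_sym cE (wcanP u)). Qed.
End Quotient.

Record qgrp (E : word -> word -> Prop) (cE : congruence E) :=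
  Qgrp { qword : word; _ : wcan cE qword == qword }.
HB.instance Definition _ E (cE : congruence E) := [isSub for @qword E cE].
HB.instance Definition _ E (cE : congruence E) := [Choice of qgrp cE by <:].

Section QuotientGroup.
Variables (E : word -> word -> Prop) (cE : congruence E).
Notation Q := (qgrp cE).
Definition qpi (w : word) : Q := Qgrp (introT eqP (wcanK cE w)).
Lemma qpiP u v : qpi u = qpi v <-> E u v.
Proof.
split=> [/(congr1 (@qword E cE)) /= uv|/(wcan_eq cE) uv]; last exact: val_inj.
by apply: (cong_trans cE (wcanP cE u)); rewrite uv; apply: (cong_sym cE (wcanP cE v)).
Qed.
Lemma qwordK (x : Q) : qpi (qword x) = x.
Proof. by apply: val_inj; case: x => w /= /eqP. Qed.
Lemma qpi_word w : E (qword (qpi w)) w.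
Proof. by apply/qpiP; rewrite qwordK. Qed.
Definition qmul (x y : Q) : Q := qpi (qword x ++ qword y).
Definition qinv (x : Q) : Q := qpi (winv (qword x)).
Definition qone : Q := qpi [::].
Lemma qmulE u v : qmul (qpi u) (qpi v) = qpi (u ++ v).
Proof. by apply/qpiP/(cong_cat cE); apply: qpi_word. Qed.
Lemma qmulA : associative qmul.
Proof.
move=> x y z; rewrite -(qwordK x) -(qwordK y) -(qwordK z) !qmulE.
by rewrite catA.
Qed.
Lemma qmul1 : left_id qone qmul.
Proof. by move=> x; rewrite -(qwordK x) qmulE. Qed.
Lemma qmulr1 : right_id qone qmul.
Proof. by move=> x; rewrite -(qwordK x) qmulE cats0. Qed.
Lemma qmulV : left_inverse qone qinv qmul.
Proof. by move=> x; rewrite -{2}(qwordK x) qmulE; apply/qpiP/(cong_invl cE). Qed.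
Lemma qmulrV : right_inverse qone qinv qmul.
Proof. by move=> x; rewrite -{1}(qwordK x) qmulE; apply/qpiP/(cong_invr cE). Qed.
HB.instance Definition _ := isGroup.Build Q qmulA qmul1 qmulr1 qmulV qmulrV.

Lemma qpiM u v : qpi (u ++ v) = qpi u * qpi v.
Proof. by rewrite -qmulE. Qed.
Lemma qpi1 : qpi [::] = 1.
Proof. by []. Qed.
Lemma qpiV w : qpi (winv w) = (qpi w)^-1.
Proof. by apply/esym/mulg1_eq; rewrite -qpiM -qpi1; apply/qpiP/(cong_invr cE). Qed.
Definition qletter (x : T) : Q := qpi [:: (true, x)].
Lemma ev_qletter w : ev qletter w = qpi w.
Proof.
elim: w => [//|[b x] w IH] /=; rewrite IH -cat1s qpiM; congr (_ * _).
by rewrite /lit /=; case: b; rewrite /qletter -?qpiV.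
Qed.

Section Lift.
Variables (K : groupType) (e : T -> K).
Definition qlift (eE : forall u v, E u v -> ev e u = ev e v) (x : Q) : K := ev e (qword x).
Hypothesis eE : forall u v, E u v -> ev e u = ev e v.
Lemma qlift_pi w : qlift eE (qpi w) = ev e w.
Proof. by apply: eE; apply: qpi_word. Qed.
Lemma qliftM : {morph qlift eE : x y / x * y}.
Proof. by move=> x y; rewrite -(qwordK x) -(qwordK y) -qpiM !qlift_pi ev_cat. Qed.
HB.instance Definition _ := isMultiplicative.Build Q K (qlift eE) qliftM.
End Lift.
End QuotientGroup.

Definition relations := word * word -> Prop.
Implicit Types R : relations.
Definition sat (K : groupType) (e : T -> K) R := forall r, R r -> ev e r.1 = ev e r.2.
(* Semantic consequence: no derivation calculus is needed. *)
Definition entails R u v := forall (K : groupType) (e : T -> K), sat e R -> ev e u = ev e v.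

Lemma entails_cong R : congruence (entails R).
Proof.
split=> [w|u v uv|u v w uv vw|u u' v v' uu vv|w|w] K e eR //.
- by rewrite uv.
- by rewrite uv // vw.
- by rewrite !ev_cat uu // vv.
- by rewrite ev_cat ev_winv mulVg.
- by rewrite ev_cat ev_winv mulgV.
Qed.

Definition list_rel (s : seq (word * word)) : relations := fun r => r \in s.

Lemma sat_sub (K : groupType) (e : T -> K) R R' : (forall r, R r -> R' r) -> sat e R' -> sat e R.
Proof. by move=> RR eR r /RR/eR. Qed.

Definition fin_entails R u v := exists2 s, (forall r, r \in s -> R r) & entails (list_rel s) u v.

Lemma fin_entails_cong R : congruence (fin_entails R).
Proof.
have both s s' : (forall r, r \in s -> R r) -> (forall r, r \in s' -> R r) ->
    forall r, r \in s ++ s' -> R r.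
  by move=> sR s'R r; rewrite mem_cat => /orP[/sR|/s'R].
have catl s s' (K : groupType) (e : T -> K) : sat e (list_rel (s ++ s')) -> sat e (list_rel s).
  by apply: sat_sub => r; rewrite /list_rel mem_cat => ->.
have catr s s' (K : groupType) (e : T -> K) : sat e (list_rel (s ++ s')) -> sat e (list_rel s').
  by apply: sat_sub => r; rewrite /list_rel mem_cat => ->; rewrite orbT.
have none u v : (forall (K : groupType) (e : T -> K), ev e u = ev e v) -> fin_entails R u v.
  by move=> uv; exists [::].
split=> [w|u v [s sR uv]|u v w [s sR uv] [s' s'R vw]|u u' v v' [s sR uu] [s' s'R vv]|w|w].
- exact: none.
- by exists s => // K e eR; rewrite uv.
- exists (s ++ s'); first exact: both.
  by move=> K e eR; rewrite uv ?vw //; [apply: catr eR|apply: catl eR].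
- exists (s ++ s'); first exact: both.
  by move=> K e eR; rewrite !ev_cat (uu K e) ?(vv K e) //; [apply: catr eR|apply: catl eR].
- by apply: none => K e; rewrite ev_cat ev_winv mulVg.
- by apply: none => K e; rewrite ev_cat ev_winv mulgV.
Qed.

(** The words modulo [fin_entails R] form a group in which the letters satisfy R. Semantic
    consequence, evaluated in this one model, is consequence from a finite part of R. *)
Lemma compactness R u v : entails R u v -> fin_entails R u v.
Proof.
move=> Ruv; apply/(qpiP (fin_entails_cong R)).
rewrite -!ev_qletter; apply: Ruv => r Rr; rewrite !ev_qletter.
apply/(qpiP (fin_entails_cong R)); exists [:: r]; first by move=> r'; rewrite inE => /eqP->.
by move=> K e; apply; rewrite /list_rel inE eqxx.
Qed.

Definition presented R := qgrp (entails_cong R).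
Lemma presented_sat R : sat (qletter (entails_cong R)) R.
Proof. by move=> r Rr; rewrite !ev_qletter; apply/qpiP => K e; apply. Qed.
End Words.

Local Open Scope ring_scope.

(** * Extensions by modules *)

Section Cobar.
Variables (k : comNzRingType) (G : groupType) (M : gmodule k G).
Lemma cobar_d1 (f : cochain M 1) x y : cobar_d f (tup 2 [:: x; y]) =
  gact M x (f (tup 1 [:: y])) - f (tup 1 [:: (x * y)%g]) + f (tup 1 [:: x]).
Proof.
rewrite /cobar_d !big_ord_recl big_ord0 /= !faceE tup_nth0 /= addr0.
by rewrite /bump /= !exprS expr0 !mulN1r !opprK !scaleN1r !scale1r addrA.
Qed.
Lemma cobar_d2 (f : cochain M 2) x y z : cobar_d f (tup 3 [:: x; y; z]) =
  gact M x (f (tup 2 [:: y; z])) - f (tup 2 [:: (x * y)%g; z])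
  + f (tup 2 [:: x; (y * z)%g]) - f (tup 2 [:: x; y]).
Proof.
rewrite /cobar_d !big_ord_recl big_ord0 /= !faceE tup_nth0 /= addr0.
by rewrite /bump /= !exprS expr0 !mulN1r !opprK !scaleN1r !scale1r !addrA.
Qed.
End Cobar.

Definition cocycle2 (k : comNzRingType) (D : groupType) (M : gmodule k D) (F : D -> D -> M) :=
  forall x y z, gact M x (F y z) + F x (y * z)%g = F (x * y)%g z + F x y.

Record ext_group (k : comNzRingType) (D : groupType) (M : gmodule k D) (F : D -> D -> M)
  (cF : cocycle2 F) := Ext { ext_pair : M * D }.

Section Extension.
Variables (k : comNzRingType) (D : groupType) (M : gmodule k D) (F : D -> D -> M).
Hypothesis cF : cocycle2 F.
Notation E := (ext_group cF).
HB.instance Definition _ := [isNew for @ext_pair k D M F cF].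
HB.instance Definition _ := [Choice of E by <:].

Definition ext (m : M) (d : D) : E := Ext cF (m, d).
Definition ext_fst (x : E) : M := (ext_pair x).1.
Definition ext_snd (x : E) : D := (ext_pair x).2.
Lemma ext_eta x : x = ext (ext_fst x) (ext_snd x).
Proof. by case: x => -[]. Qed.

Lemma cocycle1d d : F 1%g d = F 1%g 1%g.
Proof. by have := cF 1%g 1%g d; rewrite gact1 !mul1g => /addrI. Qed.
Lemma cocycled1 d : F d 1%g = gact M d (F 1%g 1%g).
Proof. by have := cF d 1%g 1%g; rewrite !mulg1 => /addIr. Qed.

Definition ext_mul (x y : E) : E :=
  ext (ext_fst x + gact M (ext_snd x) (ext_fst y) + F (ext_snd x) (ext_snd y))
      (ext_snd x * ext_snd y)%g.
(** The cocycle is not assumed normalized, whence the corrections by F 1 1 here, in the inverse and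
    in the inclusion of M. *)
Definition ext_one : E := ext (- F 1%g 1%g) 1%g.
Definition ext_inv (x : E) : E :=
  let d := ext_snd x in
  ext (- (gact M d^-1%g (ext_fst x)) - F d^-1%g d - F 1%g 1%g) d^-1%g.

Lemma ext_mulA : associative ext_mul.
Proof.
move=> [[m x]] [[n y]] [[p z]]; rewrite /ext_mul /ext_fst /ext_snd /= mulgA.
congr (Ext cF (_, _)); rewrite !linearD /= gactM -!addrA; congr (_ + (_ + _)).
by rewrite cF; apply: (etrans (addrA _ _ _) (addrC _ _)).
Qed.
Lemma ext_mul1 : left_id ext_one ext_mul.
Proof.
move=> [[m x]]; rewrite /ext_mul /ext_fst /ext_snd /= mul1g gact1 (cocycle1d x).
by congr (Ext cF (_, _)); rewrite addrAC addNr add0r.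
Qed.
Lemma ext_mulr1 : right_id ext_one ext_mul.
Proof.
move=> [[m x]]; rewrite /ext_mul /ext_fst /ext_snd /= mulg1 linearN /= (cocycled1 x).
by congr (Ext cF (_, _)); rewrite addrNK.
Qed.
Lemma ext_mulV : left_inverse ext_one ext_inv ext_mul.
Proof.
move=> [[m x]]; rewrite /ext_mul /ext_one /ext_inv /ext_fst /ext_snd /= mulVg.
have e (V : zmodType) (u v w : V) : - u - v - w + u + v = - w.
  by rewrite [LHS](ACl (3*(1*4)*(2*5))) /= !addNr !addr0.
by rewrite e.
Qed.
Lemma ext_mulrV : right_inverse ext_one ext_inv ext_mul.
Proof.
move=> [[m x]]; rewrite /ext_mul /ext_one /ext_inv /ext_fst /ext_snd /= mulgV.
rewrite !linearB linearN /= gactVK.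
have e (V : zmodType) (u p q r w : V) : p + q = w + r -> u + (- u - p - q) + r = - w.
  move=> h; rewrite -[w](addrK r) -h !opprD opprK !addrA.
  by rewrite [LHS](ACl (3*4*5*(1*2))) /= subrr addr0.
by rewrite (e _ _ _ _ _ (F 1%g 1%g)) //; have := cF x x^-1%g x;
  rewrite mulgV mulVg (cocycled1 x) (cocycle1d x).
Qed.
HB.instance Definition _ := isGroup.Build E ext_mulA ext_mul1 ext_mulr1 ext_mulV ext_mulrV.

Lemma extM m n x y :
  (ext m x * ext n y)%g = ext (m + gact M x n + F x y) (x * y)%g.
Proof. by []. Qed.
Lemma ext_sndM : {morph ext_snd : x y / (x * y)%g}.
Proof. by []. Qed.
HB.instance Definition _ := isMultiplicative.Build E D ext_snd ext_sndM.

Variables (G : groupType) (j : G -> D).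

Definition ext_incl (m : M) : E := ext (m - F 1%g 1%g) 1%g.

Lemma ext_incl_comm m a b d : m + b = a + gact M d m ->
  (ext_incl m * ext b d)%g = (ext a d * ext_incl m)%g.
Proof.
move=> e; rewrite /ext_incl !extM mul1g mulg1 gact1 (cocycle1d d) (cocycled1 d).
by rewrite linearB /= addrA !addrNK addrAC addrNK e.
Qed.

Lemma gact_natmul g (m : M) c : gact M g (c *: m) = c *: gact M g m.
Proof. exact: linearZ. Qed.

(* The cocycle is averaged, so that this is the vanishing of H^2 for Q. *)
Lemma fin_subgroup_lift (Q : seq G) : fin_subgroup Q -> inverts k (size (undup Q)) ->
  {in Q &, forall x y, j (x * y)%g = (j x * j y)%g} ->
  exists s : G -> M, {in Q &, forall x y, ext (s (x * y)%g) (j (x * y)%g) =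
     (ext (s x) (j x) * ext (s y) (j y))%g}.
Proof.
move=> fQ [c ec] jM; pose U := undup Q.
have UP x : x \in U = (x \in Q) by rewrite mem_undup.
pose S x := \sum_(y <- U) F (j x) (j y).
exists (fun x => - (c *: S x)) => x y Qx Qy; rewrite extM jM //; congr (ext _ _).
(* The cocycle identity for (x, y, z) summed over z in Q; z -> y z permutes Q. *)
have e : gact M (j x) (S y) + S x = S (x * y)%g + F (j x) (j y) *+ size U.
  rewrite /S linear_sum /= -[X in _ + X = _](perm_big _ (fin_subgroup_perm fQ Qy)) big_map.
  have -> : F (j x) (j y) *+ size U = \sum_(z <- U) F (j x) (j y).
    by rewrite big_const_seq count_predT iter_addr_0.
  rewrite -!big_split /=; apply: eq_big_seq => z; rewrite UP => Qz.
  by rewrite !jM // cF.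
have {e} : S (x * y)%g = gact M (j x) (S y) + S x - F (j x) (j y) *+ size U.
  by rewrite e addrK.
move=> ->; rewrite linearN /= gact_natmul scalerBr scalerDr -scaler_nat scalerA.
rewrite mulrC ec scale1r opprB opprD [RHS]addrC.
by congr (_ + _); apply: addrC.
Qed.

(* This is the vanishing of H^1 for C. *)
Lemma fin_subgroup_conj (C : seq G) (s s' : G -> M) : fin_subgroup C -> inverts k (size (undup C)) ->
  {in C &, forall x y, ext (s (x * y)%g) (j (x * y)%g) = (ext (s x) (j x) * ext (s y) (j y))%g} ->
  {in C &, forall x y, ext (s' (x * y)%g) (j (x * y)%g) = (ext (s' x) (j x) * ext (s' y) (j y))%g} ->
  exists m, {in C, forall x, (ext_incl m * ext (s' x) (j x))%g = (ext (s x) (j x) * ext_incl m)%g}.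
Proof.
move=> fC [c ec] sM s'M; pose U := undup C.
have UP x : x \in U = (x \in C) by rewrite mem_undup.
pose d x := s x - s' x.
have dM : {in C &, forall x y, d (x * y)%g = d x + gact M (j x) (d y)}.
  move=> x y Cx Cy; have [e _] := congr1 (fun z => ext_pair z) (sM x y Cx Cy).
  have [e' _] := congr1 (fun z => ext_pair z) (s'M x y Cx Cy).
  rewrite /d e e' /= linearB /= !opprD !addrA.
  by rewrite [LHS](ACl (1*4*2*5*(3*6))) /= subrr addr0.
exists (c *: \sum_(y <- U) d y) => x Cx; apply: ext_incl_comm.
rewrite gact_natmul (linear_sum (gact M (j x))) /=.
have -> : \sum_(y <- U) gact M (j x) (d y) = \sum_(y <- U) d y - d x *+ size U.
  apply/eqP; rewrite eq_sym subr_eq; apply/eqP.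
  rewrite -{1}(perm_big _ (fin_subgroup_perm fC Cx)) big_map.
  have -> : d x *+ size U = \sum_(z <- U) d x.
    by rewrite big_const_seq count_predT iter_addr_0.
  rewrite -big_split /=; apply: eq_big_seq => z; rewrite UP => Cz.
  by rewrite dM // addrC.
rewrite scalerBr -scaler_nat scalerA mulrC ec scale1r /d opprB.
by rewrite [RHS]addrCA [s x + _]addrC addrNK.
Qed.
End Extension.

(* H^2 vanishes when all extensions by modules split, and an extension of a
   presented group splits as soon as the letters have lifts satisfying the
   relations. *)
Definition liftable (k : comNzRingType) (T : choiceType) (R : relations T) :=
  forall (D : groupType) (j : T -> D), sat j R ->
  forall (M : gmodule k D) (F : D -> D -> M) (cF : cocycle2 F),
  exists2 e : T -> ext_group cF, sat e R & forall x, ext_snd (e x) = j x.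

(** The lifts of the letters induce a section of the extension defined by the cocycle f. Comparing
    first coordinates in sg (x y) = sg x sg y shows that minus the first coordinate of the section
    cobounds f. *)
Lemma liftable_cd (k : comNzRingType) (T : choiceType) (R : relations T) :
  liftable k R -> dim_le (cd k (presented R)) 1.
Proof.
move=> lR; apply: cd_le1 => M f df.
pose D := presented R.
pose F (x y : D) : M := f (tup 2 [:: x; y]).
have cF : cocycle2 F.
  move=> x y z; have := df (tup 3 [:: x; y; z]); rewrite cobar_d2 => /eqP.
  rewrite subr_eq add0r addrAC subr_eq => /eqP e.
  by rewrite /F e addrC.
have [e eR ej] := lR D _ (@presented_sat T R) M F cF.
have eE u v : entails R u v -> ev e u = ev e v by move=> uv; apply: uv.
pose sg := qlift eE : D -> ext_group cF.
have sgM : {morph sg : x y / (x * y)%g} by apply: qliftM.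
have sg_snd x : ext_snd (sg x) = x.
  rewrite -(qwordK x) /sg qlift_pi // (ev_morph _ _ (@ext_sndM k D M F cF)).
  by rewrite -ev_qletter; apply: ev_eq => l _; apply: ej.
exists (fun g => - ext_fst (sg (g ord0))) => g.
case: (ffun2_tup g) => x [y ->]; rewrite cobar_d1 !tup_nth0 /= sgM.
rewrite (ext_eta (sg x)) (ext_eta (sg y)) !sg_snd extM /ext_fst /= linearN /=.
by rewrite opprK !addrA [LHS](ACl (4*(1*3)*(2*5))) /= addNr subrr !addr0.
Qed.

Local Open Scope group_scope.

(** * Groups of cohomological dimension one *)

Section Core.
Variables (k : comNzRingType) (G : groupType).
Implicit Types (H L : G -> Prop) (u v w : word G) (s : seq (word G * word G)).

Definition word_in L w := forall l, l \in w -> L l.2.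
Definition rel_in L (R : relations G) := forall r, R r -> word_in L r.1 /\ word_in L r.2.
Notation valid R := (@sat G G id R).

Lemma word_in_cat L u v : word_in L u -> word_in L v -> word_in L (u ++ v).
Proof. by move=> Lu Lv l; rewrite mem_cat => /orP[/Lu|/Lv]. Qed.
Lemma word_in_winv L u : word_in L u -> word_in L (winv u).
Proof. by move=> Lu l; rewrite mem_rev => /mapP[l' /Lu Ll ->]. Qed.

Definition expressible L x := exists2 w, word_in L w & ev id w = x.
Lemma expressible_subgroup L : subgroup (expressible L).
Proof.
split=> [|x y [w Lw <-] [w' Lw' <-]|x [w Lw <-]]; first by exists [::].
- by exists (w ++ w'); rewrite ?ev_cat //; apply: word_in_cat.
- by exists (winv w); rewrite ?ev_winv //; apply: word_in_winv.
Qed.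
Lemma expressible_letter L x : L x -> expressible L x.
Proof. by move=> Lx; exists [:: (true, x)]; rewrite ?ev_letter // => l; rewrite inE => /eqP->. Qed.

(** The letters L generate H, and [Rc] entails every relation among them that is valid in G. The
    other letters of H are defined by words in L, in the manner of Tietze; by compactness the list s
    uses finitely many relations of both kinds. The defining relations do not obstruct lifting,
    since each determines the lift of a letter that occurs in no relation of s'. *)
Lemma approximation_of_presentation H L (Rc : relations G) :
  (forall x, H x -> expressible L x) ->
  (forall (K : groupType) (e : G -> K), sat e Rc ->
     forall u, word_in L u -> ev id u = 1 -> ev e u = 1) ->
  (forall s, (forall r, r \in s -> Rc r) -> exists s',
     [/\ forall r, r \in s -> r \in s', valid (list_rel s'), rel_in L (list_rel s') &
         liftable k (list_rel s')]) ->
  forall s, valid (list_rel s) -> rel_in H (list_rel s) -> exists s',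
    [/\ valid (list_rel s'), forall r, r \in s -> entails (list_rel s') r.1 r.2 &
        liftable k (list_rel s')].
Proof.
move=> HL pres fin s vs sH.
have wex x : exists w, H x -> word_in L w /\ ev id w = x.
  have [Hx|nHx] := pselect (H x); last by exists [::].
  by have [w Lw ew] := HL x Hx; exists w.
pose wx x := projT1 (cid (wex x)).
have wxP x : H x -> word_in L (wx x) /\ ev id (wx x) = x by rewrite /wx; case: cid.
pose Rx : relations G := fun r => exists x, [/\ H x, ~ L x & r = ([:: (true, x)], wx x)].
pose Ri : relations G := fun r => Rc r \/ Rx r.
have ent r : r \in s -> entails Ri r.1 r.2.
  move=> sr K e eRi.
  pose w' x := if pselect (L x) is left _ then [:: (true, x)] else wx x.
  have w'P x : H x -> [/\ word_in L (w' x), ev id (w' x) = x & ev e (w' x) = e x].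
    move=> Hx; rewrite /w'; case: pselect => [Lx|nLx].
      by split; rewrite ?ev_letter // => l; rewrite inE => /eqP->.
    have [Lw ew] := wxP x Hx; split=> //.
    have <- := eRi ([:: (true, x)], wx x); first by rewrite ev_letter.
    by right; exists x.
  have sub u : word_in H u -> exists u', [/\ word_in L u', ev id u' = ev id u & ev e u' = ev e u].
    elim: u => [|[b x] u IH] Hu; first by exists [::].
    have [|u' [Lu' iu' eu']] := IH; first by move=> l ul; apply: Hu; rewrite inE ul orbT.
    have [Lw iw ew] := w'P x (Hu _ (mem_head _ _)).
    exists ((if b then w' x else winv (w' x)) ++ u').
    split; rewrite ?ev_cat.
    - by apply: word_in_cat => //; case: b {Hu} => //; apply: word_in_winv.
    - by rewrite iu' /= /lit /=; case: b {Hu}; rewrite ?ev_winv ?iw.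
    - by rewrite eu' /= /lit /=; case: b {Hu}; rewrite ?ev_winv ?ew.
  have [H1 H2] := sH r sr.
  have [u [Lu iu eu]] := sub _ H1; have [v [Lv iv ev']] := sub _ H2.
  have : ev e (u ++ winv v) = 1.
    apply: pres => [r' Rr'||]; first by apply: eRi; left.
      by apply: word_in_cat => //; apply: word_in_winv.
    by rewrite ev_cat ev_winv iu iv (vs r sr) mulgV.
  by rewrite ev_cat ev_winv eu ev' => /divg1_eq.
have [S SRi Ss] : exists2 S, (forall r, r \in S -> Ri r) &
    forall r, r \in s -> entails (list_rel S) r.1 r.2.
  elim: s ent {vs sH} => [|r s IH] ent; first by exists [::].
  have [|S SRi Ss] := IH; first by move=> r' sr'; apply: ent; rewrite inE sr' orbT.
  have [S' S'Ri S'r] := compactness (ent r (mem_head _ _)).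
  exists (S' ++ S) => [r'|r']; first by rewrite mem_cat => /orP[/S'Ri|/SRi].
  rewrite inE => /orP[/eqP->|sr'] K e eS.
    by apply: S'r; apply: sat_sub eS => r''; rewrite /list_rel mem_cat => ->.
  by apply: Ss => //; apply: sat_sub eS => r''; rewrite /list_rel mem_cat orbC => ->.
pose Sc := [seq r <- S | `[< Rc r >]]; pose Sx := [seq r <- S | `[< Rx r >]].
have [|s' [Scs vs' Ls' lift]] := fin Sc.
  by move=> r; rewrite mem_filter => /andP[/asboolP].
have SxP r : r \in Sx -> Rx r by rewrite mem_filter => /andP[/asboolP].
exists (s' ++ Sx); split.
- move=> r; rewrite /list_rel mem_cat => /orP[/vs'//|/SxP[x [Hx _ ->]]].
  by rewrite ev_letter; have [_ ->] := wxP x Hx.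
- move=> r sr K e eS; apply: Ss => // r' Sr'; apply: eS; rewrite /list_rel mem_cat.
  have [Rr'|Rr'] := SRi r' Sr'.
    by rewrite Scs // mem_filter Sr' andbT; apply/asboolP.
  by apply/orP; right; rewrite mem_filter Sr' andbT; apply/asboolP.
move=> D j jS M F cF.
have [|e0 e0s' e0j] := lift D j _ M F cF.
  by apply: sat_sub jS => r; rewrite /list_rel mem_cat => ->.
(* A letter with a defining relation must lift to the value of its defining word; all the others
   keep their lift. *)
pose e x := if pselect (~ L x /\ ([:: (true, x)], wx x) \in Sx) is left _
  then ev e0 (wx x) else e0 x.
have eL x : L x -> e x = e0 x by move=> Lx; rewrite /e; case: pselect => // -[].
have eLw w : word_in L w -> ev e w = ev e0 w by move=> Lw; apply: ev_eq => l /Lw/eL.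
exists e => [r|x].
  rewrite /list_rel mem_cat => /orP[s'r|Sxr].
    by have [L1 L2] := Ls' r s'r; rewrite !eLw //; apply: e0s'.
  have [x [Hx nLx er]] := SxP r Sxr; rewrite er ev_letter eLw; last by case: (wxP x Hx).
  by rewrite /e; case: pselect => // -[]; split=> //; rewrite -er.
rewrite /e; case: pselect => [[nLx Sxx]|_]; last exact: e0j.
rewrite (ev_morph _ _ (@ext_sndM k D M F cF)) (@ev_eq _ _ _ j); last by move=> l _; apply: e0j.
have := jS ([:: (true, x)], wx x); rewrite ev_letter => -> //.
by rewrite /list_rel mem_cat Sxx orbT.
Qed.

Definition mul_rel (x y : G) : word G * word G :=
  ([:: (true, x); (true, y)], [:: (true, x * y)]).
Definition mul_rels (Q : seq G) := [seq mul_rel x y | x <- Q, y <- Q].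
Definition mul_rels_on (U : G -> Prop) : relations G :=
  fun r => exists x y, [/\ U x, U y & r = mul_rel x y].

Lemma ev_mul_rel (K : groupType) (e : G -> K) x y :
  (ev e (mul_rel x y).1 = ev e (mul_rel x y).2) <-> (e (x * y) = e x * e y).
Proof. by rewrite /= /lit /= !mulg1; split=> ->. Qed.

Lemma mul_relsP (K : groupType) (e : G -> K) Q : sat e (list_rel (mul_rels Q)) <->
  {in Q &, forall x y, e (x * y) = e x * e y}.
Proof.
split=> [eQ x y Qx Qy|eQ r].
  by apply/ev_mul_rel; apply: eQ; apply: allpairs_f.
by move=> /allpairsP[[x y] /= [Qx Qy ->]]; apply/ev_mul_rel/eQ.
Qed.

Lemma mul_rels_onP (K : groupType) (e : G -> K) U : sat e (mul_rels_on U) ->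
  forall x y, U x -> U y -> e (x * y) = e x * e y.
Proof. by move=> eU x y Ux Uy; apply/ev_mul_rel; apply: eU; exists x, y. Qed.

Definition letters s : seq G :=
  flatten [seq [seq l.2 | l <- r.1 ++ r.2] | r <- s].
Lemma lettersP s r l : r \in s -> l \in r.1 ++ r.2 -> l.2 \in letters s.
Proof.
move=> sr rl; apply/flattenP; exists [seq l.2 | l <- r.1 ++ r.2]; last exact: map_f.
by apply/mapP; exists r.
Qed.

Lemma locally_finite_letters (U : G -> Prop) s : locally_finite U -> exists Q,
  [/\ fin_subgroup Q, forall x, x \in Q -> U x & forall x, x \in letters s -> U x -> x \in Q].
Proof.
move=> lU; have [|Q [fQ YQ QU]] := lU [seq x <- letters s | `[< U x >]].
  by move=> x; rewrite mem_filter => /andP[/asboolP].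
exists Q; split=> // x sx Ux; apply: YQ; rewrite mem_filter sx andbT; exact/asboolP.
Qed.

Lemma mul_rels_on_letters (U : G -> Prop) s Q r : (forall x, x \in letters s -> U x -> x \in Q) ->
  r \in s -> mul_rels_on U r -> r \in mul_rels Q.
Proof.
move=> sQ sr [x [y [Ux Uy er]]]; rewrite er; apply: allpairs_f; apply: sQ => //.
  by apply: (lettersP (l := (true, x)) sr); rewrite er !inE eqxx.
by apply: (lettersP (l := (true, y)) sr); rewrite er !inE eqxx orbT.
Qed.

Lemma mul_rels_in Q L : (forall x, x \in Q -> L x) -> fin_subgroup Q ->
  rel_in L (list_rel (mul_rels Q)).
Proof.
move=> QL [_ QM] r /allpairsP[[x y] /= [Qx Qy ->]]; split=> l; rewrite !inE.
  by move=> /orP[/eqP->|/eqP->]; apply: QL.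
by move=> /eqP->; apply/QL/QM.
Qed.

Lemma fin_subgroup_filter Q (P : G -> Prop) : fin_subgroup Q -> subgroup P ->
  fin_subgroup [seq x <- Q | `[< P x >]].
Proof.
move=> [Q1 QM] sP; split.
  by rewrite mem_filter Q1 andbT; apply/asboolP; apply: subgroup1.
move=> x y; rewrite !mem_filter => /andP[/asboolP Px Qx] /andP[/asboolP Py Qy].
by rewrite QM // andbT; apply/asboolP; apply: subgroupM.
Qed.

Hypothesis gk : hd_le1_alt k G.

(** Elements common to Q1 and Q2 are the same letter, so the relations describe the amalgam over the
    intersection, free on all remaining letters. The lift on Q2 is conjugated by an element of M
    until it agrees with that on Q1 over the intersection. *)
Lemma amalgam_liftable Q1 Q2 : fin_subgroup Q1 -> fin_subgroup Q2 ->
  liftable k (list_rel (mul_rels Q1 ++ mul_rels Q2)).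
Proof.
move=> f1 f2 D j jS M F cF.
have j1 : {in Q1 &, forall x y, j (x * y) = j x * j y}.
  by apply/mul_relsP; apply: sat_sub jS => r; rewrite /list_rel mem_cat => ->.
have j2 : {in Q2 &, forall x y, j (x * y) = j x * j y}.
  by apply/mul_relsP; apply: sat_sub jS => r; rewrite /list_rel mem_cat orbC => ->.
have [s1 s1M] := fin_subgroup_lift cF f1 (inverts_fin_subgroup gk f1) j1.
have [s2 s2M] := fin_subgroup_lift cF f2 (inverts_fin_subgroup gk f2) j2.
pose C := [seq x <- Q1 | `[< x \in Q2 >]].
have CP x : x \in C <-> x \in Q1 /\ x \in Q2.
  by rewrite mem_filter; split=> [/andP[/asboolP]|[-> /asboolP ->]].
have fC : fin_subgroup C := fin_subgroup_filter f1 (fin_subgroup_subgroup f2).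
have [m mC] : exists m, {in C, forall x, ext_incl cF m * ext cF (s2 x) (j x) =
    ext cF (s1 x) (j x) * ext_incl cF m}.
  apply: (fin_subgroup_conj fC (inverts_fin_subgroup gk fC)).
    by move=> x y /CP[Q1x _] /CP[Q1y _]; apply: s1M.
  by move=> x y /CP[_ Q2x] /CP[_ Q2y]; apply: s2M.
pose i := ext_incl cF m.
pose e x := if x \in Q1 then ext cF (s1 x) (j x)
  else if x \in Q2 then i * ext cF (s2 x) (j x) * i^-1 else ext cF 0%R (j x).
have e1 x : x \in Q1 -> e x = ext cF (s1 x) (j x) by rewrite /e => ->.
have e2 x : x \in Q2 -> e x = i * ext cF (s2 x) (j x) * i^-1.
  rewrite /e => Q2x; case: ifP => Q1x; rewrite ?Q2x //.
  by rewrite mC ?mulgK //; apply/CP.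
exists e => [r|x].
  rewrite /list_rel mem_cat => /orP[|]; move: r; apply/mul_relsP => x y Qx Qy.
    by have [_ M1] := f1; rewrite !e1 ?s1M //; apply: M1.
  have [_ M2] := f2; rewrite !e2 ?s2M //; last exact: M2.
  by rewrite !mulgA mulgVK.
rewrite /e; case: ifP => // _; case: ifP => // _.
by rewrite !ext_sndM (mulmorV (@ext_sndM k D M F cF)) /= invg1 mulg1 mul1g.
Qed.

Definition conj_rel (t p q : G) : word G * word G :=
  ([:: (true, t); (true, p)], [:: (true, q); (true, t)]).
Definition conj_rels t P := [seq conj_rel t p (t * p * t^-1) | p <- P & t * p * t^-1 \in P].

(** The associated subgroups are P with t^-1 P t and P with t P t^-1, intersected. Because t lies
    outside P, its lift is still free to be corrected by an element of M. *)
Lemma HNN_liftable P t : fin_subgroup P -> t \notin P ->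
  liftable k (list_rel (mul_rels P ++ conj_rels t P)).
Proof.
move=> fP ntP D j jS M F cF.
have jM : {in P &, forall x y, j (x * y) = j x * j y}.
  by apply/mul_relsP; apply: sat_sub jS => r; rewrite /list_rel mem_cat => ->.
have jt p : p \in P -> t * p * t^-1 \in P -> j t * j p = j (t * p * t^-1) * j t.
  move=> Pp Pt; have := jS (conj_rel t p (t * p * t^-1)).
  rewrite /= /lit /= !mulg1; apply; rewrite /list_rel mem_cat; apply/orP; right.
  by apply/mapP; exists p => //; rewrite mem_filter Pp Pt.
have [s sM] := fin_subgroup_lift cF fP (inverts_fin_subgroup gk fP) jM.
pose C := [seq x <- P | `[< t^-1 * x * t \in P >]].
have CP x : x \in C <-> x \in P /\ t^-1 * x * t \in P.
  by rewrite mem_filter; split=> [/andP[/asboolP]|[-> /asboolP ->]].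
have fC : fin_subgroup C.
  apply: (fin_subgroup_filter fP).
  by have := subgroup_conj t^-1 (fin_subgroup_subgroup fP); rewrite invgK.
pose tt := ext cF 0%R (j t).
(* A second lift over C, obtained by conjugating s with an arbitrary lift of t. The element of M
   that carries it to s is the correction of that lift. *)
pose s' q := ext_fst (tt * ext cF (s (t^-1 * q * t)) (j (t^-1 * q * t)) * tt^-1).
have s'E q : q \in C ->
    ext cF (s' q) (j q) = tt * ext cF (s (t^-1 * q * t)) (j (t^-1 * q * t)) * tt^-1.
  move=> /CP[Pq Pt]; rewrite [RHS]ext_eta -/(s' q); congr (ext _ _ _).
  rewrite !ext_sndM (mulmorV (@ext_sndM k D M F cF)) /=.
  have e : t * (t^-1 * q * t) * t^-1 = q by rewrite !mulgA mulgV mul1g mulgK.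
  by rewrite jt ?e // mulgK.
have [m mC] : exists m, {in C, forall x, ext_incl cF m * ext cF (s' x) (j x) =
    ext cF (s x) (j x) * ext_incl cF m}.
  apply: (fin_subgroup_conj fC (inverts_fin_subgroup gk fC)).
    by move=> x y /CP[Px _] /CP[Py _]; apply: sM.
  move=> x y Cx Cy; have [_ CM] := fC; rewrite !s'E //; last exact: CM.
  have [[_ Px] [_ Py]] := ((CP x).1 Cx, (CP y).1 Cy).
  have e : t^-1 * (x * y) * t = (t^-1 * x * t) * (t^-1 * y * t).
    by rewrite !mulgA mulgK.
  by rewrite e sM // !mulgA mulgVK.
pose i := ext_incl cF m.
pose e x := if x \in P then ext cF (s x) (j x)
  else if x == t then i * tt else ext cF 0%R (j x).
have eP x : x \in P -> e x = ext cF (s x) (j x) by rewrite /e => ->.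
have et : e t = i * tt by rewrite /e (negbTE ntP) eqxx.
exists e => [r|x].
  rewrite /list_rel mem_cat => /orP[|/mapP[p]].
    move: r; apply/mul_relsP => x y Px Py.
    by have [_ M1] := fP; rewrite !eP ?sM //; apply: M1.
  rewrite mem_filter => /andP[Pt Pp] ->; rewrite /= /lit /= !mulg1 et !eP //.
  have e' : t^-1 * (t * p * t^-1) * t = p by rewrite !mulgA mulVg mul1g mulgVK.
  have Ct : t * p * t^-1 \in C by apply/CP; rewrite e'.
  by rewrite mulgA -mC // s'E // e' !mulgA mulgVK.
rewrite /e; case: ifP => // _; case: ifP => // /eqP ->.
by rewrite ext_sndM /= mul1g.
Qed.
End Core.

Local Open Scope group_scope.

(** * Presentations of groups acting on the integers *)

Section Presentations.
Variables (k : comNzRingType) (G : groupType) (T : G -> Prop).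
Hypotheses (gk : hd_le1_alt k G) (sT : subgroup T).
Implicit Types (H L : G -> Prop) (u v w : word G) (s : seq (word G * word G)).
Notation valid R := (@sat G G id R).

Section Conjugation.
Variables (K : groupType) (e : G -> K).
Hypothesis eT : forall x y, T x -> T y -> e (x * y) = e x * e y.

Lemma mul_on1 : e 1 = 1.
Proof.
by apply: (@mulgI _ (e 1)); rewrite -eT ?mulg1 //; apply: subgroup1.
Qed.

(** g normalizes T, and c conjugates e(T) as g conjugates T. The property passes to products and
    inverses, so elements of T can be moved past powers in G and in K simultaneously. *)
Definition conj_compat (g : G) (c : K) := forall p, T p ->
  [/\ T (g^-1 * p * g), T (g * p * g^-1) & e p * c = c * e (g^-1 * p * g)].

Lemma conj_compatM g c h d : conj_compat g c -> conj_compat h d -> conj_compat (g * h) (c * d).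
Proof.
move=> gc hd p Tp; have [Tg Tg' eg] := gc p Tp.
have [Th Th' eh] := hd _ Tg; have [_ T2 _] := hd p Tp; have [_ T3 _] := gc _ T2.
have -> : (g * h)^-1 * p * (g * h) = h^-1 * (g^-1 * p * g) * h by rewrite invgM !mulgA.
have -> : g * h * p * (g * h)^-1 = g * (h * p * h^-1) * g^-1 by rewrite invgM !mulgA.
by split=> //; rewrite mulgA eg -mulgA eh mulgA.
Qed.
Lemma conj_compatV g c : conj_compat g c -> conj_compat g^-1 c^-1.
Proof.
move=> gc p Tp; have [Tg Tg' _] := gc p Tp; rewrite invgK; split=> //.
have [_ _] := gc _ Tg'; rewrite !mulgA mulVg mul1g mulgVK => e'.
by apply: (canRL (mulKg c)); rewrite mulgA -e' mulgK.
Qed.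
Lemma conj_compat1 : conj_compat 1 1.
Proof. by move=> p Tp; rewrite !invg1 !mulg1 !mul1g. Qed.
Lemma conj_compatZ g c z : conj_compat g c -> conj_compat (zexpg g z) (zexpg c z).
Proof.
move=> gc; elim/int_ind: z => [|n IH|n IH]; first exact: conj_compat1.
  by rewrite PoszS !zexpgS; apply: conj_compatM.
rewrite (_ : (- n.+1%:Z)%R = (- n%:Z - 1)%R); last by lia.
by rewrite !zexpgP; apply: conj_compatM => //; apply: conj_compatV.
Qed.
End Conjugation.

Section HNN.
Variable t : G.
Hypotheses (tT : forall p, T p -> T (t^-1 * p * t)) (tT' : forall p, T p -> T (t * p * t^-1))
  (tfree : forall z, T (zexpg t z) -> z = 0%R) (lT : locally_finite T).
Let L x := T x \/ x = t.
Let Rc : relations G := fun r => mul_rels_on T r \/ exists p, T p /\ r = conj_rel t p (t * p * t^-1).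

(** Every word takes the same normal form t^z p, with p in T, in G and in K. If it is trivial in G,
    then t^z lies in T, so z = 0 and p = 1. *)
Lemma HNN_present (K : groupType) (e : G -> K) : sat e Rc ->
  forall u, word_in L u -> ev id u = 1 -> ev e u = 1.
Proof.
move=> eR.
have eT : forall x y, T x -> T y -> e (x * y) = e x * e y.
  by apply: mul_rels_onP; apply: sat_sub eR; left.
have ct : conj_compat e t (e t).
  move=> p Tp; split; [exact: tT|exact: tT'|].
  have := eR (conj_rel t (t^-1 * p * t) (t * (t^-1 * p * t) * t^-1)).
  rewrite !mulgA mulgV mul1g mulgK /= /lit /= !mulg1 => -> //; right.
  by exists (t^-1 * p * t); split; [apply: tT|rewrite !mulgA mulgV mul1g mulgK].
pose nf (x : G) (y : K) := exists z p, [/\ T p, x = zexpg t z * p & y = zexpg (e t) z * e p].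
have e11 := mul_on1 eT.
have eV p : T p -> e p^-1 = (e p)^-1.
  move=> Tp; apply: (@mulgI _ (e p)); rewrite -eT ?mulgV //; exact: (subgroupV sT).
have nfT p x y : T p -> nf x y -> nf (p * x) (e p * y).
  move=> Tp [z [q [Tq -> ->]]]; have [Tz _ ez] := conj_compatZ z ct Tp.
  exists z, ((zexpg t z)^-1 * p * zexpg t z * q).
  by rewrite eT // !mulgA ez mulgV mul1g; split=> //; apply: (subgroupM sT).
have nft z' x y : nf x y -> nf (zexpg t z' * x) (zexpg (e t) z' * y).
  by move=> [z [q [Tq -> ->]]]; exists (z' + z)%R, q; rewrite !zexpgD !mulgA.
have nfu u : word_in L u -> nf (ev id u) (ev e u).
  elim: u => [|[b x] u IH] Lu.
    by exists 0%R, 1; rewrite !zexpg0 e11 !mulg1; split=> //; apply: subgroup1.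
  have {}IH := IH (fun l ul => Lu l (mem_behead (s := (b, x) :: u) ul)).
  have [/= Tx|/= xt] := Lu _ (mem_head _ _); rewrite /= /lit /=.
    by case: b {Lu}; rewrite -?eV //; apply: nfT => //; apply: (subgroupV sT).
  rewrite xt; case: b {Lu}.
    by have := nft 1%R _ _ IH; rewrite !zexpg1.
  by have := nft (-1)%R _ _ IH; rewrite !zexpgN !zexpg1.
move=> u Lu; have [z [p [Tp -> ->]]] := nfu u Lu => ez.
have z0 : z = 0%R.
  apply: tfree; rewrite -(mulgK p (zexpg t z)) ez mul1g; exact: (subgroupV sT).
by move: ez; rewrite z0 !zexpg0 !mul1g => ->.
Qed.

(** Only a finite subgroup P of T that contains the T-letters of s is kept. Since t need not
    normalize P, one obtains an HNN extension in place of the semidirect product. *)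
Lemma HNN_finite s : (forall r, r \in s -> Rc r) -> exists s',
     [/\ forall r, r \in s -> r \in s', valid (list_rel s'), rel_in L (list_rel s') &
         liftable k (list_rel s')].
Proof.
move=> sR; have [P [fP PT sP]] := locally_finite_letters s lT.
have ntP : t \notin P.
  by apply/negP => /PT Tt; have := @tfree 1; rewrite zexpg1 => /(_ Tt).
exists (mul_rels P ++ conj_rels t P); split.
- move=> r sr; rewrite mem_cat; have [Mr|[p [Tp er]]] := sR r sr.
    by rewrite (mul_rels_on_letters sP sr Mr).
  apply/orP; right; apply/mapP; exists p; last exact: er.
  rewrite mem_filter; apply/andP; split; apply: sP; [|exact: tT'| |exact: Tp].
    by apply: (lettersP (l := (true, t * p * t^-1)) sr); rewrite er !inE eqxx !orbT.
  by apply: (lettersP (l := (true, p)) sr); rewrite er !inE eqxx !orbT.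
- move=> r; rewrite /list_rel mem_cat => /orP[|/mapP[p _ ->]].
    by move: r; apply/mul_relsP.
  by rewrite /= /lit /= !mulg1 mulgVK.
- move=> r; rewrite /list_rel mem_cat => /orP[|/mapP[p]].
    by move=> Pr; apply: (mul_rels_in _ fP Pr) => x /PT; left.
  rewrite mem_filter => /andP[/PT Tp' /PT Tp] ->; split=> l; rewrite !inE.
    by move=> /orP[/eqP->|/eqP->]; [right|left].
  by move=> /orP[/eqP->|/eqP->]; [left|right].
- exact: HNN_liftable.
Qed.
End HNN.

Section Amalgam.
Variables (s1 s2 : G).
Let U (s : G) x := T x \/ T (s^-1 * x).
Hypotheses (n1 : forall p, T p -> T (s1^-1 * p * s1) /\ T (s1 * p * s1^-1))
  (n2 : forall p, T p -> T (s2^-1 * p * s2) /\ T (s2 * p * s2^-1))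
  (q1 : T (s1 * s1)) (q2 : T (s2 * s2)).
Hypotheses (l1 : locally_finite (U s1)) (l2 : locally_finite (U s2)).
Variable t : G.
Hypothesis tE : t = s1^-1 * s2.
(** The alternatives s1 = s2 and s1 = s2 = 1 let one argument serve for an infinite dihedral
    quotient by T, a quotient of order two and a trivial quotient. *)
Hypotheses (free1 : forall z, T (zexpg t z) -> z = 0%R \/ s1 = s2)
  (free2 : forall z, T (s1 * zexpg t z) -> s1 = 1 /\ s2 = 1).
Let L x := U s1 x \/ U s2 x.
Let Rc : relations G := fun r => mul_rels_on (U s1) r \/ mul_rels_on (U s2) r.

(* Each letter keeps the normal form s1^b t^z p, with p in T. *)
Lemma amalgam_present (K : groupType) (e : G -> K) : sat e Rc ->
  forall u, word_in L u -> ev id u = 1 -> ev e u = 1.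
Proof.
move=> eR; have T1 := subgroup1 sT.
have eU1 : forall x y, U s1 x -> U s1 y -> e (x * y) = e x * e y.
  by apply: mul_rels_onP; apply: sat_sub eR; left.
have eU2 : forall x y, U s2 x -> U s2 y -> e (x * y) = e x * e y.
  by apply: mul_rels_onP; apply: sat_sub eR; right.
have eT x y : T x -> T y -> e (x * y) = e x * e y by move=> Tx Ty; apply: eU1; left.
have e11 := mul_on1 eT.
have Us (s : G) : U s s by right; rewrite mulVg.
have compat (s : G) : (forall p, T p -> T (s^-1 * p * s) /\ T (s * p * s^-1)) ->
    (forall x y, U s x -> U s y -> e (x * y) = e x * e y) -> conj_compat e s (e s).
  move=> ns es p Tp; have [Tp1 Tp2] := ns p Tp; split=> //.
  by rewrite -!es; [rewrite !mulgA mulgV mul1g| |left|left|]; try exact: Us.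
have c1 := compat _ n1 eU1; have c2 := compat _ n2 eU2.
have [tau tauE] : exists tau, tau = (e s1)^-1 * e s2 by exists ((e s1)^-1 * e s2).
have ct : conj_compat e t tau by rewrite tE tauE; apply: conj_compatM => //; apply: conj_compatV.
pose nf (x : G) (y : K) := exists (b : bool) z p, [/\ T p,
  x = (if b then s1 else 1) * zexpg t z * p & y = (if b then e s1 else 1) * zexpg tau z * e p].
have push (g : G) (c : K) p q : conj_compat e g c -> T p -> T q ->
    exists q', [/\ T q', p * (g * q) = g * q' & e p * (c * e q) = c * e q'].
  move=> gc Tp Tq; have [Tz _ ez] := gc _ Tp; exists (g^-1 * p * g * q).
  split; [exact: (subgroupM sT)|by rewrite !mulgA mulgV mul1g|].
  by rewrite eT // !mulgA ez.
have nfT p x y : T p -> nf x y -> nf (p * x) (e p * y).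
  move=> Tp [b [z [q [Tq -> ->]]]].
  have cb : conj_compat e (if b then s1 else 1) (if b then e s1 else 1).
    by case: b => //; apply: conj_compat1.
  have cbz := conj_compatM cb (conj_compatZ z ct).
  have [q' [Tq' eq' eq'']] := push _ _ p q cbz Tp Tq.
  by exists b, z, q'.
have es1 : e (s1 * s1) = e s1 * e s1 by apply: eU1.
have es2 : e (s2 * s2) = e s2 * e s2 by apply: eU2.
have zT z (p q : G) : T p -> T q ->
    nf (p * zexpg t z * q) (e p * zexpg tau z * e q).
  move=> Tp Tq; rewrite -!mulgA; apply: nfT => //.
  by exists false, z, q; rewrite !mul1g.
have nf1 x y : nf x y -> nf (s1 * x) (e s1 * y).
  move=> [[] [z [q [Tq -> ->]]]].
    by have := zT z _ _ q1 Tq; rewrite es1 !mulgA.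
  by exists true, z, q; rewrite !mul1g !mulgA.
have s2E : s2 = s1 * t by rewrite tE mulgA mulgV mul1g.
have e2E : e s2 = e s1 * tau by rewrite tauE mulgA mulgV mul1g.
have nf2 x y : nf x y -> nf (s2 * x) (e s2 * y).
  move=> [[] [z [q [Tq -> ->]]]].
    (* Here s2 s1 = s2^2 t^-1 with s2^2 in T, while in the other case s2 t^z = s1 t^(1 + z). *)
    have := zT (- 1 + z)%R _ _ q2 Tq; rewrite es2 !zexpgD !zexpgN !zexpg1.
    by rewrite {1}tE {1}tauE !invgM !invgK !mulgA !mulgK.
  exists true, (1 + z)%R, q; rewrite !mul1g !zexpgD !zexpg1 !mulgA.
  by rewrite -s2E -e2E.
have nfU (s : G) x y x' : (forall x y, U s x -> U s y -> e (x * y) = e x * e y) ->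
    (forall p, T p -> T (s^-1 * p * s) /\ T (s * p * s^-1)) ->
    (forall x y, nf x y -> nf (s * x) (e s * y)) -> U s x -> nf x' y ->
    nf (x * x') (e x * y).
  move=> es ns nfs [Tx|Tx] nfx; first exact: nfT.
  have -> : e x = e s * e (s^-1 * x) by rewrite -es ?mulVKg //; left.
  by rewrite -{1}(mulVKg s x) -!mulgA; apply: nfs; rewrite mulgA; apply: nfT.
have sU (s : G) : (forall p, T p -> T (s^-1 * p * s) /\ T (s * p * s^-1)) -> T (s * s) ->
    forall x, U s x -> U s x^-1.
  move=> ns qs x [Tx|Tx]; first by left; apply: (subgroupV sT).
  right; have := subgroupM sT (subgroupV sT qs) (ns _ (subgroupV sT Tx)).2.
  by rewrite !invgM invgK !mulgA !mulgVK mulgK.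
have UV (s : G) x : (forall x y, U s x -> U s y -> e (x * y) = e x * e y) ->
    U s x -> U s x^-1 -> e x^-1 = (e x)^-1.
  by move=> es Ux UVx; apply: (@mulgI _ (e x)); rewrite -es // !mulgV.
have nfu u : word_in L u -> nf (ev id u) (ev e u).
  elim: u => [|[b x] u IH] Lu.
    by exists false, 0%R, 1; rewrite !zexpg0 e11 !mulg1.
  have {}IH := IH (fun l ul => Lu l (mem_behead (s := (b, x) :: u) ul)).
  have [/= Ux|/= Ux] := Lu _ (mem_head _ _); rewrite /= /lit /=.
    have UVx := sU _ n1 q1 _ Ux.
    by case: b {Lu}; rewrite -?(UV s1) //; apply: nfU nf1 _ IH.
  have UVx := sU _ n2 q2 _ Ux.
  by case: b {Lu}; rewrite -?(UV s2) //; apply: nfU nf2 _ IH.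
move=> u Lu; have [b [z [p [Tp -> ->]]]] := nfu u Lu => ez.
have Tz : T ((if b then s1 else 1) * zexpg t z).
  by rewrite -(mulgK p (_ * zexpg t z)) ez mul1g; apply: (subgroupV sT).
have z1 (g : G) : g = 1 -> zexpg g z = 1.
  by move=> ->; case: (z) => n /=; rewrite expg1n ?invg1.
have z1K (g : K) : g = 1 -> zexpg g z = 1.
  by move=> ->; case: (z) => n /=; rewrite expg1n ?invg1.
case: b Tz ez => [/free2[e1' e2']|]; rewrite ?mul1g.
  have t1 : t = 1 by rewrite tE e1' e2' invg1 mulg1.
  have tau1 : tau = 1 by rewrite tauE e1' e2' e11 invg1 mulg1.
  by rewrite t1 tau1 e1' e11 !mul1g z1 // z1K // !mul1g => ->.
move=> /free1[-> |s12]; first by rewrite !zexpg0 !mul1g => ->.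
have t1 : t = 1 by rewrite tE s12 mulVg.
have tau1 : tau = 1 by rewrite tauE s12 mulVg.
by rewrite t1 tau1 z1 // z1K // !mul1g => ->.
Qed.

Lemma amalgam_finite s : (forall r, r \in s -> Rc r) -> exists s',
     [/\ forall r, r \in s -> r \in s', valid (list_rel s'), rel_in L (list_rel s') &
         liftable k (list_rel s')].
Proof.
move=> sR; have [Q1 [f1 QU1 sQ1]] := locally_finite_letters s l1.
have [Q2 [f2 QU2 sQ2]] := locally_finite_letters s l2.
exists (mul_rels Q1 ++ mul_rels Q2); split.
- move=> r sr; rewrite mem_cat; have [Mr|Mr] := sR r sr.
    by rewrite (mul_rels_on_letters sQ1 sr Mr).
  by rewrite (mul_rels_on_letters sQ2 sr Mr) orbT.
- by move=> r; rewrite /list_rel mem_cat => /orP[|]; move: r; apply/mul_relsP.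
- move=> r; rewrite /list_rel mem_cat => /orP[|].
    by move=> Qr; apply: (mul_rels_in _ f1 Qr) => x /QU1; left.
  by move=> Qr; apply: (mul_rels_in _ f2 Qr) => x /QU2; right.
- exact: amalgam_liftable.
Qed.
End Amalgam.
End Presentations.

Local Open Scope group_scope.

(** t attains the least positive value of c; by division with remainder this value generates the
    image. *)
Lemma min_positive_value (G : groupType) (P : G -> Prop) (c : G -> int) :
  subgroup P -> hom_on P c -> (exists2 x, P x & c x <> 0%R) ->
  exists t, [/\ P t, (0 < c t)%R & forall x, P x -> exists z, c x = (z * c t)%R].
Proof.
move=> sP cM [x Px cx].
have exn : exists n, `[< (0 < n)%N /\ exists2 y, P y & c y = Posz n >].
  exists (absz (c x)); apply/asboolP; split; first by rewrite absz_gt0; apply/eqP.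
  have [le|/ltW le] := lerP 0 (c x); first by exists x; rewrite ?gez0_abs.
  by exists x^-1; [apply: subgroupV|rewrite (hom_onV sP cM) // lez0_abs].
case: (ex_minnP exn) => n /asboolP[n0 [t Pt ct]] nmin.
exists t; split=> // [|y Py]; first by rewrite ct ltz_nat.
exists (c y %/ Posz n)%Z; rewrite ct.
have e := divz_eq (c y) (Posz n); rewrite {1}e.
suff -> : (c y %% Posz n)%Z = 0%R by rewrite addr0.
apply: contrapT => r0; have n0' : (Posz n != 0)%R by rewrite eqz_nat -lt0n.
have r_ge0 := modz_ge0 (c y) n0'; have r_lt := ltz_pmod (c y) (d := Posz n) n0.
have Pz := zexpg_subgroup (- (c y %/ Posz n)%Z)%R sP Pt.
suff : (n <= absz (c y %% Posz n)%Z)%N by rewrite leqNgt -ltz_nat gez0_abs // r_lt.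
apply: nmin; apply/asboolP; split; first by rewrite absz_gt0; apply/eqP.
exists (y * zexpg t (- (c y %/ Posz n)%Z)%R); first exact: subgroupM.
rewrite cM // (hom_onZ sP cM) // ct gez0_abs // {1}e; lia.
Qed.

(** * The colimit *)

Section Key.
Variables (k : comNzRingType) (G : groupType).
Hypotheses (gk : hd_le1_alt k G) (lG : locally_rank_le1 (fun _ : G => True)).
Notation valid R := (@sat G G id R).
Implicit Types (s : seq (word G * word G)).

(** The group H generated by the letters of s acts on the integers by x -> c(h) + eps(h) x, and T is
    the locally finite kernel. The image is infinite dihedral, infinite cyclic, of order two or
    trivial; the infinite cyclic case uses an HNN extension, the others an amalgam. *)
Theorem liftable_approximation s : valid (list_rel s) -> exists s',
  [/\ valid (list_rel s'), forall r, r \in s -> entails (list_rel s') r.1 r.2 &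
      liftable k (list_rel s')].
Proof.
move=> vs; pose X := letters s; pose H := gen X; have sH : subgroup H := gen_subgroup X.
have sInH : rel_in H (list_rel s).
  move=> r sr; split=> l rl; apply: mem_gen; apply: (lettersP sr).
    by rewrite mem_cat rl.
  by rewrite mem_cat rl orbT.
have [|K [f [sK fM lK cK]]] := lG (X := X); first by [].
have [c [eps [eps_pm epsM cM lT]]] := transfer sK fM lK cK.
pose T x := [/\ H x, eps x = 1%R & c x = 0%R].
have H1 : H 1 := subgroup1 sH.
have eps1 : eps 1 = 1%R by have := epsM _ _ H1 H1; rewrite mulg1; case: (eps_pm 1 H1) => ->.
have c1 : c 1 = 0%R by have := cM _ _ H1 H1; rewrite mulg1 eps1; lia.
have HV x : H x -> H x^-1 by apply: subgroupV.
have HM x y : H x -> H y -> H (x * y) by apply: subgroupM.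
have epsV x : H x -> eps x^-1 = eps x.
  move=> Hx; have := epsM _ _ (HV x Hx) Hx; rewrite mulVg eps1.
  by case: (eps_pm x Hx) => ->; case: (eps_pm _ (HV x Hx)) => ->.
have cV x : H x -> c x^-1 = (- (eps x * c x))%R.
  move=> Hx; have := cM _ _ (HV x Hx) Hx; rewrite mulVg c1 epsV //; lia.
have sP : subgroup (fun x => H x /\ eps x = 1%R).
  split=> [//|x y [Hx ex] [Hy ey]|x [Hx ex]]; split; auto.
    by rewrite epsM // ex ey.
  by rewrite epsV.
have cP : hom_on (fun x => H x /\ eps x = 1%R) c.
  by move=> x y [Hx ex] [Hy ey]; rewrite cM // ex mul1r.
have sT : subgroup T.
  split=> [//|x y [Hx ex cx] [Hy ey cy]|x [Hx ex cx]]; split; auto.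
  - by rewrite epsM // ex ey.
  - by rewrite cM // cx cy mulr0.
  - by rewrite epsV.
  - by rewrite cV // cx mulr0 oppr0.
have nT h p : H h -> T p -> T (h * p * h^-1).
  move=> Hh [Hp ep cp]; have Hhp := HM _ _ Hh Hp; have HhV := HV _ Hh.
  split; first exact: HM.
    by rewrite (epsM _ _ Hhp HhV) (epsM _ _ Hh Hp) ep epsV //; case: (eps_pm h Hh) => ->.
  rewrite (cM _ _ Hhp HhV) (cM _ _ Hh Hp) cp (cV _ Hh) (epsM _ _ Hh Hp) ep.
  by case: (eps_pm h Hh) => ->; lia.
have nT2 h : H h -> forall p, T p -> T (h^-1 * p * h) /\ T (h * p * h^-1).
  move=> Hh p Tp; split; last exact: nT.
  by have := nT _ _ (HV _ Hh) Tp; rewrite invgK.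
have lU h : H h -> T (h * h) -> locally_finite (fun x => T x \/ T (h^-1 * x)).
  move=> Hh Thh; pose U x := T x \/ T (h^-1 * x).
  have sU : subgroup U.
    split=> [|x y [Tx|Tx] [Ty|Ty]|x [Tx|Tx]].
    - by left; apply: subgroup1.
    - by left; apply: subgroupM.
    - right; have [Tx' _] := nT2 h Hh x Tx.
      by have := subgroupM sT Tx' Ty; rewrite !mulgA mulgK.
    - by right; rewrite mulgA; apply: subgroupM.
    - left; have [_ Tx'] := nT2 h Hh _ Tx.
      have := subgroupM sT (subgroupM sT Tx' Thh) Ty.
      by rewrite !mulgA mulgV mul1g mulgVK mulgK.
    - by left; apply: subgroupV.
    - right; have [_ Tx'] := nT2 h Hh _ (subgroupV sT Tx).
      have := subgroupM sT (subgroupV sT Thh) Tx'.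
      by rewrite !invgM invgK !mulgA mulgVK mulgK.
  apply: (locally_finite_covered sU sT).
    exists [:: 1; h] => x [Tx|Tx]; first by exists 1; rewrite ?inE ?eqxx // invg1 mulg1.
    exists h; first by rewrite !inE eqxx orbT.
    by have [_] := nT2 h Hh _ Tx; rewrite !mulgA mulgV mul1g.
  by apply: locally_finiteS lT => [|x [_ Tx]//]; apply: subgroupI.
have amalgam (s1 s2 t : G) : H s1 -> H s2 -> T (s1 * s1) -> T (s2 * s2) -> t = s1^-1 * s2 ->
    (forall z, T (zexpg t z) -> z = 0%R \/ s1 = s2) ->
    (forall z, T (s1 * zexpg t z) -> s1 = 1 /\ s2 = 1) ->
    (forall x, H x -> exists z, T ((zexpg t z)^-1 * x) \/ T ((zexpg t z)^-1 * (s1^-1 * x))) ->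
    exists s', [/\ valid (list_rel s'),
      forall r, r \in s -> entails (list_rel s') r.1 r.2 & liftable k (list_rel s')].
  move=> Hs1 Hs2 T1 T2 tE free1 free2 span.
  pose L x := (T x \/ T (s1^-1 * x)) \/ (T x \/ T (s2^-1 * x)).
  have sE := expressible_subgroup L.
  have Es1 : expressible L s1.
    by apply: expressible_letter; left; right; rewrite mulVg; apply: subgroup1.
  have Es2 : expressible L s2.
    by apply: expressible_letter; right; right; rewrite mulVg; apply: subgroup1.
  have Et z : expressible L (zexpg t z).
    by apply: zexpg_subgroup => //; rewrite tE; apply: subgroupM => //; apply: subgroupV.
  apply: (approximation_of_presentation (H := H) (L := L) _ (amalgam_present sT (nT2 _ Hs1) (nT2 _ Hs2) T1 T2
    tE free1 free2) (amalgam_finite gk (lU _ Hs1 T1) (lU _ Hs2 T2)) vs sInH).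
  move=> x Hx; have [z [Tz|Tz]] := span x Hx.
    rewrite -(mulVKg (zexpg t z) x); apply: subgroupM => //.
    by apply: expressible_letter; left; left.
  rewrite -(mulVKg s1 x) -(mulVKg (zexpg t z) (s1^-1 * x)).
  apply: subgroupM => //; apply: subgroupM => //.
  by apply: expressible_letter; left; left.
have [[t0 [Ht0 et0] ct0]|c0] := pselect (exists2 x, H x /\ eps x = 1%R & c x <> 0%R).
  have [|t [[Ht et] ct_gt0 cz]] := min_positive_value sP cP; first by exists t0.
  have free z : T (zexpg t z) -> z = 0%R.
    by move=> [_ _]; rewrite (hom_onZ sP cP) //; nia.
  have span x : H x -> eps x = 1%R -> exists z, T ((zexpg t z)^-1 * x).
    move=> Hx ex; have [z ez] := cz x (conj Hx ex); exists z; rewrite -zexpgN.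
    have [Hz e_z] := zexpg_subgroup (- z)%R sP (conj Ht et).
    by split; [auto|rewrite epsM // ex e_z|rewrite cM // e_z (hom_onZ sP cP) // ez; lia].
  (* If h is a reflection, the image is infinite dihedral, generated by the reflections h and h t.
     The square of a reflection lies in T. *)
  have [[h Hh eh]|noh] := pselect (exists2 h, H h & eps h = (-1)%R).
    have Tsq x : H x -> eps x = (-1)%R -> T (x * x).
      move=> Hx ex; split; auto; first by rewrite epsM // ex.
      by rewrite cM // ex; lia.
    have Hht := HM _ _ Hh Ht; have eht : eps (h * t) = (-1)%R by rewrite epsM // eh et.
    apply: (amalgam h (h * t) t Hh Hht (Tsq _ Hh eh) (Tsq _ Hht eht)) => [|z /free|z [_]|x Hx].
    - by rewrite mulKg.
    - by left.
    - have [Hz e_z] := zexpg_subgroup z sP (conj Ht et).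
      by rewrite epsM // eh e_z.
    - have [ex|ex] := eps_pm x Hx.
        by have [z Tz] := span x Hx ex; exists z; left.
      have HhV := HV _ Hh; have [||z Tz] := span (h^-1 * x); first exact: HM.
        by rewrite (epsM _ _ HhV Hx) epsV // eh ex.
      by exists z; right.
  have eall x : H x -> eps x = 1%R.
    by move=> Hx; case: (eps_pm x Hx) => // ex; case: noh; exists x.
  pose L x := T x \/ x = t.
  have sE := expressible_subgroup L.
  have tT p : T p -> T (t^-1 * p * t) by case/(nT2 t Ht).
  have tT' p : T p -> T (t * p * t^-1) by case/(nT2 t Ht).
  apply: (approximation_of_presentation (H := H) (L := L) _ (HNN_present sT tT tT' free)
    (HNN_finite gk tT' free lT) vs sInH).
  move=> x Hx; have [z Tz] := span x Hx (eall x Hx).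
  rewrite -(mulVKg (zexpg t z) x); apply: subgroupM => //.
    by apply: zexpg_subgroup => //; apply: expressible_letter; right.
  by apply: expressible_letter; left.
have Tall x : H x -> eps x = 1%R -> T x.
  by move=> Hx ex; split=> //; apply: contrapT => cx; apply: c0; exists x.
have zexp1 z : zexpg (1 : G) z = 1 by case: z => n /=; rewrite expg1n ?invg1.
(* There are no translations left: the image has order two, and both factors of the amalgam are T
   together with h T. *)
have [[h Hh eh]|noh] := pselect (exists2 h, H h & eps h = (-1)%R).
  have Thh : T (h * h) by apply: Tall; [apply: HM|rewrite epsM // eh].
  apply: (amalgam h h 1 Hh Hh Thh Thh) => [|z _|z [_]|x Hx]; first by rewrite mulVg.
  - by right.
  - by rewrite zexp1 mulg1 eh.
  exists 0%R; rewrite zexpg0 invg1 !mul1g.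
  have [ex|ex] := eps_pm x Hx; first by left; apply: Tall.
  have HhV := HV _ Hh; right; apply: Tall; first exact: HM.
  by rewrite (epsM _ _ HhV Hx) epsV // eh ex.
(* Here H = T, treated as an amalgam of T with itself. *)
have T1 : T (1 * 1) by rewrite mulg1.
apply: (amalgam 1 1 1 H1 H1 T1 T1) => [|z _|//|x Hx]; rewrite ?mulg1 ?invg1 //; first by right.
exists 0%R; rewrite zexpg0 invg1 !mul1g; left; apply: Tall => //.
by case: (eps_pm x Hx) => // ex; case: noh; exists x.
Qed.

Definition approx := {s : seq (word G * word G) | valid (list_rel s) /\ liftable k (list_rel s)}.
(** The condition for a homomorphism that fixes every letter. As a proposition it makes the category
    a preorder, so parallel arrows are equal. *)
Definition approx_hom (i j : approx) : Prop :=
  forall r, r \in sval i -> entails (list_rel (sval j)) r.1 r.2.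
Lemma approx_id i : approx_hom i i. Proof. by move=> r ir K e; apply. Qed.
Lemma approx_comp i j l : approx_hom j l -> approx_hom i j -> approx_hom i l.
Proof. by move=> jl ij r ir K e el; apply: ij => // r' jr'; apply: jl. Qed.
Definition approx_category : category := @Category approx approx_hom (@approx_id) (@approx_comp)
  (fun _ _ _ => Prop_irrelevance _ _) (fun _ _ _ => Prop_irrelevance _ _)
  (fun _ _ _ _ _ _ _ => Prop_irrelevance _ _).

Definition approx_group (i : approx) := presented (list_rel (sval i)).
Definition approx_letter (i : approx) : G -> approx_group i := qletter (entails_cong (list_rel (sval i))).

Lemma approx_map_proof i j (u : approx_hom i j) v w :
  entails (list_rel (sval i)) v w -> ev (@approx_letter j) v = ev (@approx_letter j) w.
Proof.
move=> vw; apply: vw => r ir; rewrite !ev_qletter; apply/qpiP; exact: u.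
Qed.
Definition approx_map i j (u : approx_hom i j) :
  {multiplicative approx_group i -> approx_group j} := qlift (approx_map_proof u).
Lemma approx_map_pi i j (u : approx_hom i j) w :
  approx_map u (qpi _ w) = qpi (entails_cong (list_rel (sval j))) w.
Proof. by rewrite /approx_map /= qlift_pi ev_qletter. Qed.

Lemma approx_map1 i x : approx_map (@approx_id i) x = x.
Proof. by rewrite -(qwordK x) approx_map_pi. Qed.
Lemma approx_mapM i j l (v : approx_hom j l) (u : approx_hom i j) x :
  approx_map (approx_comp v u) x = approx_map v (approx_map u x).
Proof. by rewrite -(qwordK x) !approx_map_pi. Qed.
Definition approx_system : group_system approx_category :=
  @GroupSystem approx_category (fun i => approx_group i : groupType) approx_map
    approx_map1 approx_mapM.

Lemma approx_iota_proof (i : approx) v w :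
  entails (list_rel (sval i)) v w -> ev (@id G) v = ev id w.
Proof. by move=> vw; apply: vw; case: (svalP i). Qed.
Definition approx_iota (i : approx) : {multiplicative approx_group i -> G} :=
  qlift (@approx_iota_proof i).
Lemma approx_iota_pi i w : approx_iota i (qpi _ w) = ev id w.
Proof. by rewrite /approx_iota /= qlift_pi. Qed.

Lemma approx_ex s : valid (list_rel s) -> exists i : approx,
  forall r, r \in s -> entails (list_rel (sval i)) r.1 r.2.
Proof.
by move=> /liftable_approximation[s' [vs' ss' ls']]; exists (exist _ s' (conj vs' ls')).
Qed.

Lemma approx_ub i j : exists l, approx_hom i l /\ approx_hom j l.
Proof.
have [|l lP] := @approx_ex (sval i ++ sval j).
  move=> r; rewrite /list_rel mem_cat => /orP[] h.
    by case: (svalP i) => + _; apply.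
  by case: (svalP j) => + _; apply.
by exists l; split=> r ir; apply: lP; rewrite mem_cat ir ?orbT.
Qed.

(** Any equation between words that is valid in G already holds at some later stage: this is the
    injectivity half of the colimit property. *)
Lemma approx_ub_rel i u v : ev (@id G) u = ev id v ->
  exists l, approx_hom i l /\ entails (list_rel (sval l)) u v.
Proof.
move=> uv; have [|l lP] := @approx_ex ((u, v) :: sval i).
  move=> r; rewrite /list_rel inE => /orP[/eqP->//|].
  by case: (svalP i) => + _; apply.
exists l; split=> [r ir|]; first by apply: lP; rewrite inE ir orbT.
exact: lP (mem_head _ _).
Qed.

Lemma approx_filtered : filtered approx_category.
Proof.
split=> [|i j|i j u v].
- by have [|i _] := @approx_ex [::]; last by exists i.
- by have [l [il jl]] := approx_ub i j; exists l.
- by exists j, (@approx_id j); exact: (@Prop_irrelevance (approx_hom i j)).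
Qed.

(** The mediating map is read off from the letters at one stage. Since true equations between words
    hold at a later stage, it is multiplicative and independent of the stage. *)
Lemma approx_colimit : @is_colimit approx_category approx_system G approx_iota.
Proof.
split=> [i j u x|H f fc].
  rewrite /= -(qwordK x) [LHS](_ : _ = approx_iota j (approx_map u (qpi _ (qword x)))) //.
  by rewrite approx_map_pi !approx_iota_pi.
have [i0 _] : exists i : approx, True by have [|i _] := @approx_ex [::]; last by exists i.
have fE (i j : approx) (u : approx_hom i j) w : f i (qpi _ w) = f j (qpi _ w).
  by rewrite -(fc i j u) /= -[approx_map _ _]/(approx_map u _) approx_map_pi.
have fev i j v w : ev (@id G) v = ev id w -> f i (qpi _ v) = f j (qpi _ w).
  move=> vw; have [l [il jl]] := approx_ub i j; have [m [lm vwm]] := approx_ub_rel l vw.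
  rewrite (fE i m) ?(fE j m); try by apply: approx_comp lm _.
  by congr (f m _); apply/qpiP.
pose u g := f i0 (qpi _ [:: (true, g)]).
have uE i w : u (ev id w) = f i (qpi _ w) by apply: fev; rewrite ev_letter.
have uM : {morph u : x y / x * y}.
  move=> x y; rewrite /u -(gmulfM (s := f i0)) -qpiM; apply: fev.
  by rewrite /= /lit /= !mulg1.
pose uu : {multiplicative G -> H} := HB.pack u (isMultiplicative.Build G H u uM).
exists uu; split=> [i x|v vf g] /=.
  by rewrite -(qwordK x) approx_iota_pi (uE i).
by rewrite /u -vf /= approx_iota_pi ev_letter.
Qed.
End Key.

Local Close Scope group_scope.

Theorem mainTheorem3 (k : comNzRingType) (G : groupType) :
  elementary_amenable G -> dim_le (hd k G) 1 ->
  exists (I : category) (D : group_system I)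
    (iota : forall i : I, {multiplicative D i -> G}),
    [/\ filtered I, is_colimit iota & forall i : I, dim_le (cd k (D i)) 1].
Proof.
move=> eG /hd_le1P gk; have lG := hd_le1_locally_rank_le1 eG gk.
exists (approx_category k G), (approx_system k G), (@approx_iota k G).
split; [exact: approx_filtered|exact: approx_colimit|].
by move=> i; apply: liftable_cd; case: (svalP i).
Qed.
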